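(* Let $\mu$ be a positive Borel measure on the unit circle $\mathbb{T}$, singular with respect to Lebesgue measure, and let $S_\mu$ be the associated singular inner function. If $S_\mu$ is cyclic in $D^p_{p-1}$ for some $p>2$, then $\mu(E)=0$ for every Beurling-Carleson set $E\subset\mathbb{T}$.
   Context: $\mathbb{D}$ is the open unit disc. The singular inner function associated with $\mu$ is $$S_\mu(z)=\exp\left\{-\int_0^{2\pi}\frac{e^{i\theta}+z}{e^{i\theta}-z}\,d\mu(\theta)\right\},\qquad z\in\mathbb{D}.$$ $D^p_{p-1}$ is the space of analytic functions $f$ on $\mathbb{D}$ with $$\|f\|_{D^p_{p-1}}=|f(0)|+\left(\int_{\mathbb{D}}(1-|z|)^{p-1}|f'(z)|^p\,dA(z)\right)^{1/p}<\infty,$$ where $dA$ is area measure. A function $f\in D^p_{p-1}$ is cyclic in $D^p_{p-1}$ if there is a sequence of polynomials $(p_n)$ such that $\|p_nf-1\|_{D^p_{p-1}}\to0$. A closed set $E\subset\mathbb{T}$ is a Beurling-Carleson set if it has zero Lebesgue measure and $\sum_n|I_n|\log\frac{1}{|I_n|}<\infty$, where $\mathbb{T}\setminus E$ is the disjoint union of the open intervals (arcs) $(I_n)_n$ and $|\cdot|$ denotes Lebesgue measure on $\mathbb{T}$. *)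

(* Defs.v *)
From HB Require Import structures.
From mathcomp Require Import all_boot all_order all_algebra.
From mathcomp Require Import complex.
From mathcomp Require Import all_classical all_reals all_analysis.

Set Implicit Arguments.
Unset Strict Implicit.
Unset Printing Implicit Defensive.

Import Order.TTheory GRing.Theory Num.Theory.
Import numFieldNormedType.Exports.

Local Open Scope classical_set_scope.
Local Open Scope complex_scope.
Local Open Scope ring_scope.

(* The complex plane is [R[i]^o]: [R[i]] with its topology and its structure
   of normed space over itself, so that [derivable f z 1] and [derive1 f z]
   are complex differentiability and the complex derivative. The norm [`|z|]
   of that structure has values in [R[i]]; [complex_modulus] is real valued. *)
Definition complex_modulus (R : realType) (z : R[i]) : R := complex.Re `|z|.

Definition unit_disc (R : realType) : set R[i] :=
  [set z | complex_modulus z < 1].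

Definition unit_circle (R : realType) : set R[i] :=
  [set z | complex_modulus z = 1].

Definition expi (R : realType) (t : R) : R[i] := cos t +i* sin t.

Definition cexp (R : realType) (z : R[i]) : R[i] :=
  (expR (complex.Re z))%:C * expi (complex.Im z).

(* The complex plane with its Borel sigma-algebra. *)
Notation borelC R := (g_sigma_algebraType (@open (R[i])^o)).

Definition circle_lebesgue (R : realType) (A : set R[i]) : \bar R :=
  lebesgue_measure [set t : R | 0 <= t < 2 * pi /\ A (expi t)].

(* A Borel measure on the circle is a Borel measure [mu] on the plane with
   [mu (~` unit_circle) = 0]. *)
Definition circle_singular (R : realType)
    (mu : {measure set (borelC R) -> \bar R}) : Prop :=
  exists N : set (borelC R),
    [/\ measurable N, N `<=` @unit_circle R,
        circle_lebesgue N = 0%E & mu (@unit_circle R `\` N) = 0%E].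

Definition cintegral (R : realType) (mu : {measure set (borelC R) -> \bar R})
    (A : set R[i]) (g : R[i] -> R[i]) : R[i] :=
  Rintegral mu A (fun x => complex.Re (g x))
  +i* Rintegral mu A (fun x => complex.Im (g x)).

Definition singular_inner (R : realType)
    (mu : {measure set (borelC R) -> \bar R}) (z : R[i]^o) : R[i]^o :=
  cexp (- cintegral mu (@unit_circle R) (fun w => (w + z) / (w - z))).

Definition analytic_on_disc (R : realType) (f : R[i]^o -> R[i]^o) : Prop :=
  forall z, unit_disc z -> derivable f z 1.

Definition Dnorm (R : realType) (p : R) (f : R[i]^o -> R[i]^o) : \bar R :=
  ((complex_modulus (f 0%R))%:E +
   (\int[lebesgue_measure \x lebesgue_measure]_(w in
        [set w : R * R | unit_disc (w.1 +i* w.2)])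
      ((1 - complex_modulus (w.1 +i* w.2)) `^ (p - 1) *
       complex_modulus (derive1 f (w.1 +i* w.2)) `^ p)%:E) `^ p^-1)%E.

Definition in_D (R : realType) (p : R) (f : R[i]^o -> R[i]^o) : Prop :=
  analytic_on_disc f /\ (Dnorm p f < +oo)%E.

Definition cyclic_in_D (R : realType) (p : R) (f : R[i]^o -> R[i]^o) : Prop :=
  in_D p f /\
  exists P : nat -> {poly R[i]},
    Dnorm p (fun z => (P n).[z] * f z - 1) @[n --> \oo] --> 0%E.

Definition circle_arc (R : realType) (a b : R) : set R[i] :=
  [set expi t | t in `]a, b[].

(* The family of complementary arcs may be finite or infinite, whence the
   index set [N]. As at most finitely many arcs have length greater than 1,
   the series has only finitely many negative terms, and it has a sum
   [< +oo] if and only if it is (absolutely) summable. *)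
Definition beurling_carleson (R : realType) (E : set R[i]) : Prop :=
  [/\ @closed R[i]^o E, E `<=` @unit_circle R, circle_lebesgue E = 0%E &
    exists (N : set nat) (a b : nat -> R),
      [/\ forall n, N n -> a n < b n <= a n + 2 * pi,
          trivIset N (fun n => circle_arc (a n) (b n)),
          @unit_circle R `\` E = \bigcup_(n in N) circle_arc (a n) (b n) &
          summable N (fun n => ((b n - a n) * ln (b n - a n)^-1)%:E)]].

(* Main.v *)
Require Import Defs.
From HB Require Import structures.
From mathcomp Require Import all_boot all_order all_algebra.
From mathcomp Require Import complex.
From mathcomp Require Import all_classical all_reals all_analysis.
From mathcomp Require Import measurable_realfun ring lra.

Set Implicit Arguments.
Unset Strict Implicit.
Unset Printing Implicit Defensive.

Import Order.TTheory GRing.Theory Num.Theory.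
Import numFieldNormedType.Exports.

Local Open Scope classical_set_scope.
Local Open Scope complex_scope.
Local Open Scope ring_scope.

(** Let [T] be the unit circle, and let [nu] and [sigma] be the restrictions of
    [mu] to [E] and to its complement in [T]. With [P[m]] for the Poisson
    integral of [m], the modulus of the singular inner function [S] is
    [exp (- P[nu] - P[sigma])]. The proof shows that near [E] the potential
    [P[nu]] is at most the Poisson integral of an integrable function, and
    deduces that [nu] has no mass on the null set [E].

    Let [P_n] be polynomials with [P_n S -> 1] in the space. For [p > 2] an
    estimate in the manner of Morrey, where the derivative is integrated along
    the segments of two cones with vertices [0] and [z] (the lemma
    [growth_bound]), shows that [|P_n S| <= C (1 - |z|) ^ -k] for all large [n],
    with [C] and [k] independent of [n] ([cyclic_growth]), and that
    [|P_n S| >= 1 / 2] at any given point for all large [n] ([cyclic_lower]).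

    The condition of Beurling and Carleson is what makes the logarithm of the
    distance to [E] integrable on [T] ([integrable_log_dist]). A multiple of it
    is an integrable function [psi] such that [P[psi]] is at least
    [- k ln (1 - |z|)] when the distance from [z] to [E] is at most a multiple of
    the square root of [1 - |z|] ([log_potential_ge]). Consider the region of
    the disc where some Poisson kernel with pole in [E] exceeds [1]. On its
    boundary inside the disc, [P[nu] <= nu E]; hence
    [|P_n| exp (- P[sigma]) <= C' (1 - |z|) ^ -k] there, and
    [|P_n| exp (- P[sigma] - P[psi])] is bounded. As the logarithm of this
    function is subharmonic, the bound holds in the whole region, uniformly in
    [n] ([polynomial_bound]). Comparing it with the lower bound for [|P_n S|]
    yields [P[nu] <= P[psi] + c] in the region, and [c] is absorbed by [psi]
    ([potential_dominated]).

    Divide the circle into [2 ^ j] arcs of length [t], and let [z_i] be the point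
    at distance [t] from the circle near the [i]-th arc. If this arc is close to
    [E], then [z_i] is in the region and a neighbourhood of the arc has
    [nu]-measure at most [4 t P[nu](z_i) <= 4 t P[psi](z_i)]. So [nu E] is at most
    the integral of [4 psi] against the sum of the kernels [t Poisson(z_i, .)]
    over these arcs. This sum is bounded, since the Poisson kernels of a regular
    polygon add up to a single one ([sum_poisson_roots]), and it tends to zero
    off [E]. As [E] is a null set, [nu E = 0] by dominated convergence
    ([measure_vanishes]).

    Subharmonicity is only used through the values at four points
    [z + 'i ^ j h], on which the error terms are explicit ([herglotz4],
    [sub4_factor]); this is all that the maximum principle needs. *)

(** * The modulus and the exponential in the complex plane *)

Section Basics.
Variable R : realType.
Implicit Types (z w : R[i]) (x y : R).
Local Notation cm := (@complex_modulus R).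
Local Notation Re := complex.Re.
Local Notation Im := complex.Im.

Lemma normcE z : `|z| = (cm z)%:C.
Proof. by rewrite /complex_modulus normc_def. Qed.

Lemma cmodE z : cm z = Num.sqrt (Re z ^+ 2 + Im z ^+ 2).
Proof. by rewrite /complex_modulus normc_def. Qed.

Lemma cmod_sq z : cm z ^+ 2 = Re z ^+ 2 + Im z ^+ 2.
Proof. by rewrite cmodE sqr_sqrtr // addr_ge0 ?sqr_ge0. Qed.

Lemma cmod_ge0 z : 0 <= cm z.
Proof. by rewrite cmodE sqrtr_ge0. Qed.

Lemma cmod_real x : cm x%:C = `|x|.
Proof. by rewrite cmodE /= expr0n addr0 sqrtr_sqr. Qed.

Lemma cmodM z w : cm (z * w) = cm z * cm w.
Proof. by apply: complexI; rewrite -normcE normrM !normcE -rmorphM. Qed.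

Lemma cmod0 : cm 0 = 0.
Proof. by rewrite /complex_modulus normr0. Qed.

Lemma cmod1 : cm 1 = 1.
Proof. by rewrite /complex_modulus normr1. Qed.

Lemma cmodV z : cm z^-1 = (cm z)^-1.
Proof. by apply: complexI; rewrite -normcE normfV normcE fmorphV. Qed.

Lemma cmod_div z w : cm (z / w) = cm z / cm w.
Proof. by rewrite cmodM cmodV. Qed.

Lemma cmodX z n : cm (z ^+ n) = cm z ^+ n.
Proof. by elim: n => [|n IH]; rewrite ?expr0 ?cmod1 // !exprS cmodM IH. Qed.

Lemma cmodD z w : cm (z + w) <= cm z + cm w.
Proof.
by have := ler_normD z w; rewrite !normcE -rmorphD lecR.
Qed.

Lemma cmodN z : cm (- z) = cm z.
Proof. by rewrite /complex_modulus normrN. Qed.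

Lemma cmodC z w : cm (z - w) = cm (w - z).
Proof. by rewrite -cmodN opprB. Qed.

Lemma cmodB z w : cm (z - w) <= cm z + cm w.
Proof. by rewrite -(cmodN w) cmodD. Qed.

Lemma cmodB_ge z w : cm z - cm w <= cm (z - w).
Proof. by rewrite lerBlDr -{1}(subrK w z) cmodD. Qed.

Lemma cmod_tri v z w : cm (z - w) <= cm (z - v) + cm (v - w).
Proof. by rewrite -{1}(subrK v z) -addrA cmodD. Qed.

Lemma cmod_Re z : `|Re z| <= cm z.
Proof. by rewrite cmodE -sqrtr_sqr ler_wsqrtr // lerDl sqr_ge0. Qed.

Lemma cmod_Im z : `|Im z| <= cm z.
Proof. by rewrite cmodE -sqrtr_sqr ler_wsqrtr // lerDr sqr_ge0. Qed.

Lemma cmod_le_ReIm z : cm z <= `|Re z| + `|Im z|.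
Proof.
rewrite cmodE -[leRHS]ger0_norm ?addr_ge0 // -sqrtr_sqr ler_wsqrtr //.
by rewrite sqrrD !real_normK ?num_real // lerD2r lerDl mulrn_wge0 // mulr_ge0.
Qed.

Lemma cmod_eq0 z : (cm z == 0) = (z == 0).
Proof. by rewrite -(inj_eq (@complexI R)) -normcE normr_eq0. Qed.

Lemma cmod_gt0 z : (0 < cm z) = (z != 0).
Proof. by rewrite lt_def cmod_ge0 andbT cmod_eq0. Qed.

Lemma cmod_nat n : cm n%:R = n%:R.
Proof. by rewrite -[n%:R in LHS](rmorph_nat (real_complex R)) cmod_real normr_nat. Qed.

Lemma ReD z w : Re (z + w) = Re z + Re w. Proof. by case: z w => [? ?] []. Qed.
Lemma ImD z w : Im (z + w) = Im z + Im w. Proof. by case: z w => [? ?] []. Qed.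
Lemma ReN z : Re (- z) = - Re z. Proof. by case: z. Qed.
Lemma ImN z : Im (- z) = - Im z. Proof. by case: z. Qed.
Lemma ReB z w : Re (z - w) = Re z - Re w. Proof. by rewrite ReD ReN. Qed.
Lemma ImB z w : Im (z - w) = Im z - Im w. Proof. by rewrite ImD ImN. Qed.
Lemma ReM z w : Re (z * w) = Re z * Re w - Im z * Im w.
Proof. by case: z w => [? ?] []. Qed.
Lemma ImM z w : Im (z * w) = Re z * Im w + Im z * Re w.
Proof. by case: z w => [? ?] []. Qed.

Lemma cmod_expi x : cm (expi x) = 1.
Proof. by rewrite cmodE /= cos2Dsin2 sqrtr1. Qed.

Lemma expiD x y : expi (x + y) = expi x * expi y.
Proof.
apply/eqP; rewrite eq_complex ReM ImM /= cosD sinD.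
by apply/andP; split; apply/eqP; ring.
Qed.

Lemma expi0 : expi 0 = 1 :> R[i].
Proof. by rewrite /expi cos0 sin0. Qed.

Lemma expiMn x n : expi (x *+ n) = expi x ^+ n.
Proof. by elim: n => [|n IH]; rewrite ?mulr0n ?expi0 // mulrS expiD IH exprS. Qed.

Lemma cmod_cexp z : cm (cexp z) = expR (Re z).
Proof.
by rewrite /cexp cmodM cmod_expi mulr1 cmod_real gtr0_norm // expR_gt0.
Qed.

Lemma cexpD z w : cexp (z + w) = cexp z * cexp w.
Proof.
by rewrite /cexp ReD ImD expRD expiD rmorphM /= mulrACA.
Qed.

(** The norm of [R[i]^o] takes its values in [R[i]]; all the estimates below
    are between real numbers, and this is the bridge. *)
Lemma nbhs_cmod (z : R[i]^o) (A : set R[i]^o) :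
  nbhs z A <-> exists2 e : R, 0 < e & forall w, cm (z - w) < e -> A w.
Proof.
split=> [/nbhs_ballP[e /= e0 eA]|[e e0 eA]].
  have [eR e0'] : e = (Re e)%:C /\ 0 < Re e.
    case: e e0 {eA} => a b; rewrite ltcE /= => /andP[/eqP -> ->]; split=> //.
  exists (Re e) => // w zw; apply: eA; rewrite /ball /= eR normcE ltcR //.
apply/nbhs_ballP; exists e%:C => /=; first by rewrite ltcR.
by move=> w; rewrite /ball /= normcE ltcR => /eA.
Qed.

Lemma cvg_cmod (T : Type) (F : set_system T) (FF : Filter F) (f : T -> R[i]^o) (l : R[i]^o) :
  (f @ F --> l) <-> forall e : R, 0 < e -> \forall x \near F, cm (l - f x) < e.
Proof.
split=> [fl e e0|H].
  by apply: (fl [set w | cm (l - w) < e]); apply/nbhs_cmod; exists e.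
by move=> A /nbhs_cmod[e e0 eA]; apply: filterS (H _ e0) => x; exact: eA.
Qed.

End Basics.

(** * Measurability in the plane *)

Section Measurability.
Variable R : realType.
Local Notation cm := (@complex_modulus R).
Local Notation Re := complex.Re.
Local Notation Im := complex.Im.

Lemma ltr_distP (x y e : R) : `|x - y| < e <-> y - e < x /\ x < y + e.
Proof. by rewrite ltr_distl; split=> [/andP//|[-> ->]]. Qed.

(** [D] is the union of the squares with rational centre and rational radius
    that it contains, of which there are countably many. *)
Lemma measurable_open_plane (D : set (R * R)) :
  (forall q, D q -> exists2 e : R, 0 < e &
     forall q', `|q.1 - q'.1| < e -> `|q.2 - q'.2| < e -> D q') ->
  measurable D.
Proof.
move=> oD.
pose B (a b c : rat) : set (R * R) :=
  ball (ratr a : R) (ratr c : R) `*` ball (ratr b : R) (ratr c : R).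
have -> : D = \bigcup_a \bigcup_b \bigcup_c
    (if pselect (B a b c `<=` D) then B a b c else set0).
  apply/seteqP; split => [[x y] Dxy|q [a _ [b _ [c _]]]]; last first.
    by case: pselect => // BD /BD.
  have [e e0 eD] := oD _ Dxy.
  have [c] : exists c, (ratr c : R) \in `]0, (e / 2)[.
    by apply: rat_in_itvoo; rewrite divr_gt0.
  rewrite in_itv /= => /andP[c0 ce].
  have [a] : exists a, (ratr a : R) \in `](x - ratr c), (x + ratr c)[.
    by apply: rat_in_itvoo; lra.
  rewrite in_itv /= => /andP[a1 a2].
  have [b] : exists b, (ratr b : R) \in `](y - ratr c), (y + ratr c)[.
    by apply: rat_in_itvoo; lra.
  rewrite in_itv /= => /andP[b1 b2].
  exists a; [by []|exists b; [by []|exists c; [by []|]]].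
  case: (pselect (B a b c `<=` D)) => [BD|] /=; last first.
    case=> -[u v] [/=]; rewrite /ball /= => /ltr_distP h1 /ltr_distP h2.
    apply: eD => /=; apply/ltr_distP; lra.
  by split; rewrite /ball /=; apply/ltr_distP; lra.
apply: bigcupT_measurable_rat => a; apply: bigcupT_measurable_rat => b.
apply: bigcupT_measurable_rat => c; case: pselect => [BD|_] /=; last exact: measurable0.
by apply: measurableX; rewrite ball_itv; exact: measurable_itv.
Qed.

Lemma measurable_fun_open_plane (D : set (R * R)) (f : R * R -> R) :
  (forall q, D q -> exists2 e : R, 0 < e &
     forall q', `|q.1 - q'.1| < e -> `|q.2 - q'.2| < e -> D q') ->
  (forall q, D q -> forall e : R, 0 < e -> exists2 d : R, 0 < d &
     forall q', D q' -> `|q.1 - q'.1| < d -> `|q.2 - q'.2| < d ->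
       `|f q - f q'| < e) ->
  measurable_fun D f.
Proof.
move=> oD cf; apply: (measurability _ (RGenOInfty.measurableE R)).
move=> _ [_ [a ->] <-]; apply: measurable_open_plane => q [Dq].
rewrite /= in_itv /= andbT => afq.
have [e e0 eD] := oD _ Dq.
have [|d d0 dD] := cf _ Dq (f q - a); first by rewrite subr_gt0.
exists (Order.min e d); first by rewrite lt_min e0.
move=> q'; rewrite !lt_min => /andP[xe xd] /andP[ye yd].
have Dq' := eD _ xe ye; split => //=; rewrite in_itv /= andbT.
have /ltr_distP := dD _ Dq' xd yd; lra.
Qed.

Lemma open_measurableC (A : set (R[i])^o) : open A ->
  measurable (A : set (borelC R)).
Proof. by move=> oA; apply: sub_sigma_algebra. Qed.

Lemma closed_measurableC (A : set (R[i])^o) : closed A ->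
  measurable (A : set (borelC R)).
Proof.
by move=> /closed_openC/open_measurableC/measurableC; rewrite setCK.
Qed.

Lemma open_cmodP (A : set R[i]^o) :
  open A <-> forall z, A z -> exists2 e : R, 0 < e & forall w, cm (z - w) < e -> A w.
Proof.
by rewrite openE; split => H z Az; apply/nbhs_cmod; exact: H.
Qed.

(** The sigma-algebra of [borelC R] is generated by the open sets of the plane;
    this is how measurability of a function is obtained from its continuity. *)
Lemma lipschitz_measurableC (f : R[i] -> R) :
  (forall z w, `|f z - f w| <= cm (z - w)) ->
  measurable_fun setT (f : borelC R -> R).
Proof.
move=> lf; apply: (measurability _ (RGenOInfty.measurableE R)).
move=> _ [_ [a ->] <-]; rewrite setTI; apply: open_measurableC.
apply/open_cmodP => z /=; rewrite in_itv /= andbT => az.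
exists (f z - a); first by rewrite subr_gt0.
move=> w zw; have := le_lt_trans (lf z w) zw; rewrite in_itv /= andbT.
by move=> /ltr_distP; lra.
Qed.

Lemma measurable_ReC : measurable_fun setT (@complex.Re R : borelC R -> R).
Proof. by apply: lipschitz_measurableC => z w; rewrite -ReB cmod_Re. Qed.

Lemma measurable_ImC : measurable_fun setT (@complex.Im R : borelC R -> R).
Proof. by apply: lipschitz_measurableC => z w; rewrite -ImB cmod_Im. Qed.

Lemma closed_unit_circle : closed (@unit_circle R : set R[i]^o).
Proof.
rewrite -openC; apply/open_cmodP => z /= /eqP z1.
exists `|cm z - 1|; first by rewrite normr_gt0 subr_eq0.
move=> w zw w1; have {}w1 : cm w = 1 := w1.
have h1 := cmodB_ge z w; have h2 := cmodB_ge w z; rewrite cmodC in h2.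
move: zw; rewrite ltNge => /negP; apply.
by rewrite -w1; rewrite ler_norml; apply/andP; split; lra.
Qed.

Lemma measurable_unit_circle : measurable (@unit_circle R : set (borelC R)).
Proof. exact: closed_measurableC closed_unit_circle. Qed.

End Measurability.

(** * The Poisson kernel *)

Section PoissonKernel.
Variable R : realType.
Local Notation cm := (@complex_modulus R).
Local Notation Re := complex.Re.
Local Notation Im := complex.Im.
Implicit Types (z w : R[i]).

Definition herglotz z w : R[i] := (w + z) / (w - z).

Definition poisson z w : R := (1 - cm z ^+ 2) / cm (w - z) ^+ 2.

Lemma Re_div z w : Re (z / w) = (Re z * Re w + Im z * Im w) / cm w ^+ 2.
Proof.
case: z w => [a b] [c e]; rewrite cmod_sq ReM /=.
by rewrite /GRing.inv /=; ring.
Qed.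

Lemma poissonE z w : cm w = 1 -> poisson z w = Re (herglotz z w).
Proof.
move=> w1; rewrite /herglotz Re_div /poisson; congr (_ / _).
have : cm w ^+ 2 = 1 by rewrite w1 expr1n.
rewrite !cmod_sq !ReD !ImD !ReN !ImN => <-; ring.
Qed.

Lemma sub_cmod_ge z w : cm w = 1 -> 1 - cm z <= cm (w - z).
Proof. by move=> <-; exact: cmodB_ge. Qed.

Lemma sub_cmod_gt0 z w : cm w = 1 -> cm z < 1 -> 0 < cm (w - z).
Proof.
by move=> w1 z1; apply: lt_le_trans (sub_cmod_ge z w1); rewrite subr_gt0.
Qed.

Lemma sub_cmod_neq0 z w : cm w = 1 -> cm z < 1 -> w - z != 0.
Proof. by move=> w1 z1; rewrite -cmod_gt0 sub_cmod_gt0. Qed.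

Lemma poisson_ge0 z w : cm z < 1 -> 0 <= poisson z w.
Proof.
move=> z1; rewrite /poisson divr_ge0 ?sqr_ge0 // subr_ge0.
by rewrite expr_le1 ?cmod_ge0 // ltW.
Qed.

Lemma poisson_le z w : cm w = 1 -> cm z < 1 -> poisson z w <= 2 / (1 - cm z).
Proof.
move=> w1 z1; have h := sub_cmod_ge z w1; have z0 := cmod_ge0 z.
have p : 0 < 1 - cm z by rewrite subr_gt0.
rewrite /poisson ler_pdivrMr ?exprn_gt0 ?sub_cmod_gt0 //.
rewrite mulrAC ler_pdivlMr //.
have : (1 - cm z) ^+ 2 <= cm (w - z) ^+ 2 by rewrite lerXn2r ?nnegrE ?cmod_ge0 // ltW.
nra.
Qed.

Lemma poisson_ge z w (s : R) : cm z < 1 -> 0 < cm (w - z) -> cm (w - z) <= s ->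
  (1 - cm z) / s ^+ 2 <= poisson z w.
Proof.
move=> z1 wz ws; have s0 := lt_le_trans wz ws; have z0 := cmod_ge0 z.
rewrite /poisson ler_pM ?invr_ge0 ?sqr_ge0 ?subr_ge0 ?(ltW z1) //; first by nra.
by rewrite lef_pV2 ?posrE ?exprn_gt0 // lerXn2r ?nnegrE ?cmod_ge0 ?(ltW s0).
Qed.

Lemma herglotzB z z' w : w - z != 0 -> w - z' != 0 ->
  herglotz z w - herglotz z' w = 2 * w * (z - z') / ((w - z) * (w - z')).
Proof. by move=> h1 h2; rewrite /herglotz; field; rewrite h1 h2. Qed.

Lemma poisson_lipschitz z z' w (r : R) : cm w = 1 -> 0 < r ->
  r <= 1 - cm z -> r <= 1 - cm z' ->
  `|poisson z w - poisson z' w| <= 2 / r ^+ 2 * cm (z - z').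
Proof.
move=> w1 r0 rz rz'; have z1 : cm z < 1 by lra. have z1' : cm z' < 1 by lra.
rewrite !poissonE // -ReB; apply: (le_trans (cmod_Re _)).
rewrite herglotzB ?sub_cmod_neq0 // cmod_div !cmodM w1 cmod_nat mulr1.
rewrite mulrAC ler_wpM2r ?cmod_ge0 // ler_pM2l //.
have h1 := sub_cmod_ge z w1; have h2 := sub_cmod_ge z' w1.
rewrite lef_pV2 ?posrE ?mulr_gt0 ?exprn_gt0 ?sub_cmod_gt0 // expr2.
by apply: ler_pM; lra.
Qed.

(** The points [z + 'i ^ j * k] are the four fourth roots of [k ^ 4] around [z]:
    in the mean over them every power of [k] but the fourth ones cancels. The
    error of the mean value property is then explicit, and no integration on
    circles is needed to express that the Poisson kernel is harmonic. *)
Lemma herglotz4 z w k : w - z != 0 -> (w - z) ^+ 4 - k ^+ 4 != 0 ->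
  herglotz (z + k) w + herglotz (z - k) w +
  herglotz (z + 'i * k) w + herglotz (z - 'i * k) w =
  4 * herglotz z w + 8 * w * k ^+ 4 / ((w - z) * ((w - z) ^+ 4 - k ^+ 4)).
Proof.
move=> wz wzh; have [I Ii] : exists I : R[i], I = 'i by exists 'i.
have I2 : I * I = -1 by rewrite Ii -expr2 sqr_i.
rewrite -!Ii.
have e : (w - z) ^+ 4 - k ^+ 4 =
   (w - z - k) * (w - z + k) * ((w - z - I * k) * (w - z + I * k)).
  rewrite [X in _ = _ * X](_ : _ = (w - z) ^+ 2 - (I * I) * k ^+ 2); last by ring.
  by rewrite I2; ring.
have := wzh; rewrite {1}e !mulf_eq0 !negb_or.
move=> /andP[/andP[h1 h2] /andP[h3 h4]].
rewrite /herglotz.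
have -> : (w + (z + k)) / (w - (z + k)) + (w + (z - k)) / (w - (z - k)) =
   2 * (w ^+ 2 - z ^+ 2 + k ^+ 2) / ((w - z) ^+ 2 - k ^+ 2).
  field; apply/and3P; split; first
    [ by rewrite opprD ?opprK addrA
    | by apply: etrans (mulf_neq0 h1 h2); congr (_ != _); ring ].
have -> : 2 * (w ^+ 2 - z ^+ 2 + k ^+ 2) / ((w - z) ^+ 2 - k ^+ 2) +
  (w + (z + I * k)) / (w - (z + I * k)) + (w + (z - I * k)) / (w - (z - I * k)) =
  2 * (w ^+ 2 - z ^+ 2 + k ^+ 2) / ((w - z) ^+ 2 - k ^+ 2) +
   2 * (w ^+ 2 - z ^+ 2 + (I * I) * k ^+ 2) / ((w - z) ^+ 2 - (I * I) * k ^+ 2).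
  rewrite -addrA; congr (_ + _).
  field; apply/and3P; split; first
    [ by rewrite opprD ?opprK addrA
    | by apply: etrans (mulf_neq0 h3 h4); congr (_ != _); ring ].
rewrite I2.
have h12 : (w - z) ^+ 2 - k ^+ 2 != 0.
  by apply: etrans (mulf_neq0 h1 h2); congr (_ != _); ring.
have h34 : (w - z) ^+ 2 - - 1 * k ^+ 2 != 0.
  by rewrite -I2; apply: etrans (mulf_neq0 h3 h4); congr (_ != _); ring.
field.
by rewrite wzh wz h12 h34.
Qed.

Lemma poisson4 z w (h : R) : cm w = 1 -> cm z < 1 -> 0 < h -> h <= (1 - cm z) / 2 ->
  poisson (z + h%:C) w + poisson (z - h%:C) w +
  poisson (z + 'i * h%:C) w + poisson (z - 'i * h%:C) w
  <= 4 * poisson z w + 16 / (1 - cm z) ^+ 5 * h ^+ 4.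
Proof.
move=> w1 z1 h0 hr; set r := 1 - cm z in hr *.
have r0 : 0 < r by rewrite /r subr_gt0.
have wz := sub_cmod_ge z w1; have wz0 := sub_cmod_neq0 w1 z1.
have hc : cm (h%:C ^+ 4) = h ^+ 4 by rewrite cmodX cmod_real gtr0_norm.
have h4 : h ^+ 4 <= r ^+ 4 / 16.
  have -> : r ^+ 4 / 16 = (r / 2) ^+ 4 by field.
  by rewrite lerXn2r ?nnegrE ?(ltW h0) // divr_ge0 // ltW.
have w4 : r ^+ 4 <= cm (w - z) ^+ 4.
  by rewrite lerXn2r ?nnegrE ?cmod_ge0 // ltW.
have r4 : 0 < r ^+ 4 by rewrite exprn_gt0.
have dd : r ^+ 4 / 2 <= cm ((w - z) ^+ 4 - h%:C ^+ 4).
  apply: le_trans (cmodB_ge _ _); rewrite hc cmodX; lra.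
have d0 : (w - z) ^+ 4 - h%:C ^+ 4 != 0.
  by rewrite -cmod_gt0; apply: lt_le_trans dd; lra.
rewrite !poissonE // -!ReD herglotz4 // ReD.
have -> : Re (4 * herglotz z w) = 4 * Re (herglotz z w).
  by rewrite ReM -[4 in LHS](rmorph_nat (real_complex R)) /= mul0r subr0.
rewrite lerD2l; apply: le_trans (ler_norm _) _; apply: le_trans (cmod_Re _) _.
rewrite cmod_div (cmodM (8 * w)) (cmodM 8) (cmodM (w - z)) hc w1 cmod_nat mulr1.
rewrite ler_pdivrMr ?mulr_gt0 ?cmod_gt0 //.
set ab := cm (w - z) * _.
rewrite [leRHS](_ : _ = 16 * ab / r ^+ 5 * h ^+ 4); last by ring.
rewrite ler_wpM2r ?exprn_ge0 ?(ltW h0) // ler_pdivlMr ?exprn_gt0 // /ab.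
have : r * (r ^+ 4 / 2) <= cm (w - z) * cm ((w - z) ^+ 4 - h%:C ^+ 4).
  by apply: ler_pM => //; lra.
rewrite (exprS r 4); lra.
Qed.

Lemma herglotz_double z w : w - z != 0 -> w + z != 0 ->
  herglotz z w + herglotz (- z) w = 2 * herglotz (z ^+ 2) (w ^+ 2).
Proof.
move=> h1 h2; rewrite /herglotz; field.
rewrite opprK h1 h2 /= andbT; apply: etrans (mulf_neq0 h1 h2).
by congr (_ != _); ring.
Qed.

(** [z] and [- z] are the two square roots of [z ^+ 2]. Iterated, this computes
    the sum of the Poisson kernels at the [2 ^ j] vertices of a regular
    polygon. *)
Lemma poisson_double z w : cm w = 1 -> cm z < 1 ->
  poisson z w + poisson (- z) w = 2 * poisson (z ^+ 2) (w ^+ 2).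
Proof.
move=> w1 z1; have z1' : cm (- z) < 1 by rewrite cmodN.
rewrite !poissonE ?cmodX ?w1 ?expr1n // -ReD herglotz_double ?sub_cmod_neq0 //.
  by rewrite ReM -[2 in LHS](rmorph_nat (real_complex R)) /= mul0r subr0.
by have := sub_cmod_neq0 w1 z1'; rewrite opprK.
Qed.

End PoissonKernel.

(** * Poisson integrals *)

Section PoissonIntegral.
Context {R : realType} {d : measure_display} {X : measurableType d}.
Variables (m : {measure set X -> \bar R}) (D : set X) (v : X -> R[i]) (phi : X -> R).
Local Notation cm := (@complex_modulus R).
Local Notation Re := complex.Re.
Local Notation Im := complex.Im.

Definition poisson_integral z : R := Rintegral m D (fun x => poisson z (v x) * phi x).

Hypotheses (mD : measurable D) (mRe : measurable_fun D (fun x => Re (v x)))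
  (mIm : measurable_fun D (fun x => Im (v x)))
  (v1 : forall x, D x -> cm (v x) = 1)
  (phi_ge0 : forall x, D x -> 0 <= phi x)
  (iphi : m.-integrable D (fun x => (phi x)%:E)).

Lemma measurable_poisson z : measurable_fun D (fun x => poisson z (v x)).
Proof.
apply: (eq_measurable_fun (fun x => (1 - cm z ^+ 2) *
  ((Re (v x) - Re z) ^+ 2 + (Im (v x) - Im z) ^+ 2) `^ (-1))).
  move=> x _; rewrite /poisson (cmod_sq (v x - z)) ReB ImB powR_inv1 //.
  by rewrite addr_ge0 ?sqr_ge0.
apply: measurable_funM => //.
apply: (measurableT_comp (measurable_powR (-1))).
by apply: measurable_funD; apply: measurable_funX; apply: measurable_funB.
Qed.

Lemma integrable_poisson z : cm z < 1 ->
  m.-integrable D (fun x => (poisson z (v x) * phi x)%:E).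
Proof.
move=> z1; have k0 : 0 <= 2 / (1 - cm z) by rewrite divr_ge0 // subr_ge0 ltW.
have iK := integrableZl mD (2 / (1 - cm z)) iphi.
apply: le_integrable iK => //.
  apply/measurable_EFinP; apply: measurable_funM; first exact: measurable_poisson.
  by apply/measurable_EFinP; case/integrableP : iphi.
move=> x Dx; have f0 := phi_ge0 Dx; have p0 := poisson_ge0 (v x) z1.
rewrite -EFinM !abse_EFin lee_fin (ger0_norm (mulr_ge0 p0 f0)).
by rewrite (ger0_norm (mulr_ge0 k0 f0)) ler_wpM2r ?phi_ge0 // poisson_le ?v1.
Qed.

Lemma poisson_integral_ge0 z : cm z < 1 -> 0 <= poisson_integral z.
Proof.
by move=> z1; apply: Rintegral_ge0 => x Dx; apply: mulr_ge0; [exact: poisson_ge0|exact: phi_ge0].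
Qed.

Lemma poisson_integral_lipschitz (r : R) z z' : 0 < r -> r <= 1 - cm z ->
  r <= 1 - cm z' ->
  `|poisson_integral z - poisson_integral z'| <=
  2 / r ^+ 2 * Rintegral m D phi * cm (z - z').
Proof.
move=> r0 rz rz'; have z1 : cm z < 1 by lra. have z1' : cm z' < 1 by lra.
rewrite /poisson_integral -RintegralB ?integrable_poisson //.
have iB := integrableB mD (integrable_poisson z1) (integrable_poisson z1').
apply: le_trans (le_normr_Rintegral mD iB) _.
rewrite mulrAC -RintegralZl //; apply: le_Rintegral => //.
- exact: integrable_norm.
- exact: (integrableZl mD (2 / r ^+ 2 * cm (z - z')) iphi).
move=> x Dx; rewrite -mulrBl normrM (ger0_norm (phi_ge0 Dx)).
by rewrite ler_wpM2r ?phi_ge0 // poisson_lipschitz ?v1.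
Qed.

Lemma poisson_integral4 z (h : R) : cm z < 1 -> 0 < h -> h <= (1 - cm z) / 2 ->
  poisson_integral (z + h%:C) + poisson_integral (z - h%:C) +
  poisson_integral (z + 'i * h%:C) + poisson_integral (z - 'i * h%:C)
  <= 4 * poisson_integral z + 16 / (1 - cm z) ^+ 5 * Rintegral m D phi * h ^+ 4.
Proof.
move=> z1 h0 hz.
have lt1 w : cm w = h -> cm (z + w) < 1.
  by move=> wh; apply: le_lt_trans (cmodD _ _) _; rewrite wh; lra.
have c1 : cm h%:C = h by rewrite cmod_real gtr0_norm.
have c2 : cm ('i * h%:C) = h by rewrite cmodM cmodE /= expr0n expr1n add0r sqrtr1 mul1r.
have i1 := integrable_poisson (lt1 _ c1).
have i2 := integrable_poisson (lt1 (- h%:C) (etrans (cmodN _) c1)).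
have i3 := integrable_poisson (lt1 _ c2).
have i4 := integrable_poisson (lt1 (- ('i * h%:C)) (etrans (cmodN _) c2)).
have i12 := integrableD mD i1 i2; have i123 := integrableD mD i12 i3.
have i1234 := integrableD mD i123 i4.
have i0 := integrableZl mD 4 (integrable_poisson z1).
have ip := integrableZl mD (16 / (1 - cm z) ^+ 5 * h ^+ 4) iphi.
rewrite /poisson_integral -RintegralD // -RintegralD // -RintegralD //.
rewrite mulrAC -!RintegralZl ?integrable_poisson // -RintegralD //.
apply: le_Rintegral => //; first exact: (integrableD mD i0 ip).
move=> x Dx; rewrite -!mulrDl mulrA -mulrDl ler_wpM2r ?phi_ge0 //.
by apply: poisson4; rewrite ?v1.
Qed.

End PoissonIntegral.

(** * A maximum principle *)

Section MaximumPrinciple.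
Variable R : realType.
Local Notation cm := (@complex_modulus R).
Local Notation Re := complex.Re.
Local Notation Im := complex.Im.
Implicit Types (z w : R[i]).

(** As a closed subset of the image of a square of the real plane. *)
Lemma compact_cmod (A : set R[i]^o) (M : R) :
  closed A -> (forall z, A z -> cm z <= M) -> compact A.
Proof.
move=> cA AM.
pose f (q : R * R) : R[i]^o := q.1 +i* q.2.
have cf : continuous f.
  move=> q; apply/cvg_cmod => e e0.
  have e2 : 0 < e / 2 by rewrite divr_gt0.
  have h1 : \forall q' \near nbhs q, `|q.1 - q'.1| < e / 2.
    have c1 : @fst R R @ nbhs q --> q.1 by exact: cvg_fst.
    by have /cvgrPdist_lt := c1; exact.
  have h2 : \forall q' \near nbhs q, `|q.2 - q'.2| < e / 2.
    have c2 : @snd R R @ nbhs q --> q.2 by exact: cvg_snd.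
    by have /cvgrPdist_lt := c2; exact.
  near=> q'; apply: le_lt_trans (cmod_le_ReIm _) _; rewrite ReB ImB /=.
  by rewrite (splitr e) ltrD //; near: q'.
have cB : compact (`[- M, M]%classic `*` `[- M, M]%classic : set (R * R)).
  by apply: compact_setX; exact: segment_compact.
have cfB := continuous_compact (continuous_subspaceT cf) cB.
apply: (subclosed_compact cA cfB) => z Az; exists (Re z, Im z); last by case: z {Az}.
have h1 := le_trans (cmod_Re z) (AM z Az).
have h2 := le_trans (cmod_Im z) (AM z Az).
by split => /=; rewrite in_itv /= -ler_norml.
Unshelve. all: by end_near. Qed.

Lemma cvg_cmod_within (A : set R[i]^o) (f : R[i] -> R) z :
  (forall e : R, 0 < e -> exists2 d : R, 0 < d &
     forall w, A w -> cm (z - w) < d -> `|f z - f w| < e) ->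
  f w @[w --> within A (nbhs (z : R[i]^o))] --> f z.
Proof.
move=> H; apply/cvgrPdist_lt => e e0; have [d d0 dP] := H e e0.
rewrite near_withinE; apply/nbhs_cmod; exists d => // w zw Aw; exact: dP.
Qed.

Lemma lipschitz_horner (p : {poly R[i]}) (M : R) : exists2 C : R, 0 <= C &
  forall z w, cm z <= M -> cm w <= M -> cm (p.[z] - p.[w]) <= C * cm (z - w).
Proof.
elim/poly_ind: p => [|p c [C C0 IH]].
  by exists 0 => // z w _ _; rewrite !horner0 subrr cmod0 mul0r.
have [K K0 pK] : exists2 K : R, 0 <= K & forall w, cm w <= M -> cm p.[w] <= K.
  exists (cm p.[0] + C * `|M|) => [|w wM]; first by rewrite addr_ge0 ?cmod_ge0 ?mulr_ge0.
  have M0 : 0 <= M := le_trans (cmod_ge0 w) wM.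
  rewrite -[p.[w]](subrK p.[0]) addrC; apply: le_trans (cmodD _ _) _.
  rewrite lerD2l; apply: le_trans (IH _ _ wM _) _; first by rewrite cmod0.
  by rewrite subr0 ger0_norm // ler_wpM2l.
exists (C * `|M| + K) => [|z w zM wM]; first by rewrite addr_ge0 ?mulr_ge0.
have M0 : 0 <= M := le_trans (cmod_ge0 w) wM.
rewrite !hornerE.
have -> : p.[z] * z + c - (p.[w] * w + c) = (p.[z] - p.[w]) * z + p.[w] * (z - w).
  by ring.
apply: le_trans (cmodD _ _) _; rewrite !cmodM mulrDl lerD //; last first.
  by rewrite ler_wpM2r ?cmod_ge0 ?pK.
rewrite mulrAC ger0_norm // ler_pM ?cmod_ge0 // IH //.
Qed.

(** Subharmonicity of [ln (cm F)] at [z], tested on the four points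
    [z + 'i ^ j * h], up to an error of order [h ^ 4] which is harmless against
    the gain of order [h ^ 2] coming from [cmod_sq4]. Exponentiated, the
    condition is stable under products and makes sense at the zeros of [F]. *)
Definition sub4 (F : R[i] -> R[i]) z := exists C d : R, [/\ 0 <= C, 0 < d &
  forall h : R, 0 < h -> h < d -> 0 <= 1 - C * h ^+ 4 /\
    cm (F z) ^+ 4 * (1 - C * h ^+ 4) <=
    cm (F (z + h%:C) * F (z - h%:C) * (F (z + 'i * h%:C) * F (z - 'i * h%:C)))].

Lemma exp4_small (C : R) : 0 <= C -> exists2 d : R, 0 < d &
  forall h, 0 < h -> h < d -> 0 <= 1 - C * h ^+ 4.
Proof.
move=> C0; exists (1 + C)^-1 => [|h h0 hd]; first by rewrite invr_gt0 ltr_wpDr.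
have C1 : 0 < 1 + C by rewrite ltr_wpDr.
have : h * (1 + C) < 1 by rewrite -ltr_pdivlMr // mul1r.
have hC : 0 <= h * C by rewrite mulr_ge0 // ltW.
move=> h1; have hlt : h < 1 by lra.
have h3 : h ^+ 3 <= 1 by rewrite exprn_ile1 // ltW.
have h30 : 0 <= h ^+ 3 by rewrite exprn_ge0 // ltW.
rewrite exprS; nra.
Qed.

Lemma sub4M F G z : sub4 F z -> sub4 G z -> sub4 (fun x => F x * G x) z.
Proof.
move=> [C [d [C0 d0 H]]] [C' [d' [C0' d0' H']]].
have [e e0 eP] := exp4_small (addr_ge0 C0 C0').
exists (C + C'), (Order.min e (Order.min d d')); split.
- exact: addr_ge0.
- by rewrite !lt_min e0 d0.
move=> h h0; rewrite !lt_min => /and3P[he hd hd'].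
have [a1 a2] := H h h0 hd; have [b1 b2] := H' h h0 hd'.
split; first exact: eP.
set f1 := F (z + _) in a2 *; set f2 := F (z - h%:C) in a2 *.
set f3 := F (z + _) in a2 *; set f4 := F (z - _) in a2 *.
set g1 := G (z + _) in b2 *; set g2 := G (z - h%:C) in b2 *.
set g3 := G (z + _) in b2 *; set g4 := G (z - _) in b2 *.
have -> : f1 * g1 * (f2 * g2) * (f3 * g3 * (f4 * g4)) =
  (f1 * f2 * (f3 * f4)) * (g1 * g2 * (g3 * g4)) by ring.
have pF := exprn_ge0 4 (cmod_ge0 (F z)); have pG := exprn_ge0 4 (cmod_ge0 (G z)).
rewrite [leRHS]cmodM; apply: le_trans (ler_pM (mulr_ge0 pF a1) (mulr_ge0 pG b1) a2 b2).
rewrite cmodM exprMn [leRHS]mulrACA; apply: ler_wpM2l; first exact: mulr_ge0 pF pG.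
have : 0 <= (C * h ^+ 4) * (C' * h ^+ 4).
  by apply: mulr_ge0; apply: mulr_ge0 => //; exact: exprn_ge0 (ltW h0).
by nra.
Qed.

Lemma sub4_cst c z : sub4 (fun=> c) z.
Proof.
exists 0, 1; split => // h _ _; rewrite mul0r subr0 ler01; split => //.
by rewrite mulr1 !cmodM -expr2 -expr2 -exprM.
Qed.

(** The product of the four values is [(z - a) ^ 4 - h ^ 4]. *)
Lemma sub4_factor a z : z - a != 0 -> sub4 (fun x => x - a) z.
Proof.
move=> za; have za0 : 0 < cm (z - a) by rewrite cmod_gt0.
have C0 : 0 <= (cm (z - a))^-1 ^+ 4 by rewrite exprn_ge0 // invr_ge0 ltW.
have [d d0 dP] := exp4_small C0.
exists ((cm (z - a))^-1 ^+ 4), d; split => // h h0 hd; split; first exact: dP.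
set k := h%:C.
have -> : (z + k - a) * (z - k - a) * ((z + 'i * k - a) * (z - 'i * k - a)) =
   (z - a) ^+ 4 - k ^+ 4.
  transitivity (((z - a) ^+ 2 - k ^+ 2) * ((z - a) ^+ 2 - 'i ^+ 2 * k ^+ 2)).
    by ring.
  by rewrite sqr_i; ring.
apply: le_trans (cmodB_ge _ _); rewrite !cmodX cmod_real (gtr0_norm h0).
rewrite mulrBr mulr1 mulrA -exprMn divff ?expr1n ?mul1r //.
by rewrite gt_eqF.
Qed.

(** A polynomial with complex coefficients is a product of linear factors. *)
Lemma sub4_horner (p : {poly R[i]}) z : p.[z] != 0 -> sub4 (horner p) z.
Proof.
have [r ->] := closed_field_poly_normal p.
rewrite hornerZ mulf_eq0 negb_or => /andP[_ pz].
rewrite (_ : horner _ = fun x => lead_coef p * \prod_(a <- r) (x - a)); last first.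
  apply/funext => x; rewrite hornerZ horner_prod; congr (_ * _).
  by apply: eq_bigr => a _; rewrite !hornerE.
apply: sub4M; first exact: sub4_cst.
elim: r pz => [|a r IH].
  move=> _; rewrite (_ : (fun _ => _) = fun=> 1); first exact: sub4_cst.
  by apply/funext => x; rewrite big_nil.
rewrite big_cons hornerM mulf_eq0 negb_or !hornerE => /andP[za /IH rz].
rewrite (_ : (fun _ => _) = fun x => (x - a) * \prod_(b <- r) (x - b)).
  by apply: sub4M => //; exact: sub4_factor.
by apply/funext => x; rewrite big_cons.
Qed.

Lemma cmod_sq4 z (h : R) : cm (z + h%:C) ^+ 2 + cm (z - h%:C) ^+ 2 +
   cm (z + 'i * h%:C) ^+ 2 + cm (z - 'i * h%:C) ^+ 2 = 4 * cm z ^+ 2 + 4 * h ^+ 2.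
Proof. by rewrite !cmod_sq; case: z => a b /=; ring. Qed.

(** If the bound failed, so would the one for the product of the left-hand side
    with [expR (ep * (cm z ^+ 2 - 1))] for some small [ep]; at a maximum of this
    product, necessarily in [U], the mean over four points strictly exceeds
    the value at the centre, by [sub4_horner] and [cmod_sq4]. *)
Lemma maximum_principle (p : {poly R[i]}) (P : R[i] -> R) (A U : set R[i]^o) (B : R) :
  compact A -> (forall z, A z -> cm z <= 1) ->
  (forall z, U z -> A z /\ exists2 e : R, 0 < e & forall w, cm (z - w) < e -> A w) ->
  (forall z, A z -> forall e : R, 0 < e -> exists2 d : R, 0 < d &
     forall w, A w -> cm (z - w) < d -> `|P z - P w| < e) ->
  (forall z, U z -> exists K d : R, [/\ 0 <= K, 0 < d & forall h, 0 < h -> h < d ->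
     P (z + h%:C) + P (z - h%:C) + P (z + 'i * h%:C) + P (z - 'i * h%:C) <=
     4 * P z + K * h ^+ 4]) ->
  0 <= B -> (forall z, A z -> ~ U z -> cm p.[z] * expR (- P z) <= B) ->
  forall z, A z -> cm p.[z] * expR (- P z) <= B.
Proof.
move=> cA A1 UA cP P4 B0 AUB z0 Az0; rewrite leNgt; apply/negP => Bz0.
pose V0 z := cm p.[z] * expR (- P z).
have V00 : 0 < V0 z0 by apply: le_lt_trans Bz0.
have [ep ep0 epB] : exists2 ep, 0 < ep & B < V0 z0 * (1 - ep).
  exists ((V0 z0 - B) / (2 * V0 z0)).
    by apply: divr_gt0; [rewrite subr_gt0|exact: mulr_gt0].
  have -> : V0 z0 * (1 - (V0 z0 - B) / (2 * V0 z0)) = (V0 z0 + B) / 2.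
    by field; rewrite gt_eqF.
  by rewrite /V0 in V00 *; lra.
pose V z := V0 z * expR (ep * (cm z ^+ 2 - 1)).
have cV : {within A, continuous V}.
  apply/subspace_continuousP => z Az; apply: cvgM; [apply: cvgM|].
  - apply: cvg_cmod_within => e e0; have [C C0 pC] := lipschitz_horner p 1.
    exists (e / (1 + C)) => [|w Aw zw]; first by rewrite divr_gt0 // ltr_wpDr.
    have C1 : 0 < 1 + C by rewrite ltr_wpDr.
    have pzw := pC z w (A1 _ Az) (A1 _ Aw).
    apply: le_lt_trans (_ : cm (p.[z] - p.[w]) < e).
      rewrite ler_norml cmodB_ge andbT lerNl opprB cmodC cmodB_ge //.
    apply: le_lt_trans pzw _; move: zw; rewrite ltr_pdivlMr //.
    have := cmod_ge0 (z - w); lra.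
  - apply: (continuous_cvg _ (@continuous_expR R _)); apply: cvgN.
    exact: cvg_cmod_within (cP z Az).
  - apply: (continuous_cvg _ (@continuous_expR R _)); apply: cvg_cmod_within => e e0.
    exists (e / (2 * ep)) => [|w Aw zw]; first by rewrite divr_gt0 // mulr_gt0.
    have h : `|cm z - cm w| <= cm (z - w).
      by rewrite ler_norml cmodB_ge andbT lerNl opprB cmodC cmodB_ge.
    rewrite -mulrBr opprB addrA subrK subr_sqr normrM (gtr0_norm ep0) normrM.
    have z1 := A1 _ Az; have w1 := A1 _ Aw.
    have zz := cmod_ge0 z; have ww := cmod_ge0 w.
    rewrite (@ger0_norm _ (cm z + cm w)) ?addr_ge0 //.
    move: zw; rewrite ltr_pdivlMr ?mulr_gt0 //.
    have := normr_ge0 (cm z - cm w); have := ltW ep0.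
    have : `|cm z - cm w| * (cm z + cm w) <= cm (z - w) * 2.
      by rewrite ler_pM ?addr_ge0 //; lra.
    nra.
have [|z1] := compact_EVT_max _ cA cV; first by exists z0.
rewrite inE => Az1 Vz1.
have Bz1 : B < V z1.
  apply: lt_le_trans (Vz1 z0 _); last by rewrite inE.
  have : V0 z0 * (1 - ep) <= V z0.
    rewrite /V ler_wpM2l ?(ltW V00) //; apply: le_trans (expR_ge1Dx _).
    have := sqr_ge0 (cm z0); nra.
  exact: lt_le_trans.
have VV0 z : A z -> V z <= V0 z.
  move=> Az; rewrite /V ler_piMr //.
    by rewrite /V0 mulr_ge0 ?cmod_ge0 ?expR_ge0.
  rewrite -[leRHS]expR0 ler_expR pmulr_rle0 // subr_le0 expr_le1 ?cmod_ge0 //.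
  exact: A1.
have Uz1 : U z1.
  by apply: contrapT => /(AUB _ Az1); rewrite leNgt (lt_le_trans Bz1) // VV0.
have pz1 : p.[z1] != 0.
  apply/eqP => pz; move: Bz1; rewrite /V /V0 pz cmod0 !mul0r ltNge B0 //.
have Vz1_gt0 : 0 < V z1 by apply: le_lt_trans Bz1.
have [C [d [C0 d0 dP]]] := sub4_horner pz1.
have [K [d' [K0 d0' dP']]] := P4 _ Uz1.
have [_ [e e0 eA]] := UA _ Uz1.
(* [s] is such that for [h < s] the errors of order [h ^ 4] are smaller than
   the gain [4 * ep * h ^ 2] *)
pose s := 4 * ep / (1 + K + C * (1 + 4 * ep)).
have q0 : 0 < 1 + K + C * (1 + 4 * ep).
  have : 0 <= C * (1 + 4 * ep) by rewrite mulr_ge0 //; lra.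
  lra.
have s0 : 0 < s by rewrite divr_gt0 // mulr_gt0.
pose h := Order.min (Order.min d d') (Order.min e (Order.min 1 s)) / 2.
have h0 : 0 < h by rewrite divr_gt0 // !lt_min d0 d0' e0 ltr01.
have /and5P[hd hd' he h1 hs] : [&& h < d, h < d', h < e, h < 1 & h < s].
  have : h < Order.min (Order.min d d') (Order.min e (Order.min 1 s)).
    by rewrite /h ltr_pdivrMr // ltr_pMr ?ltr1n // !lt_min d0 d0' e0 ltr01.
  by rewrite !lt_min => /andP[/andP[-> ->] /and3P[-> -> ->]].
have hA w : cm w = h -> V (z1 + w) <= V z1.
  move=> wh; apply: Vz1; rewrite inE; apply: eA.
  by rewrite opprD addrA subrr sub0r cmodN wh.
have c1 : cm h%:C = h by rewrite cmod_real gtr0_norm.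
have c2 : cm ('i * h%:C) = h by rewrite cmodM cmodE /= expr0n expr1n add0r sqrtr1 mul1r.
have v1 := hA _ c1; have v2 := hA (- h%:C) (etrans (cmodN _) c1).
have v3 := hA _ c2; have v4 := hA (- ('i * h%:C)) (etrans (cmodN _) c2).
have V_ge0 z : 0 <= V z by rewrite /V /V0 !mulr_ge0 ?cmod_ge0 ?expR_ge0.
have vv : V (z1 + h%:C) * V (z1 - h%:C) * (V (z1 + 'i * h%:C) * V (z1 - 'i * h%:C))
   <= V z1 ^+ 4.
  rewrite (_ : V z1 ^+ 4 = V z1 * V z1 * (V z1 * V z1)); last by ring.
  have VV a b : 0 <= V a * V b := mulr_ge0 (V_ge0 a) (V_ge0 b).
  by apply: (ler_pM (VV _ _) (VV _ _)); apply: (ler_pM (V_ge0 _) (V_ge0 _)).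
have [ch1 ch2] := dP h h0 hd; have ph := dP' h h0 hd'.
have VE : V (z1 + h%:C) * V (z1 - h%:C) * (V (z1 + 'i * h%:C) * V (z1 - 'i * h%:C)) =
  cm (p.[z1 + h%:C] * p.[z1 - h%:C] * (p.[z1 + 'i * h%:C] * p.[z1 - 'i * h%:C])) *
  expR (- (P (z1 + h%:C) + P (z1 - h%:C) + P (z1 + 'i * h%:C) + P (z1 - 'i * h%:C)) +
    ep * (4 * cm z1 ^+ 2 + 4 * h ^+ 2 - 4)).
  rewrite -cmod_sq4 /V /V0 !cmodM.
  set x1 := z1 + _; set x2 := z1 - h%:C; set x3 := z1 + _; set x4 := z1 - _.
  rewrite (_ : - _ + _ = (- P x1 + ep * (cm x1 ^+ 2 - 1)) + (- P x2 + ep * (cm x2 ^+ 2 - 1))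
    + (- P x3 + ep * (cm x3 ^+ 2 - 1)) + (- P x4 + ep * (cm x4 ^+ 2 - 1))); last by ring.
  by rewrite !expRD; ring.
have V4 : V z1 ^+ 4 = cm p.[z1] ^+ 4 *
    expR (- (4 * P z1) + ep * (4 * cm z1 ^+ 2 - 4)).
  rewrite /V /V0 -mulrA -expRD exprMn -expRM_natl; congr (_ * expR _).
  by ring.
have : (1 - C * h ^+ 4) * (1 + (4 * ep * h ^+ 2 - K * h ^+ 4)) <= 1.
  apply: le_trans (ler_wpM2l ch1 (expR_ge1Dx _)) _.
  rewrite -(ler_pM2l (exprn_gt0 4 Vz1_gt0)) mulr1.
  apply: le_trans vv; rewrite VE V4.
  rewrite mulrACA -expRD ler_pM ?mulr_ge0 ?exprn_ge0 ?cmod_ge0 ?expR_ge0 //.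
  by rewrite ler_expR; lra.
set t := h ^+ 2; have t0 : 0 < t by rewrite exprn_gt0.
have t1 : t <= h by rewrite /t expr2 ler_piMl // ltW.
have -> : h ^+ 4 = t ^+ 2 by rewrite /t -exprM.
move=> hh; move: hs; rewrite /s ltr_pdivlMr // => hs.
have : t * (1 + K + C * (1 + 4 * ep)) < 4 * ep.
  by apply: le_lt_trans hs; rewrite ler_wpM2r // ltW.
have tt : t <= 1 by lra.
have k1 : 0 <= C * (t * (4 * ep) * (1 - t)).
  apply: mulr_ge0 => //; apply: mulr_ge0; last by rewrite subr_ge0.
  by apply: mulr_ge0; [exact: ltW|lra].
have k2 : 0 <= C * (K * t ^+ 3).
  by apply: mulr_ge0 => //; apply: mulr_ge0 => //; exact: exprn_ge0 (ltW t0).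
move=> kk; have : 4 * ep - K * t - C * t * (1 + 4 * ep * t - K * t ^+ 2) <= 0.
  by rewrite -(pmulr_rle0 _ t0); lra.
lra.
Qed.

End MaximumPrinciple.

(** * Integration over a cone *)

Section AffineTonelli.
Variable R : realType.
Local Notation leb := (@lebesgue_measure R).
Local Open Scope ereal_scope.

Lemma measurable_affine (c a : R) : measurable_fun setT (fun s : R => (c + a * s)%R).
Proof. by apply: measurable_funD => //; exact: mulrl_measurable. Qed.

(** Change of variables; it follows from the uniqueness of Lebesgue measure. *)
Lemma ge0_integral_affine (c a : R) (g : R -> \bar R) : a != 0%R ->
  measurable_fun setT g -> (forall x, 0 <= g x) ->
  `|a|%:E * \int[leb]_s g (c + a * s)%R = \int[leb]_x g x.
Proof.
move=> a0 mg g0.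
pose F (s : R) : measurableTypeR R := (c + a * s)%R.
have mF : measurable_fun setT F := measurable_affine c a.
have Na0 : (0 <= `|a|)%R by [].
pose nu : {measure set (measurableTypeR R) -> \bar R} :=
  measure_function_pushforward__canonical__measure_function_Measure leb mF.
pose mu' : {measure set (measurableTypeR R) -> \bar R} := mscale (NngNum Na0) nu.
have E A : measurable A -> leb A = mu' A.
  apply: lebesgue_measure_unique => _ [[x y] _ <-] /=.
  rewrite /mu' /= /mscale /= /pushforward lebesgue_measure_itv /= lte_fin.
  have [xy|yx] := ltP x y; last first.
    rewrite (_ : _ @^-1` _ = set0) ?measure0 ?mule0 //.
    by apply/seteqP; split => // s /=; rewrite /F in_itv /= => /andP[h1 h2]; lra.
  move: a0; rewrite neq_lt => /orP[a0|a0].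
    rewrite (_ : _ @^-1` _ = `[(y - c) / a, (x - c) / a[%classic)%R; last first.
      apply/seteqP; split => s /=; rewrite /F !in_itv /=.
        rewrite ler_ndivrMr // ltr_ndivlMr //.
        by move=> /andP[h1 h2]; apply/andP; split; lra.
      rewrite ler_ndivrMr // ltr_ndivlMr //.
      by move=> /andP[h1 h2]; apply/andP; split; lra.
    rewrite lebesgue_measure_itv /= lte_fin ltr_nM2r ?invr_lt0 // ltrD2r xy.
    rewrite -!EFinD -EFinM; congr EFin; rewrite ltr0_norm //; field.
    by rewrite lt_eqF.
  rewrite (_ : _ @^-1` _ = `](x - c) / a, (y - c) / a]%classic)%R; last first.
    apply/seteqP; split => s /=; rewrite /F !in_itv /=.
      rewrite ltr_pdivrMr // ler_pdivlMr //.
      by move=> /andP[h1 h2]; apply/andP; split; lra.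
    rewrite ltr_pdivrMr // ler_pdivlMr //.
    by move=> /andP[h1 h2]; apply/andP; split; lra.
  rewrite lebesgue_measure_itv /= lte_fin ltr_pM2r ?invr_gt0 // ltrD2r xy.
  rewrite -!EFinD -EFinM; congr EFin; rewrite gtr0_norm //; field.
  by rewrite gt_eqF.
rewrite [RHS](eq_measure_integral mu'); last by move=> A mA _; rewrite -E.
rewrite /mu' ge0_integral_mscale //; congr (_ * _).
by rewrite /nu /= ge0_integral_pushforward.
Qed.

Lemma measurable_cone (G : R * R -> \bar R) (c1 c2 a b eta : R) :
  measurable_fun setT G ->
  measurable_fun [set: R * R] (fun q : R * R =>
     G (c1 + a * q.1, c2 + b * q.1 + eta * q.1 * q.2)%R).
Proof.
move=> mG; apply: (measurableT_comp mG).
apply/measurable_fun_pairP; split.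
  apply: (measurableT_comp (measurable_affine c1 a)); exact: measurable_fst.
apply: measurable_funD.
  by apply: (measurableT_comp (measurable_affine c2 b)); exact: measurable_fst.
apply: measurable_funM => //; apply: measurable_funM => //.
Qed.

Section Cone.
Variables (G : R * R -> \bar R) (c1 c2 a b eta e : R).
Hypotheses (e0 : (0 < e)%R) (mG : measurable_fun setT G) (G0 : forall q, 0 <= G q).

Let K (q : R * R) :=
  (Order.max 0 q.1)%:E * G (c1 + a * q.1, c2 + b * q.1 + eta * q.1 * q.2)%R
   * (\1_(`[e, 1%R]%classic : set R) q.1)%:E.

Let mK : measurable_fun setT K.
Proof.
apply: emeasurable_funM; first apply: emeasurable_funM.
- apply/measurable_EFinP; apply: measurable_maxr => //; exact: measurable_fst.
- exact: measurable_cone.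
- apply/measurable_EFinP.
  have mi : measurable_fun setT (\1_(`[e, 1%R]%classic : set R) : R -> R).
    exact: measurable_indic.
  exact: measurableT_comp mi measurable_fst.
Qed.

Let K0 q : 0 <= K q.
Proof. by rewrite /K !mule_ge0 ?G0 // lee_fin ?le_max ?lexx. Qed.

Let KE t : \int[leb]_(s in `[e, 1%R])
    (s%:E * G (c1 + a * s, c2 + b * s + eta * s * t)%R) = \int[leb]_s K (s, t).
Proof.
rewrite [LHS]integral_mkcond; apply: eq_integral => s _.
rewrite /K /patch indicE /=; case: ifPn => [|_]; last by rewrite mule0.
rewrite inE /= in_itv /= => /andP[es _]; rewrite mule1 max_r //.
exact: le_trans (ltW e0) es.
Qed.

Lemma measurable_cone_integral : measurable_fun setT (fun t : R =>
  \int[leb]_(s in `[e, 1%R])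
    (s%:E * G (c1 + a * s, c2 + b * s + eta * s * t)%R)).
Proof.
under eq_fun do rewrite KE.
exact: (measurable_fun_fubini_tonelli_G (m1 := leb) K).
Qed.

(** Change of variables in the parametrization of the cone with vertex
    [(c1, c2)] over a vertical segment: the jacobian is [s] up to a constant,
    which explains the weight. *)
Lemma integral_cone_le : a != 0%R -> (0 < eta)%R ->
  \int[leb]_(t in `[0%R, 1%R]) \int[leb]_(s in `[e, 1%R])
     (s%:E * G (c1 + a * s, c2 + b * s + eta * s * t)%R) <=
  (`|a| * eta)^-1%:E * \int[leb \x leb]_q G q.
Proof.
move=> a0 eta0.
have e1 : \int[leb]_(t in `[0%R, 1%R]) \int[leb]_(s in `[e, 1%R])
     (s%:E * G (c1 + a * s, c2 + b * s + eta * s * t)%R) <=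
   \int[leb]_t \int[leb]_s K (s, t).
  under eq_integral do rewrite KE.
  have mF := measurable_fun_fubini_tonelli_G (m1 := leb) K mK K0.
  rewrite integral_mkcond; apply: ge0_le_integral => //.
  - by move=> t _; rewrite /patch; case: (t \in _) => //; exact: integral_ge0.
  - apply/(measurable_restrictT _ _).1 => //.
    by apply: measurable_funTS.
  - by move=> t _; rewrite /patch; case: (t \in _) => //; exact: integral_ge0.
apply: le_trans e1 _; rewrite -(fubini_tonelli (m1 := leb) (m2 := leb) K) //.
have e2 s : \int[leb]_t K (s, t) <=
    eta^-1%:E * \int[leb]_y G (c1 + a * s, y)%R.
  rewrite /K /= indicE; have [|_] := boolP (s \in _); last first.
    under eq_integral do rewrite mule0; rewrite integral0 mule_ge0 //.
      by rewrite lee_fin invr_ge0 ltW.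
    exact: integral_ge0.
  rewrite inE /= in_itv /= => /andP[es s1].
  have s0 : (0 < s)%R := lt_le_trans e0 es.
  have mGs : measurable_fun setT (fun y : R => G (c1 + a * s, y)%R).
    by apply: (measurableT_comp mG); exact: measurable_pair1.
  under eq_integral do rewrite mule1 max_r ?(ltW s0) //.
  have es0 : (eta * s)%R != 0%R by rewrite mulf_neq0 ?gt_eqF.
  rewrite -(ge0_integral_affine (c2 + b * s)%R es0 mGs) //.
  have mGa := measurableT_comp mGs (measurable_affine (c2 + b * s) (eta * s)).
  rewrite ge0_integralZl //; last by rewrite lee_fin ltW.
  rewrite muleA -EFinM gtr0_norm ?mulr_gt0 // mulrA mulVf ?mul1r //.
  by rewrite gt_eqF.
have mH : measurable_fun setT (fun x : R => \int[leb]_y G (x, y)).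
  exact: (measurable_fun_fubini_tonelli_F (m2 := leb) G).
apply: (@le_trans _ _ (\int[leb]_s (eta^-1%:E * \int[leb]_y G (c1 + a * s, y)%R))).
  apply: ge0_le_integral => //.
  - by move=> s _; exact: integral_ge0.
  - exact: (measurable_fun_fubini_tonelli_F (m2 := leb) K).
  - apply: measurable_funeM; apply: (measurableT_comp mH); exact: measurable_affine.
rewrite ge0_integralZl //; last 3 first.
- exact: (measurableT_comp mH (measurable_affine c1 a)).
- by move=> s _; exact: integral_ge0.
- by rewrite lee_fin invr_ge0 ltW.
rewrite fubini_tonelli1 // -(ge0_integral_affine c1 a0 mH); last first.
  by move=> s; exact: integral_ge0.
rewrite muleA -EFinM invfM mulrAC mulVf ?mul1r // normr_eq0 //.
Qed.

End Cone.

End AffineTonelli.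

(** * Integration of a derivative along a segment *)

Section SegmentFTC.
Variable R : realType.
Local Notation cm := (@complex_modulus R).
Local Notation leb := (@lebesgue_measure R).
Variables f g : R[i] -> R[i].
Hypothesis fd : forall z, cm z < 1 -> forall e : R, 0 < e ->
  exists2 d : R, 0 < d &
  forall h, cm h < d -> cm (f (z + h) - f z - g z * h) <= e * cm h.
Hypothesis gc : forall z, cm z < 1 -> forall e : R, 0 < e ->
  exists2 d : R, 0 < d &
  forall w, cm w < 1 -> cm (z - w) < d -> cm (g z - g w) < e.

Lemma near_segment c v (s u : R) : cm (c + s%:C * v) < 1 -> 0 < u ->
  \forall t \near s, cm (g (c + s%:C * v) - g (c + t%:C * v)) < u.
Proof.
move=> s1 u0; have v1 : 0 < 1 + cm v by rewrite ltr_wpDr // cmod_ge0.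
have [d d0 dP] := gc s1 u0.
near=> t.
have st : cm (c + s%:C * v - (c + t%:C * v)) = `|s - t| * cm v.
  have -> : c + s%:C * v - (c + t%:C * v) = (s - t)%:C * v by rewrite rmorphB /=; ring.
  by rewrite cmodM cmod_real.
have ht : `|s - t| < Order.min d (1 - cm (c + s%:C * v)) / (1 + cm v).
  near: t; apply: (cvgrPdist_lt _ _).1; first exact: cvg_id.
  by rewrite divr_gt0 // lt_min d0 subr_gt0.
have : cm (c + s%:C * v - (c + t%:C * v)) < Order.min d (1 - cm (c + s%:C * v)).
  rewrite st; apply: le_lt_trans (_ : `|s - t| * (1 + cm v) < _).
    by rewrite ler_wpM2l // lerDr.
  by rewrite -ltr_pdivlMr.
rewrite lt_min => /andP[h1 h2].
apply: dP => //.
have := cmodB_ge (c + t%:C * v) (c + s%:C * v); rewrite cmodC; lra.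
Unshelve. all: by end_near. Qed.

Section Functional.
Variable L : R[i] -> R.
Hypotheses (LB : forall z w, L (z - w) = L z - L w)
  (LZ : forall (r : R) z, L (r%:C * z) = r * L z) (Lle : forall z, `|L z| <= cm z).

Lemma is_derive_segment c v (s : R) : cm (c + s%:C * v) < 1 ->
  is_derive s 1 (fun s : R => L (f (c + s%:C * v))) (L (g (c + s%:C * v) * v)).
Proof.
move=> s1; set l := L _.
have H : h^-1 *: (L (f (c + (h *: 1 + s)%:C * v)) - L (f (c + s%:C * v))) @[h --> 0^'] --> l.
  apply/cvgrPdist_le => e e0.
  have e0' : 0 < e / (1 + cm v) by rewrite divr_gt0 // ltr_wpDr // cmod_ge0.
  have [d d0 dP] := fd s1 e0'.
  have v1 : 0 < 1 + cm v by rewrite ltr_wpDr // cmod_ge0.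
  near=> h.
  have h0 : h != 0 by near: h; exact: nbhs_dnbhs_neq.
  have hd : `|h| < d / (1 + cm v).
    by near: h; apply: dnbhs0_lt; rewrite divr_gt0.
  have hv : cm (h%:C * v) <= `|h| * (1 + cm v).
    by rewrite cmodM cmod_real ler_wpM2l // lerDr.
  have := dP (h%:C * v); rewrite ltr_pdivlMr // in hd.
  move=> /(_ (le_lt_trans hv hd)) hh.
  have -> : c + (h *: 1 + s)%:C * v = c + s%:C * v + h%:C * v.
    by rewrite [h *: 1]mulr1 rmorphD /= mulrDl addrA addrAC.
  rewrite -LB /l; set z := c + _ in hh *.
  have hC : h%:C != 0 by rewrite (inj_eq (@complexI R) h 0).
  rewrite -[X in `|X - _|](mulKf h0) -LZ -[_ *: _]/(_ * _) -mulrBr normrM normfV -LB.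
  rewrite ler_pdivrMl ?normr_gt0 //; apply: le_trans (Lle _) _.
  have -> : h%:C * (g z * v) = g z * (h%:C * v) by ring.
  rewrite cmodC; apply: le_trans hh _.
  rewrite mulrAC ler_pdivrMr //.
  have := ler_wpM2l (ltW e0) hv; lra.
have D : derivable (fun s : R => L (f (c + s%:C * v))) s 1 by apply/cvg_ex; exists l.
by apply: DeriveDef => //; apply/cvg_lim.
Unshelve. all: by end_near. Qed.

Lemma continuous_segment c v (s : R) : cm (c + s%:C * v) < 1 ->
  {for s, continuous (fun s : R => L (g (c + s%:C * v) * v))}.
Proof.
move=> s1; apply/cvgrPdist_lt => e e0.
have v1 : 0 < 1 + cm v by rewrite ltr_wpDr // cmod_ge0.
apply: filterS (near_segment s1 (divr_gt0 e0 v1)) => t.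
rewrite ltr_pdivlMr // => h.
rewrite -LB -mulrBl; apply: le_lt_trans (Lle _) _; rewrite cmodM.
by apply: le_lt_trans h; rewrite ler_wpM2l ?cmod_ge0 // lerDr.
Qed.

Lemma segment_functional_le c v (e : R) : 0 < e -> e < 1 ->
  (forall s : R, 0 <= s <= 1 -> cm (c + s%:C * v) < 1) ->
  (`|L (f (c + v)) - L (f (c + e%:C * v))|%:E <=
   \int[leb]_(s in `[e, 1%R]) (cm (g (c + s%:C * v)) * cm v)%:E)%E.
Proof.
move=> e0 e1 sD.
have sD' s : s \in `[e, 1] -> cm (c + s%:C * v) < 1.
  by rewrite in_itv /= => /andP[h1 h2]; apply: sD; rewrite h2 andbT; lra.
pose F (s : R) := L (f (c + s%:C * v)); pose G (s : R) := L (g (c + s%:C * v) * v).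
have dF s : s \in `[e, 1] -> is_derive s 1 F (G s).
  by move=> /sD'; exact: is_derive_segment.
have cF s : s \in `[e, 1] -> {for s, continuous F}.
  move=> /dF [D _]; apply: differentiable_continuous; exact/derivable1_diffP.
have cG : {within `[e, 1], continuous G}.
  apply: continuous_in_subspaceT => s; rewrite inE => /sD'; exact: continuous_segment.
have ee : e \in `[e, 1] by rewrite in_itv /= lexx ltW.
have e11 : 1 \in `[e, 1] by rewrite in_itv /= lexx ltW.
have := continuous_FTC2 e1 cG.
move=> /(_ F); rewrite /F /= mul1r => FTC.
have {}FTC : (\int[leb]_(x in `[e, 1%R]) (G x)%:E = (F 1)%:E - (F e)%:E)%E.
  rewrite /F /= mul1r; apply: FTC.
    split.
    - by move=> s se; have [] := dF s (subset_itv_oo_cc se).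
    - exact: cvg_at_right_filter (cF _ ee).
    - exact: cvg_at_left_filter (cF _ e11).
  move=> s se; have := dF s (subset_itv_oo_cc se).
  by move=> D; rewrite derive1E derive_val.
have iG : leb.-integrable `[e, 1] (EFin \o G).
  by apply: continuous_compact_integrable => //; exact: segment_compact.
have -> : (`|L (f (c + v)) - L (f (c + e%:C * v))|%:E =
    `|\int[leb]_(x in `[e, 1%R]) (G x)%:E|)%E.
  by rewrite FTC -EFinB abse_EFin /F /= mul1r.
apply: le_trans (le_abse_integral leb _ _) _ => //.
  by case/integrableP : iG.
have mGc : measurable_fun `[e, 1] (fun s : R => cm (g (c + s%:C * v)) * cm v).
  apply: (@subspace_continuous_measurable_fun R) => //.
  apply: continuous_in_subspaceT => s; rewrite inE => /sD' s1.
  apply: cvgMl; apply/cvgrPdist_lt => u u0.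
  apply: filterS (near_segment s1 u0) => t; apply: le_lt_trans.
  by rewrite ler_norml cmodB_ge andbT lerNl opprB cmodC cmodB_ge.
apply: ge0_le_integral => //.
- by case/integrableP : iG => mG _; exact: measurableT_comp.
- exact/measurable_EFinP.
by move=> s _; rewrite abse_EFin lee_fin -cmodM Lle.
Qed.

End Functional.

(** The fundamental theorem of calculus is applied to the real and imaginary
    parts of [f], whence the factor [2]. The segment starts at [e > 0] because
    weights that are negative powers of [s] will be used. *)
Lemma segment_le c v (e : R) : 0 < e -> e < 1 ->
  (forall s : R, 0 <= s <= 1 -> cm (c + s%:C * v) < 1) ->
  ((cm (f (c + v) - f (c + e%:C * v)))%:E <=
   2%:E * \int[leb]_(s in `[e, 1%R]) (cm (g (c + s%:C * v)) * cm v)%:E)%E.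
Proof.
move=> e0 e1 sD.
have ReZ (r : R) z : complex.Re (r%:C * z) = r * complex.Re z.
  by rewrite ReM /= mul0r subr0.
have ImZ (r : R) z : complex.Im (r%:C * z) = r * complex.Im z.
  by rewrite ImM /= mul0r addr0.
have h1 := segment_functional_le (@ReB R) ReZ (@cmod_Re R) e0 e1 sD.
have h2 := segment_functional_le (@ImB R) ImZ (@cmod_Im R) e0 e1 sD.
have -> : (2%:E = 1 + 1 :> \bar R)%E by rewrite -EFinD.
rewrite ge0_muleDl ?lee01 // !mul1e.
apply: le_trans (leeD h1 h2); rewrite -EFinD lee_fin -ReB -ImB.
exact: cmod_le_ReIm.
Qed.

End SegmentFTC.

(** * A growth estimate for functions with derivative in a weighted space *)

Section Growth.
Variable R : realType.
Local Notation cm := (@complex_modulus R).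
Local Notation leb := (@lebesgue_measure R).

(** Young's inequality for the product of [A * s `^ p^-1] and [s `^ - p^-1],
    with the constants bounded by one. The parameter [l] is used to make the
    second term small. *)
Lemma young_weight (p A s l : R) : 1 < p -> 0 <= A -> 0 < s -> 0 < l ->
  A <= l `^ (p - 1) * (s * A `^ p) + l^-1 * s `^ (- (p - 1)^-1).
Proof.
move=> p1 A0 s0 l0.
have q0 : 0 < p - 1 by rewrite subr_gt0.
have pp : (p == 0) = false by rewrite gt_eqF // (lt_trans ltr01).
suff : l * A <= s * (l * A) `^ p + s `^ (- (p - 1)^-1).
  rewrite -ler_pdivlMl // => /le_trans; apply.
  rewrite mulrDr lerD2r powRM ?(ltW l0) //.
  have -> : l `^ p = l `^ (p - 1) * l.
    by rewrite -{3}(powRr1 (ltW l0)) -powRD ?subrK ?(gt_eqF l0) ?implybT.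
  rewrite le_eqVlt; apply/orP; left; apply/eqP; field.
  by rewrite gt_eqF.
set B := l * A; have B0 : 0 <= B by rewrite mulr_ge0 // ltW.
have [h|h] := leP B (s `^ (- (p - 1)^-1)).
  by apply: le_trans h _; rewrite lerDr mulr_ge0 ?powR_ge0 // ltW.
have Bp : 0 < B by apply: le_lt_trans h; exact: powR_ge0.
apply: le_trans (_ : s * B `^ p <= _); last by rewrite lerDl powR_ge0.
have -> : B `^ p = B `^ (p - 1) * B.
  by rewrite -{3}(powRr1 B0) -powRD ?subrK ?(gt_eqF Bp) ?implybT.
rewrite mulrA ler_peMl // -ler_pdivrMl // mulr1.
have : (s `^ (- (p - 1)^-1)) `^ (p - 1) <= B `^ (p - 1).
  by apply: ge0_ler_powR; rewrite ?nnegrE ?(ltW q0) ?powR_ge0 // ltW.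
rewrite -powRrM mulNr mulVf ?gt_eqF // powR_inv1 //; exact: ltW.
Qed.

Lemma integral_powR_le (b e : R) : 0 < b < 1 -> 0 < e -> e < 1 ->
  (\int[leb]_(s in `[e, 1%R]) (s `^ (- b))%:E <= ((1 - b)^-1)%:E)%E.
Proof.
move=> /andP[b0 b1] e0 e1.
have pos s : s \in `[e, 1] -> 0 < s.
  by rewrite in_itv /= => /andP[/(lt_le_trans e0)].
have b1' : 1 - b != 0 by rewrite gt_eqF // subr_gt0.
pose F (s : R) := (1 - b)^-1 * s `^ (1 - b).
have dF s : s \in `[e, 1] -> is_derive s 1 F (s `^ (- b)).
  move=> /pos s0; have D := is_derive1_powR (1 - b) s0.
  have D' : is_derive s 1 (fun x : R => (1 - b)^-1 *: (x `^ (1 - b)))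
      ((1 - b)^-1 *: ((1 - b) * s `^ (1 - b - 1))) by exact: is_deriveZ.
  apply: trigger_derive D' _.
  rewrite -[_ *: _]/(_ * _) mulrA mulVf // mul1r; congr (_ `^ _); ring.
have cF s : s \in `[e, 1] -> {for s, continuous F}.
  move=> /dF [D _]; apply: differentiable_continuous; exact/derivable1_diffP.
have cG : {within `[e, 1], continuous (fun s : R => s `^ (- b))}.
  apply: continuous_in_subspaceT => s; rewrite inE => /pos s0.
  have [D _] := is_derive1_powR (- b) s0.
  apply: differentiable_continuous; exact/derivable1_diffP.
have ee : e \in `[e, 1] by rewrite in_itv /= lexx ltW.
have e11 : 1 \in `[e, 1] by rewrite in_itv /= lexx ltW.
rewrite (continuous_FTC2 e1 cG (F := F)); last 2 first.
- split.
  + by move=> s se; have [] := dF s (subset_itv_oo_cc se).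
  + exact: cvg_at_right_filter (cF _ ee).
  + exact: cvg_at_left_filter (cF _ e11).
- move=> s se; have := dF s (subset_itv_oo_cc se).
  by move=> D; rewrite derive1E derive_val.
rewrite -EFinB lee_fin /F powR1 mulr1 gerBl mulr_ge0 ?powR_ge0 // invr_ge0 subr_ge0.
exact: ltW.
Qed.

Variables f g : R[i] -> R[i].
Hypothesis fd : forall z, cm z < 1 -> forall e : R, 0 < e ->
  exists2 d : R, 0 < d &
  forall h, cm h < d -> cm (f (z + h) - f z - g z * h) <= e * cm h.
Hypothesis gc : forall z, cm z < 1 -> forall e : R, 0 < e ->
  exists2 d : R, 0 < d &
  forall w, cm w < 1 -> cm (z - w) < d -> cm (g z - g w) < e.

(** Since [g] is only controlled in the unit disc, its powers are cut off
    outside of a smaller disc to be integrated over the plane. *)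
Definition truncated_power (p r : R) : R * R -> \bar R :=
  (fun q : R * R => (cm (g (q.1 +i* q.2)) `^ p)%:E) \_ [set q | cm (q.1 +i* q.2) < r].

Lemma cmod_pairB (q q' : R * R) (d : R) : `|q.1 - q'.1| < d / 2 ->
  `|q.2 - q'.2| < d / 2 -> cm (q.1 +i* q.2 - (q'.1 +i* q'.2)) < d.
Proof.
move=> h1 h2; apply: le_lt_trans (cmod_le_ReIm _) _.
by rewrite ReB ImB /= (splitr d) ltrD.
Qed.

Lemma open_disc_pair (r : R) q : cm (q.1 +i* q.2) < r -> exists2 e : R, 0 < e &
  forall q' : R * R, `|q.1 - q'.1| < e -> `|q.2 - q'.2| < e -> cm (q'.1 +i* q'.2) < r.
Proof.
move=> qr; exists ((r - cm (q.1 +i* q.2)) / 2); first by rewrite divr_gt0 // subr_gt0.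
move=> q' h1 h2; have := cmod_pairB h1 h2.
have := cmodB_ge (q'.1 +i* q'.2) (q.1 +i* q.2); rewrite cmodC; lra.
Qed.

Lemma measurable_disc_pair (r : R) : measurable [set q : R * R | cm (q.1 +i* q.2) < r].
Proof. by apply: measurable_open_plane => q /open_disc_pair. Qed.

Lemma measurable_cmod_pair : measurable_fun setT (fun q : R * R => cm (q.1 +i* q.2)).
Proof.
apply: measurable_fun_open_plane => [q _|q _ e e0]; first by exists 1.
exists (e / 2) => [|q' _ h1 h2]; first by rewrite divr_gt0.
apply: le_lt_trans (cmod_pairB h1 h2).
by rewrite ler_norml cmodB_ge andbT lerNl opprB cmodC cmodB_ge.
Qed.

Lemma measurable_cmod_deriv :
  measurable_fun [set q : R * R | cm (q.1 +i* q.2) < 1]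
    (fun q : R * R => cm (g (q.1 +i* q.2))).
Proof.
apply: measurable_fun_open_plane => [q /open_disc_pair //|q q1 e e0].
have [d d0 dP] := gc q1 e0; exists (d / 2) => [|q' q'1 h1 h2]; first by rewrite divr_gt0.
apply: le_lt_trans (dP _ q'1 (cmod_pairB h1 h2)).
by rewrite ler_norml cmodB_ge andbT lerNl opprB cmodC cmodB_ge.
Qed.

Lemma measurable_truncated_power (p r : R) : r <= 1 ->
  measurable_fun setT (truncated_power p r).
Proof.
move=> r1; rewrite /truncated_power.
have /(measurable_restrictT _) H := measurable_disc_pair r; apply/H.
apply/measurable_EFinP; apply: (measurableT_comp (measurable_powR p)).
apply: measurable_funS measurable_cmod_deriv.
  exact: measurable_disc_pair.
by move=> q /= /lt_le_trans; apply.
Qed.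

Lemma truncated_power_ge0 (p r : R) q : (0 <= truncated_power p r q)%E.
Proof. by rewrite /truncated_power /patch; case: (_ \in _) => //; rewrite lee_fin powR_ge0. Qed.

(** [young_weight] is applied under the integral of [segment_le]: the first term
    is an integral over a cone with the jacobian [s] as weight, and the second
    one is bounded because [(p - 1)^-1 < 1]. This is where [2 < p] is needed. *)
Lemma cone_le (p r : R) (c1 c2 a b eta e l t : R) : 2 < p -> r <= 1 ->
  0 < e -> e < 1 -> 0 < l ->
  cm (a +i* (b + eta * t)) <= 2 ->
  (forall s : R, 0 <= s <= 1 -> cm ((c1 + a * s) +i* (c2 + b * s + eta * s * t)) < r) ->
  ((cm (f ((c1 +i* c2) + (a +i* (b + eta * t))) -
       f ((c1 +i* c2) + e%:C * (a +i* (b + eta * t)))))%:E <=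
   (4 * l `^ (p - 1))%:E * \int[leb]_(s in `[e, 1%R]) (s%:E *
      truncated_power p r (c1 + a * s, c2 + b * s + eta * s * t)%R) +
   (4 * (l^-1 * (1 - (p - 1)^-1)^-1))%:E)%E.
Proof.
move=> p2 r1 e0 e1 l0 v2 sD; set c := c1 +i* c2; set v := _ +i* (b + _) in v2 *.
have E s : c + s%:C * v = (c1 + a * s) +i* (c2 + b * s + eta * s * t).
  by rewrite /c /v; apply/eqP; rewrite eq_complex ReD ImD ReM ImM /=;
     apply/andP; split; apply/eqP; ring.
have sD' s : 0 <= s <= 1 -> cm (c + s%:C * v) < 1.
  by move=> s01; rewrite E; exact: lt_le_trans (sD _ s01) r1.
apply: le_trans (segment_le fd gc e0 e1 sD') _.
have q0 : 0 < p - 1 by lra.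
have q1 : 0 < (p - 1)^-1 < 1 by rewrite invr_gt0 q0 invf_lt1 //; lra.
set T := (fun s : R => (s%:E * _)%E).
have pos s : s \in `[e, 1] -> 0 < s /\ s <= 1.
  by rewrite in_itv /= => /andP[/(lt_le_trans e0)].
have TE s : s \in `[e, 1] -> T s = (s * cm (g (c + s%:C * v)) `^ p)%:E.
  move=> /pos[s0 s1]; rewrite /T /truncated_power /patch mem_set /= -?E ?EFinM //.
  by rewrite E; apply: sD; rewrite s1 ltW.
have mT : measurable_fun `[e, 1] T.
  rewrite /T; apply: emeasurable_funM => //.
  apply: measurable_funTS; apply: (measurableT_comp (measurable_truncated_power p r1)).
  apply/measurable_fun_pairP; split => /=; first exact: measurable_affine.
  apply: measurable_funD; first exact: measurable_affine.
  by apply: measurable_funM => //; exact: mulrl_measurable.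
have T0 s : s \in `[e, 1] -> (0 <= T s)%E.
  by move=> /pos[s0 s1]; rewrite /T mule_ge0 ?truncated_power_ge0 // lee_fin ltW.
have mP : measurable_fun `[e, 1] (fun s : R => (l^-1 * s `^ (- (p - 1)^-1))%:E).
  apply/measurable_EFinP; apply: measurable_funM => //.
  exact: measurable_funTS (measurable_powR _).
have mM : measurable_fun `[e, 1] (fun s : R => (2%:E * ((l `^ (p - 1))%:E * T s +
    (l^-1 * s `^ (- (p - 1)^-1))%:E))%E).
  by apply: measurable_funeM; apply: emeasurable_funD => //; exact: measurable_funeM.
have mmul : measurable_fun `[e, 1] (fun s : R => (l `^ (p - 1))%:E * T s)%E.
  exact: measurable_funeM.
have mulT0 s : s \in `[e, 1] -> (0 <= (l `^ (p - 1))%:E * T s)%E.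
  by move=> se; rewrite mule_ge0 ?T0 // lee_fin powR_ge0.
have P0 (s : R) : (0 <= (l^-1 * s `^ (- (p - 1)^-1))%:E)%E.
  by rewrite lee_fin mulr_ge0 ?powR_ge0 // invr_ge0 ltW.
have step : (\int[leb]_(s in `[e, 1%R]) (cm (g (c + s%:C * v)) * cm v)%:E <=
   \int[leb]_(s in `[e, 1%R]) (2%:E * ((l `^ (p - 1))%:E * T s +
    (l^-1 * s `^ (- (p - 1)^-1))%:E)))%E.
  apply: ge0_le_integral => //.
  - by move=> s _; rewrite lee_fin mulr_ge0 ?cmod_ge0.
  - apply/measurable_EFinP; apply: (@subspace_continuous_measurable_fun R) => //.
    apply: continuous_in_subspaceT => s; rewrite inE => /pos [s0 s1].
    apply: cvgMl; apply/cvgrPdist_lt => u u0.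
    have s1' : cm (c + s%:C * v) < 1 by apply: sD'; rewrite s1 ltW.
    apply: filterS (near_segment gc s1' u0) => x; apply: le_lt_trans.
    by rewrite ler_norml cmodB_ge andbT lerNl opprB cmodC cmodB_ge.
  - move=> s se; rewrite TE // -EFinM lee_fin mulrC.
    apply: ler_pM; rewrite ?cmod_ge0 //.
    by have [s0 _] := pos s se; apply: young_weight; rewrite ?cmod_ge0 //; lra.
apply: le_trans (lee_wpmul2l _ step) _; first by rewrite lee_fin.
rewrite ge0_integralZl //; last first.
  by move=> s se; rewrite adde_ge0 ?mulT0.
  by apply: emeasurable_funD.
rewrite ge0_integralD // ge0_integralZl //; last by rewrite lee_fin powR_ge0.
rewrite muleA -EFinM ge0_muleDr; last 2 first.
- rewrite mule_ge0 ?lee_fin ?powR_ge0 // integral_ge0 //.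
- by rewrite integral_ge0.
rewrite muleA -EFinM; apply: leeD; first by rewrite -natrM.
rewrite -natrM EFinM; apply: lee_wpmul2l; first by rewrite lee_fin.
under eq_integral do rewrite EFinM.
rewrite ge0_integralZl //; last 3 first.
- by apply/measurable_EFinP; exact: measurable_funTS (measurable_powR _).
- by move=> s _; rewrite lee_fin powR_ge0.
- by rewrite lee_fin invr_ge0 ltW.
rewrite EFinM; apply: lee_wpmul2l; first by rewrite lee_fin invr_ge0 ltW.
exact: integral_powR_le.
Qed.

End Growth.

Section GrowthBound.
Variable R : realType.
Local Notation cm := (@complex_modulus R).
Local Notation leb := (@lebesgue_measure R).
Variables f g : R[i] -> R[i].
Hypothesis fd : forall z, cm z < 1 -> forall e : R, 0 < e ->
  exists2 d : R, 0 < d &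
  forall h, cm h < d -> cm (f (z + h) - f z - g z * h) <= e * cm h.
Hypothesis gc : forall z, cm z < 1 -> forall e : R, 0 < e ->
  exists2 d : R, 0 < d &
  forall w, cm w < 1 -> cm (z - w) < d -> cm (g z - g w) < e.

Definition weighted_energy (p : R) : \bar R :=
  (\int[leb \x leb]_(q in [set q : R * R | (cm (q.1 +i* q.2) < 1)%R])
    (((1 - cm (q.1 +i* q.2)) `^ (p - 1) * cm (g (q.1 +i* q.2)) `^ p)%:E))%E.

Lemma integral_truncated_power_le (p r : R) : 1 < p -> 0 < r < 1 ->
  (\int[leb \x leb]_q truncated_power g p (1 - r) q <=
   (r `^ (p - 1))^-1%:E * weighted_energy p)%E.
Proof.
move=> p1 /andP[r0 r1].
have q0 : 0 < p - 1 by rewrite subr_gt0.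
have rp : 0 < r `^ (p - 1) by exact: powR_gt0.
have r1' : 1 - r <= 1 by lra.
have mD := measurable_disc_pair (1 : R).
have mg := measurable_cmod_deriv gc.
rewrite /weighted_energy -ge0_integralZl //; last 3 first.
- apply/measurable_EFinP; apply: measurable_funM; last first.
    exact: (measurableT_comp (measurable_powR p) mg).
  apply: (measurableT_comp (measurable_powR (p - 1))); apply: measurable_funB => //.
  exact: measurable_funTS (@measurable_cmod_pair R).
- by move=> q _; rewrite lee_fin mulr_ge0 ?powR_ge0.
- by rewrite lee_fin invr_ge0 powR_ge0.
rewrite [leRHS]integral_mkcond; apply: ge0_le_integral => //.
- by move=> q _; exact: truncated_power_ge0.
- exact: measurable_truncated_power.
- have /(measurable_restrictT _) H := mD; apply/H; apply: measurable_funeM.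
  apply/measurable_EFinP; apply: measurable_funM; last first.
    exact: (measurableT_comp (measurable_powR p) mg).
  apply: (measurableT_comp (measurable_powR (p - 1))); apply: measurable_funB => //.
  exact: measurable_funTS (@measurable_cmod_pair R).
move=> q _; rewrite /truncated_power /patch.
case: ifPn => [|_]; last first.
  by case: ifPn => // _; rewrite -EFinM lee_fin !mulr_ge0 ?invr_ge0 ?powR_ge0.
rewrite inE /= => qr; have q1 : cm (q.1 +i* q.2) < 1 by lra.
rewrite mem_set //= -EFinM lee_fin ler_pdivlMl // ler_wpM2r ?powR_ge0 //.
by apply: ge0_ler_powR; rewrite ?nnegrE; lra.
Qed.

Lemma le_integral_average (x L K : R) (J1 J2 : R -> \bar R) :
  0 <= x -> 0 <= L -> 0 <= K ->
  measurable_fun (`[0, 1]%classic : set R) J1 ->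
  measurable_fun (`[0, 1]%classic : set R) J2 ->
  (forall t, 0 <= J1 t)%E -> (forall t, 0 <= J2 t)%E ->
  (forall t, 0 <= t <= 1 -> (x%:E <= L%:E * (J1 t + J2 t) + K%:E)%E) ->
  (x%:E <= L%:E * (\int[leb]_(t in `[0%R, 1%R]) J1 t +
                   \int[leb]_(t in `[0%R, 1%R]) J2 t) + K%:E)%E.
Proof.
move=> x0 L0 K0 m1 m2 J10 J20 key.
have mJ : measurable_fun (`[0, 1]%classic : set R) (fun t => J1 t + J2 t)%E.
  exact: emeasurable_funD.
have mLJ : measurable_fun (`[0, 1]%classic : set R) (fun t => L%:E * (J1 t + J2 t))%E.
  exact: measurable_funeM.
have mJL : measurable_fun (`[0, 1]%classic : set R)
    (fun t => L%:E * (J1 t + J2 t) + K%:E)%E.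
  exact: emeasurable_funD.
have J0 t : (0 <= J1 t + J2 t)%E by exact: adde_ge0.
have LJ0 t : (0 <= L%:E * (J1 t + J2 t))%E by exact: mule_ge0.
have : (\int[leb]_(t in `[0%R, 1%R]) x%:E <=
    \int[leb]_(t in `[0%R, 1%R]) (L%:E * (J1 t + J2 t) + K%:E))%E.
  by apply: ge0_le_integral.
rewrite integral_cst //= lebesgue_measure_itv /= lte_fin ltr01 oppr0 adde0 mule1.
rewrite ge0_integralD // integral_cst //= lebesgue_measure_itv /= lte_fin ltr01.
by rewrite oppr0 adde0 mule1 ge0_integralZl_EFin // ge0_integralD.
Qed.

(** For a point [w] of a vertical segment, the increments of [f] from [0] to [w]
    and from [z] to [w] are bounded by [cone_le]. In the average over [w] the
    integrals along segments become integrals over two cones, with vertices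
    [0] and [z], both contained in the disc of radius [1 - (1 - cm z) / 4]. The
    segment is at distance at least [(1 - cm z) / 4] from both vertical lines
    through the vertices, which keeps the cones from degenerating. *)
Lemma growth_bound (p l I : R) z : 2 < p -> 0 < l -> 0 <= I ->
  (weighted_energy p <= I%:E)%E -> cm z < 1 ->
  cm (f z - f 0) <=
    256 * l `^ (p - 1) * (1 - cm z) ^- 2 * (((1 - cm z) / 4) `^ (p - 1))^-1 * I +
    16 * (1 - (p - 1)^-1)^-1 / l.
Proof.
move=> p2 l0 I0 WI z1.
set del := 1 - cm z; have del0 : 0 < del by rewrite /del subr_gt0.
have del1 : del <= 1 by rewrite /del; have := cmod_ge0 z; lra.
have q0 : 0 < p - 1 by lra.
have K0 : 0 <= (1 - (p - 1)^-1)^-1.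
  by rewrite invr_ge0 subr_ge0 invf_le1 //; lra.
have [D0|D0] := leP (cm (f z - f 0)) 0.
  apply: le_trans D0 _; apply: addr_ge0; last first.
    by rewrite !mulr_ge0 // invr_ge0 ltW.
  apply: mulr_ge0; last exact: I0.
  apply: mulr_ge0; last by rewrite invr_ge0 powR_ge0.
  apply: mulr_ge0; last by rewrite invr_ge0 exprn_ge0 // ltW.
  by apply: mulr_ge0; [exact: ler0n|exact: powR_ge0].
set D := cm (f z - f 0) in D0 *.
have [x0 [y0 zE]] : exists x0 y0, z = x0 +i* y0 by case: (z) => x y; exists x, y.
(* the segment is placed on the side of [z] that is away from the origin *)
pose a := if 0 <= x0 then del / 4 else - (del / 4).
have na : `|a| = del / 4.
  rewrite /a; case: ifP => _; rewrite ?normrN gtr0_norm //; lra.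
have nm : del / 4 <= `|x0 + a|.
  rewrite /a; case: (leP 0 x0) => h.
    by rewrite ger0_norm; lra.
  by rewrite ltr0_norm; lra.
(* [e] will be so small that the ends of the segments cut off near the vertices
   contribute at most half of [D] *)
have cont c : cm c < 1 -> exists2 e : R, 0 < e &
    forall h, cm h < e -> cm (f (c + h) - f c) <= D / 4.
  move=> c1; have [d d0 dP] := fd c1 ltr01.
  have g0 : 0 < 1 + cm (g c) by rewrite ltr_wpDr // cmod_ge0.
  exists (Order.min d (D / 4 / (1 + cm (g c)))).
    by rewrite lt_min d0 !divr_gt0.
  move=> h; rewrite lt_min ltr_pdivlMr // => /andP[/dP h1 h2].
  rewrite -[_ - f c](subrK (g c * h)); apply: le_trans (cmodD _ _) _.
  rewrite cmodM; lra.
have [ez ez0 ezP] := cont z z1.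
have [eo eo0 eoP] := cont 0 (eq_ind_r (fun x => x < 1) ltr01 (cmod0 R)).
pose e := Order.min (Order.min ez eo) 1 / 4.
have em0 : 0 < Order.min (Order.min ez eo) 1 by rewrite !lt_min ez0 eo0 ltr01.
have e0 : 0 < e by rewrite divr_gt0.
have [eez eeo e1] : [/\ 2 * e < ez, 2 * e < eo & e < 1].
  have : 2 * e < Order.min (Order.min ez eo) 1 by rewrite /e; lra.
  by rewrite !lt_min => /andP[/andP[-> ->] h]; split => //; lra.
pose r := 1 - del / 4; have r1 : r <= 1 by rewrite /r; lra.
have zdel : cm z = 1 - del by rewrite /del; lra.
have smallv s t : 0 <= s <= 1 -> 0 <= t <= 1 -> cm ((a * s) +i* (del / 4 * s * t)) <= del / 2.
  move=> /andP[s0 s1] /andP[t0 t1]; apply: le_trans (cmod_le_ReIm _) _ => /=.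
  rewrite normrM na (ger0_norm s0) (ger0_norm (mulr_ge0 (mulr_ge0 _ s0) t0)); last by lra.
  have : del / 4 * s <= del / 4 by rewrite ler_piMr //; lra.
  have : del / 4 * s * t <= del / 4 * s by rewrite ler_piMr // mulr_ge0 //; lra.
  lra.
have v1 t : 0 <= t <= 1 -> cm (a +i* (0 + del / 4 * t)) <= del / 2.
  by move=> t01; have := smallv 1 t; rewrite !mulr1 add0r; apply => //; rewrite ler01 lexx.
have wE t : (x0 + a) +i* (y0 + del / 4 * t) = z + (a +i* (0 + del / 4 * t)).
  by rewrite zE add0r.
have w1 t : 0 <= t <= 1 -> cm ((x0 + a) +i* (y0 + del / 4 * t)) <= 1 - del / 2.
  move=> t01; rewrite wE; apply: le_trans (cmodD _ _) _; have := v1 t t01; lra.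
pose Jz (t : R) := (\int[leb]_(s in `[e, 1%R]) (s%:E *
      truncated_power g p r (x0 + a * s, y0 + 0 * s + del / 4 * s * t)%R))%E.
pose Jo (t : R) := (\int[leb]_(s in `[e, 1%R]) (s%:E *
      truncated_power g p r (0 + (x0 + a) * s, 0 + y0 * s + del / 4 * s * t)%R))%E.
have Jz0 t : (0 <= Jz t)%E.
  apply: integral_ge0 => s; rewrite /= in_itv /= => /andP[es _].
  by rewrite mule_ge0 ?truncated_power_ge0 // lee_fin (le_trans (ltW e0)).
have Jo0 t : (0 <= Jo t)%E.
  apply: integral_ge0 => s; rewrite /= in_itv /= => /andP[es _].
  by rewrite mule_ge0 ?truncated_power_ge0 // lee_fin (le_trans (ltW e0)).
pose K1 : R := 4 * (l^-1 * (1 - (p - 1)^-1)^-1).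
pose L1 : R := 4 * l `^ (p - 1).
have K10 : 0 <= K1 by rewrite /K1 !mulr_ge0 // invr_ge0 ltW.
have L10 : 0 <= L1 by rewrite /L1 !mulr_ge0 // powR_ge0.
have key t : 0 <= t <= 1 -> ((D / 2)%:E <= L1%:E * (Jz t + Jo t) + (2 * K1)%:E)%E.
  move=> t01.
  have hz : ((cm (f (z + (a +i* (0 + del / 4 * t))) -
       f (z + e%:C * (a +i* (0 + del / 4 * t)))))%:E <= L1%:E * Jz t + K1%:E)%E.
    rewrite zE; apply: cone_le => //.
      by apply: le_trans (v1 t t01) _; lra.
    move=> s s01; rewrite mul0r addr0.
    rewrite (_ : _ +i* _ = z + ((a * s) +i* (del / 4 * s * t))); last by rewrite zE.
    apply: le_lt_trans (cmodD _ _) _; have := smallv s t s01 t01; rewrite /r; lra.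
  have ho : ((cm (f (0 + ((x0 + a) +i* (y0 + del / 4 * t))) -
       f (0 + e%:C * ((x0 + a) +i* (y0 + del / 4 * t)))))%:E <= L1%:E * Jo t + K1%:E)%E.
    apply: (@cone_le _ f g fd gc p r 0 0) => //.
      by apply: le_trans (w1 t t01) _; lra.
    move=> s s01.
    rewrite (_ : _ +i* _ = s%:C * ((x0 + a) +i* (y0 + del / 4 * t))); last first.
      by apply/eqP; rewrite eq_complex ReM ImM /=; apply/andP; split; apply/eqP; ring.
    move: s01 => /andP[s0 s1]; rewrite cmodM cmod_real (ger0_norm s0).
    have := w1 t t01; have := cmod_ge0 ((x0 + a) +i* (y0 + del / 4 * t)).
    rewrite /r; nra.
  have := leeD hz ho; set hL := (_ + _)%E => hLR.
  have : ((D / 2)%:E <= hL)%E.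
    rewrite /hL -EFinD lee_fin !add0r.
    have sm w : cm w <= 1 -> cm (e%:C * w) <= 2 * e.
      by move=> w1'; rewrite cmodM cmod_real gtr0_norm //; nra.
    have b1 := ezP (e%:C * (a +i* (del / 4 * t))).
    have b2 := eoP (e%:C * ((x0 + a) +i* (y0 + del / 4 * t))).
    have {}b1 := b1 (le_lt_trans (sm _ _) eez).
    have {}b2 := b2 (le_lt_trans (sm _ _) eeo).
    have v1' := v1 t t01; have w1' := w1 t t01; rewrite add0r in v1'.
    have {}b1 : cm (f (z + e%:C * (a +i* (del / 4 * t))) - f z) <= D / 4 by apply: b1; lra.
    have {}b2 : cm (f (e%:C * ((x0 + a) +i* (y0 + del / 4 * t))) - f 0) <= D / 4.
      by rewrite add0r in b2; apply: b2; lra.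
    rewrite wE add0r in b2; rewrite wE add0r.
    move: b1 b2; set W := f (z + (a +i* _)); set X := f (z + _); set Y := f (_ * _) => b1 b2.
    have t1 := cmod_tri X (f z) (f 0); have t2 := cmod_tri W X (f 0).
    have t3 := cmod_tri Y W (f 0); rewrite -/D (cmodC (f z)) (cmodC X W) in t1 t2.
    lra.
  move=> /le_trans; apply; apply: le_trans hLR _.
  rewrite le_eqVlt; apply/orP; left; apply/eqP.
  have K2 : K1 + K1 = 2 * K1 by ring.
  by rewrite addeACA -EFinD K2 (ge0_muleDr _ (Jz0 t) (Jo0 t)).
have mtp := measurable_truncated_power gc p r1.
have tp0 := truncated_power_ge0 g p r.
have mJz : measurable_fun (`[0, 1]%classic : set R) Jz.
  by apply: measurable_funTS; exact: measurable_cone_integral.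
have mJo : measurable_fun (`[0, 1]%classic : set R) Jo.
  by apply: measurable_funTS; exact: measurable_cone_integral.
have D20 : 0 <= D / 2 by rewrite divr_ge0 // ltW.
have K20 : 0 <= 2 * K1 by rewrite mulr_ge0.
have := le_integral_average D20 L10 K20 mJz mJo Jz0 Jo0 key.
have d4 : 0 < del / 4 by lra.
have a0 : a != 0 by rewrite -normr_gt0 na.
have m0 : x0 + a != 0 by rewrite -normr_gt0; lra.
have Iz := @integral_cone_le _ (truncated_power g p r) x0 y0 a 0 (del / 4) e e0 mtp tp0 a0 d4.
have Io := @integral_cone_le _ (truncated_power g p r) 0 0 (x0 + a) y0 (del / 4) e e0 mtp tp0 m0 d4.
have IT : (\int[leb \x leb]_q truncated_power g p r q <=
    (((del / 4) `^ (p - 1))^-1 * I)%:E)%E.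
  apply: le_trans (integral_truncated_power_le _ _) _; [lra|lra|].
  by rewrite EFinM; apply: lee_wpmul2l => //; rewrite lee_fin invr_ge0 powR_ge0.
pose T : R := ((del / 4) `^ (p - 1))^-1 * I.
have T0 : 0 <= T by rewrite mulr_ge0 // invr_ge0 powR_ge0.
have bnd (m : R) : del / 4 <= `|m| ->
   ((`|m| * (del / 4))^-1%:E * \int[leb \x leb]_q truncated_power g p r q <=
    (16 * del ^- 2 * T)%:E)%E.
  move=> hm; have pm : 0 < `|m| * (del / 4) by rewrite mulr_gt0 //; lra.
  apply: le_trans (lee_wpmul2l _ IT) _; first by rewrite lee_fin invr_ge0 ltW.
  rewrite -EFinM lee_fin ler_wpM2r // invf_ple ?posrE //; last first.
    by rewrite mulr_gt0 // invr_gt0 exprn_gt0.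
  rewrite invfM invrK expr2; have : del / 4 * (del / 4) <= `|m| * (del / 4).
    by rewrite ler_wpM2r // ltW.
  lra.
have Bz := le_trans Iz (bnd a _); have Bo := le_trans Io (bnd _ nm).
have {}Bz := Bz (eq_ind_r (fun x => _ <= x) (lexx _) na).
set B := 16 * del ^- 2 * T in Bz Bo *.
have BE : ((L1 * (B + B) + 2 * K1)%:E = L1%:E * (B%:E + B%:E) + (2 * K1)%:E)%E by [].
move=> H; have {H} : ((D / 2)%:E <= (L1 * (B + B) + 2 * K1)%:E)%E.
  rewrite BE; apply: (le_trans H); apply: (leeD _ (lexx _)).
  have L1E : (0 <= L1%:E)%E by rewrite lee_fin.
  have BzJ : (\int[leb]_(t in `[0%R, 1%R]) Jz t <= B%:E)%E := Bz.
  have BoJ : (\int[leb]_(t in `[0%R, 1%R]) Jo t <= B%:E)%E := Bo.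
  exact: (lee_wpmul2l L1E (leeD BzJ BoJ)).
rewrite lee_fin /B /L1 /K1 /T.
have -> : 16 * (1 - (p - 1)^-1)^-1 / l = 16 * (l^-1 * (1 - (p - 1)^-1)^-1) by ring.
have -> : 256 * l `^ (p - 1) * del ^- 2 * ((del / 4) `^ (p - 1))^-1 * I =
   256 * (l `^ (p - 1) * (del ^- 2 * (((del / 4) `^ (p - 1))^-1 * I))) by ring.
lra.
Qed.

End GrowthBound.

(** * The derivative of a singular inner function *)

Section ComplexDerivative.
Variable R : realType.
Local Notation cm := (@complex_modulus R).
Implicit Types (f : R[i]^o -> R[i]^o) (z : R[i]^o).

Lemma dnbhs_cmod z (A : set R[i]^o) :
  z^' A <-> exists2 e : R, 0 < e & forall w, w != z -> cm (z - w) < e -> A w.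
Proof.
split=> [/nbhs_cmod[e e0 eA]|[e e0 eA]].
  by exists e => // w wz zw; exact: eA.
by apply/nbhs_cmod; exists e => // w zw wz; exact: eA.
Qed.

(** The first order expansion is easier to establish for a function that is
    defined by an integral than the convergence of difference quotients. *)
Lemma is_derive_cmodP f z (l : R[i]^o) : is_derive z 1 f l <->
  forall e : R, 0 < e -> exists2 d : R, 0 < d &
    forall h, cm h < d -> cm (f (z + h) - f z - l * h) <= e * cm h.
Proof.
have E (h : R[i]) : h != 0 ->
    cm (l - h^-1 *: ((f \o shift z) (h *: (1 : R[i]^o)) - f z)) =
    cm (f (z + h) - f z - l * h) / cm h.
  move=> h0; rewrite /= -[_^-1 *: _]/(_ * _) -[h *: _]/(h * 1).
  rewrite -cmod_div cmodC mulr1 (addrC h); congr cm.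
  by rewrite mulrBl mulfK // mulrC.
split=> [[df dl] e e0|H].
  have /cvg_cmod/(_ e e0) := df; rewrite -/(derive f z 1) dl.
  move=> /dnbhs_cmod[d d0 dP].
  exists d => // h hd; have [->|h0] := eqVneq h 0.
    by rewrite addr0 subrr mulr0 subr0 cmod0 mulr0.
  have := dP h h0; rewrite sub0r cmodN => /(_ hd) dPh.
  have := eq_ind _ (fun x => x < e) dPh _ (E h h0).
  by rewrite ltr_pdivrMr ?cmod_gt0 // => /ltW.
have cv (e : R) : 0 < e -> exists2 d : R, 0 < d & forall h : R[i]^o, h != 0 -> cm (0 - h) < d ->
    cm (l - (h : R[i])^-1 *: ((f \o shift z) ((h : R[i]) *: (1 : R[i]^o)) - f z)) < e.
  move=> e0; have [d d0 dP] := H _ (divr_gt0 e0 (ltr0n R 2)).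
  exists d => // h h0; rewrite sub0r cmodN => hd.
  apply: (eq_ind_r (fun x => x < e) _ (E h h0)); rewrite ltr_pdivrMr ?cmod_gt0 //.
  apply: le_lt_trans (dP _ hd) _; rewrite ltr_pM2r ?cmod_gt0 //; lra.
have D : derivable f z 1.
  apply/cvg_ex; exists l; apply/cvg_cmod => e /cv[d d0 dP].
  by apply/dnbhs_cmod; exists d.
apply: DeriveDef; first exact: D.
apply/cvg_lim; first exact: norm_hausdorff.
apply/cvg_cmod => e /cv[d d0 dP].
by apply/dnbhs_cmod; exists d.
Qed.

Lemma is_derive_horner (p : {poly R[i]}) z : is_derive z 1 (fun x : R[i]^o => p.[x] : R[i]^o) p^`().[z].
Proof.
elim/poly_ind: p => [|p c IH].
  rewrite deriv0 horner0 (_ : (fun x => _) = cst 0); first exact: is_derive_cst.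
  by apply/funext => x; rewrite horner0.
rewrite (_ : (fun x => _) = (fun x : R[i]^o => (p.[x] : R[i]^o)) * id + cst (c : R[i]^o)); last first.
  by apply/funext => x /=; rewrite !hornerE.
have D := is_deriveD (is_deriveM IH (is_derive_id z (1 : R[i]^o))) (is_derive_cst (c : R[i]^o) z 1).
have -> : (p * 'X + c%:P)^`().[z] = (p.[z] : R[i]) * 1 + (z : R[i]) * p^`().[z] + 0.
  by rewrite derivD derivM derivC derivX !hornerE; ring.
exact: D.
Qed.

Lemma real_littleo (F : R -> R) (l : R) : is_derive (0 : R) (1 : R) F l ->
  forall e : R, 0 < e -> exists2 d : R, 0 < d &
    forall y, `|y| < d -> `|F y - F 0 - l * y| <= e * `|y|.
Proof.
move=> [df <-] e e0.
have /cvgrPdist_lt/(_ e e0)/nbhs_ballP[d /= d0 dP] := df.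
exists d => // y yd; have [->|y0] := eqVneq y 0.
  by rewrite subrr mulr0 subr0 normr0 mulr0.
have := dP y; rewrite /ball /= sub0r normrN => /(_ yd y0).
rewrite addr0 [_ *: 1]mulr1 -[_ *: (_ - _)]/(_ * _) -/(derive F (0 : R) (1 : R)).
move=> h; rewrite -ler_pdivrMr ?normr_gt0 // -normf_div ltW //.
by rewrite mulrBl mulfK // distrC (mulrC (F y - _)).
Qed.

Lemma cexp_littleo (e : R) : 0 < e -> exists2 d : R, 0 < d &
  forall k : R[i], cm k < d -> cm (cexp k - 1 - k) <= e * cm k.
Proof.
move=> e0; pose e' := Order.min 1 e / 8.
have e'0 : 0 < e' by rewrite divr_gt0 // lt_min ltr01.
have e'1 : e' <= 1 / 8 by rewrite ler_pM2r // ge_min lexx.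
have e'e : e' <= e / 8 by rewrite ler_pM2r // ge_min lexx orbT.
have [d1 d10 h1] := real_littleo (is_derive_expR 0) e'0.
have [d2 d20 h2] := real_littleo (is_derive_cos 0) e'0.
have [d3 d30 h3] := real_littleo (is_derive_sin 0) e'0.
exists (Order.min (Order.min d1 d2) (Order.min d3 e')).
  by rewrite !lt_min d10 d20 d30.
move=> [x y]; rewrite !lt_min => /andP[/andP[k1 k2] /andP[k3 k4]].
have kx := cmod_Re (x +i* y); have ky := cmod_Im (x +i* y); rewrite /= in kx ky.
have := h1 x (le_lt_trans kx k1); have := h2 y (le_lt_trans ky k2).
have := h3 y (le_lt_trans ky k3).
rewrite expR0 cos0 sin0 ?oppr0 mul0r !subr0 ?addr0 !mul1r.
set k := cm _ in kx ky k1 k2 k3 k4 *.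
set E := expR x; set C := cos y; set S := sin y => hS hC hE.
have k0 : 0 <= k := cmod_ge0 _.
have ek : e' * k <= e' * e' by rewrite ler_wpM2l // ltW.
have hS' : `|S - y| <= e' * k by apply: le_trans hS _; rewrite ler_wpM2l // ltW.
have hC' : `|C - 1| <= e' * k by apply: le_trans hC _; rewrite ler_wpM2l // ltW.
have hE' : `|E - 1 - x| <= e' * k by apply: le_trans hE _; rewrite ler_wpM2l // ltW.
have hE2 : `|E - 1| <= 2 * e'.
  rewrite -[E - 1](subrK x); apply: le_trans (ler_normD _ _) _.
  have : e' * e' <= e' * (1 / 8) by rewrite ler_wpM2l // ltW.
  lra.
have C1 : `|C| <= 1 by rewrite ler_norml cos_geN1 cos_le1.
have S1 : `|S| <= 2 * k.
  rewrite -[S](subrK y); apply: le_trans (ler_normD _ _) _.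
  have : e' * k <= (1 / 8) * k by rewrite ler_wpM2r.
  lra.
apply: le_trans (cmod_le_ReIm _) _.
have -> : complex.Re (cexp (x +i* y) - 1 - (x +i* y)) = (E - 1 - x) + (C - 1) + (E - 1) * (C - 1).
  by rewrite !ReB /cexp ReM /= /E /C; ring.
have -> : complex.Im (cexp (x +i* y) - 1 - (x +i* y)) = (S - y) + (E - 1) * S.
  by rewrite !ImB /cexp ImM /= /E /S; ring.
have b1 : `|(E - 1) * (C - 1)| <= 2 * e' * (e' * k).
  by rewrite normrM ler_pM.
have b2 : `|(E - 1) * S| <= 2 * e' * (2 * k) by rewrite normrM ler_pM.
have t1 := ler_normD ((E - 1 - x) + (C - 1)) ((E - 1) * (C - 1)).
have t2 := ler_normD (E - 1 - x) (C - 1).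
have t3 := ler_normD (S - y) ((E - 1) * S).
have q1 : e' * (e' * k) <= e' * k * (1 / 8).
  by rewrite mulrC ler_wpM2l // mulr_ge0 // ltW.
have q2 : e' * k <= e / 8 * k by rewrite ler_wpM2r.
have q3 : 0 <= e' * k by rewrite mulr_ge0 // ltW.
lra.
Qed.

End ComplexDerivative.

Section SingularInnerDerivative.
Variable R : realType.
Local Notation cm := (@complex_modulus R).
Local Notation Re := complex.Re.
Local Notation Im := complex.Im.
Local Notation T := (@unit_circle R : set (borelC R)).

Definition cmeasurable (G : R[i] -> R[i]) :=
  measurable_fun T (fun w : borelC R => Re (G w)) /\
  measurable_fun T (fun w : borelC R => Im (G w)).

Lemma cmeasurable_cst c : cmeasurable (fun=> c).
Proof. by split; exact: measurable_cst. Qed.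

Lemma cmeasurable_id : cmeasurable id.
Proof.
by split; apply: measurable_funTS; [exact: measurable_ReC|exact: measurable_ImC].
Qed.

Lemma cmeasurableD F G : cmeasurable F -> cmeasurable G ->
  cmeasurable (fun w => F w + G w).
Proof.
move=> [f1 f2] [g1 g2]; split.
  by under eq_fun do rewrite ReD; exact: measurable_funD.
by under eq_fun do rewrite ImD; exact: measurable_funD.
Qed.

Lemma cmeasurableM F G : cmeasurable F -> cmeasurable G ->
  cmeasurable (fun w => F w * G w).
Proof.
move=> [f1 f2] [g1 g2]; split.
  by under eq_fun do rewrite ReM; apply: measurable_funB; exact: measurable_funM.
by under eq_fun do rewrite ImM; apply: measurable_funD; exact: measurable_funM.
Qed.

Lemma cmeasurableN F : cmeasurable F -> cmeasurable (fun w => - F w).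
Proof.
move=> f; have := cmeasurableM (cmeasurable_cst (-1)) f.
by under [in X in _ -> X]eq_fun do rewrite -mulN1r.
Qed.

Lemma cmeasurableV F : cmeasurable F -> cmeasurable (fun w => (F w)^-1).
Proof.
move=> [f1 f2].
have mc : measurable_fun T (fun w : borelC R => ((Re (F w) ^+ 2 + Im (F w) ^+ 2) `^ (-1))).
  apply: (measurableT_comp (measurable_powR (-1))).
  by apply: measurable_funD; exact: measurable_funX.
have E w : Re (F w) ^+ 2 + Im (F w) ^+ 2 >= 0 by rewrite addr_ge0 ?sqr_ge0.
split.
  apply: (eq_measurable_fun (fun w : borelC R =>
      Re (F w) * (Re (F w) ^+ 2 + Im (F w) ^+ 2) `^ (-1))).
    by move=> w _; rewrite powR_inv1 //; case: (F w) => a b.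
  exact: measurable_funM.
apply: (eq_measurable_fun (fun w : borelC R =>
    - Im (F w) * (Re (F w) ^+ 2 + Im (F w) ^+ 2) `^ (-1))).
  by move=> w _; rewrite powR_inv1 //; case: (F w) => a b /=; rewrite mulNr.
by apply: measurable_funM => //; exact: measurable_funN.
Qed.

Variable mu : {finite_measure set (borelC R) -> \bar R}.
Let m := fine (mu T).
Local Notation cint := (cintegral mu (@unit_circle R)).

Definition cbounded (G : R[i] -> R[i]) (M : R) := forall w, cm w = 1 -> cm (G w) <= M.

Lemma integrable_bounded (G : R[i] -> R) (M : R) :
  measurable_fun T (G : borelC R -> R) -> (forall w, cm w = 1 -> `|G w| <= M) ->
  mu.-integrable T (fun w => (G w)%:E).
Proof.
move=> mG GM; apply: measurable_bounded_integrable => //.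
- exact: measurable_unit_circle.
- by rewrite ltey_eq fin_num_measure //; exact: measurable_unit_circle.
exists M; split; first exact: num_real.
by move=> x Mx w Tw /=; apply: le_trans (ltW Mx); exact: GM.
Qed.

Lemma integrable_cmeasurable G M : cmeasurable G -> cbounded G M ->
  mu.-integrable T (fun w : borelC R => (Re (G w))%:E) /\
  mu.-integrable T (fun w : borelC R => (Im (G w))%:E).
Proof.
move=> [g1 g2] GM; split; apply: (integrable_bounded _ (M := M)) => // w w1.
  exact: le_trans (cmod_Re _) (GM w w1).
exact: le_trans (cmod_Im _) (GM w w1).
Qed.

Lemma cintegralB F G M N : cmeasurable F -> cmeasurable G -> cbounded F M ->
  cbounded G N -> cint (fun w => F w - G w) = cint F - cint G.
Proof.
move=> mF mG bF bG.
have [f1 f2] := integrable_cmeasurable mF bF.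
have [g1 g2] := integrable_cmeasurable mG bG.
have mT := @measurable_unit_circle R.
apply/eqP; rewrite eq_complex ReB ImB /=; apply/andP; split; apply/eqP.
  by rewrite -RintegralB //; apply: eq_Rintegral => w _; rewrite ReB.
by rewrite -RintegralB //; apply: eq_Rintegral => w _; rewrite ImB.
Qed.

Lemma cintegralZ c G M : cmeasurable G -> cbounded G M ->
  cint (fun w => c * G w) = c * cint G.
Proof.
move=> mG bG; have [g1 g2] := integrable_cmeasurable mG bG.
have mT := @measurable_unit_circle R.
have zl (a : R) (F : borelC R -> R) : mu.-integrable T (fun w => (F w)%:E) ->
    mu.-integrable T (fun w => (a * F w)%:E) by move=> iF; exact: (integrableZl mT a iF).
apply/eqP; rewrite eq_complex ReM ImM /=; apply/andP; split; apply/eqP.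
  by rewrite -!RintegralZl // -RintegralB ?zl //; apply: eq_Rintegral => w _; rewrite ReM.
by rewrite -!RintegralZl // -RintegralD ?zl //; apply: eq_Rintegral => w _; rewrite ImM.
Qed.

Lemma cmod_cintegral_le G M : cmeasurable G -> cbounded G M ->
  cm (cint G) <= 2 * M * m.
Proof.
move=> mG bG; have [g1 g2] := integrable_cmeasurable mG bG.
have mT := @measurable_unit_circle R.
have fT : (mu T < +oo)%E by rewrite ltey_eq fin_num_measure.
have B (F : borelC R -> R) : mu.-integrable T (fun w => (F w)%:E) ->
    (forall w, cm w = 1 -> `|F w| <= M) -> `|Rintegral mu T F| <= M * m.
  move=> iF FM; apply: le_trans (le_normr_Rintegral mT iF) _.
  rewrite -[leRHS](Rintegral_cst mu mT); apply: le_Rintegral => //.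
  - exact: integrable_norm.
  - by apply: (integrable_bounded _ (M := `|M|)) => //; exact: measurable_cst.
apply: le_trans (cmod_le_ReIm _) _ => /=.
have b1 := B _ g1 (fun w w1 => le_trans (cmod_Re _) (bG w w1)).
have b2 := B _ g2 (fun w w1 => le_trans (cmod_Im _) (bG w w1)).
lra.
Qed.

Definition herglotz_transform z := cint (herglotz z).

Definition herglotz_deriv z := cint (fun w => 2 * w / (w - z) ^+ 2).

Lemma cmeasurable_sub z : cmeasurable (fun w => w - z).
Proof. exact: cmeasurableD cmeasurable_id (cmeasurable_cst _). Qed.

Lemma cmeasurable_herglotz z : cmeasurable (herglotz z).
Proof.
apply: cmeasurableM; last exact: cmeasurableV (cmeasurable_sub z).
exact: cmeasurableD cmeasurable_id (cmeasurable_cst _).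
Qed.

Lemma cmeasurable_herglotz_deriv z : cmeasurable (fun w => 2 * w / (w - z) ^+ 2).
Proof.
apply: cmeasurableM.
  exact: cmeasurableM (cmeasurable_cst _) cmeasurable_id.
apply: cmeasurableV; have := cmeasurable_sub z => H.
by under [X in cmeasurable X]eq_fun do rewrite expr2; exact: cmeasurableM.
Qed.

Lemma inv_sub_le z w (r : R) : 0 < r -> r <= 1 - cm z -> cm w = 1 ->
  cm (w - z)^-1 <= r^-1.
Proof.
move=> r0 rz w1; have h := sub_cmod_ge z w1.
rewrite cmodV lef_pV2 ?posrE //; lra.
Qed.

Lemma cbounded_herglotz z : cm z < 1 -> cbounded (herglotz z) (2 / (1 - cm z)).
Proof.
move=> z1 w w1; have r0 : 0 < 1 - cm z by lra.
rewrite /herglotz cmodM ler_pM ?cmod_ge0 ?inv_sub_le //.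
by apply: le_trans (cmodD _ _) _; lra.
Qed.

Lemma cbounded_herglotz_deriv z : cm z < 1 ->
  cbounded (fun w => 2 * w / (w - z) ^+ 2) (2 / (1 - cm z) ^+ 2).
Proof.
move=> z1 w w1; have r0 : 0 < 1 - cm z by lra.
rewrite cmod_div cmodM w1 cmod_nat mulr1 cmodX ler_wpM2l //.
have h := sub_cmod_ge z w1.
rewrite lef_pV2 ?posrE ?exprn_gt0 //; last by lra.
by rewrite lerXn2r ?nnegrE ?cmod_ge0 ?(ltW r0).
Qed.

(** The second order remainder of [herglotz z w] in [z] is bounded uniformly in
    [w] on the circle, and so can be integrated. *)
Lemma herglotz_transform_taylor z : cm z < 1 -> exists2 C : R, 0 <= C &
  forall h, cm h <= (1 - cm z) / 2 ->
   cm (herglotz_transform (z + h) - herglotz_transform z - h * herglotz_deriv z) <=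
   C * cm h ^+ 2.
Proof.
move=> z1; set r := 1 - cm z; have r0 : 0 < r by rewrite /r; lra.
have m0 : 0 <= m by rewrite fine_ge0.
exists (2 * (4 / r ^+ 3) * m) => [|h hr].
  by rewrite !mulr_ge0 // invr_ge0 exprn_ge0 // ltW.
have zh : r / 2 <= 1 - cm (z + h) by have := cmodD z h; rewrite /r in hr *; lra.
have zh1 : cm (z + h) < 1 by lra.
have mz := cmeasurable_herglotz z; have bz := cbounded_herglotz z1.
have mzh := cmeasurable_herglotz (z + h); have bzh := cbounded_herglotz zh1.
have md := cmeasurable_herglotz_deriv z; have bd := cbounded_herglotz_deriv z1.
rewrite /herglotz_transform /herglotz_deriv -(cintegralZ h md bd).
rewrite -(cintegralB mzh mz bzh bz).
have bz2 : cbounded (fun w => herglotz (z + h) w - herglotz z w)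
    (2 / (1 - cm (z + h)) + 2 / (1 - cm z)).
  move=> w w1; apply: le_trans (cmodB _ _) _.
  by apply: lerD; [exact: bzh|exact: bz].
have bd2 : cbounded (fun w => h * (2 * w / (w - z) ^+ 2)) (cm h * (2 / (1 - cm z) ^+ 2)).
  by move=> w w1; rewrite cmodM ler_wpM2l ?cmod_ge0 // bd.
have mz2 := cmeasurableD mzh (cmeasurableN mz).
have md2 := cmeasurableM (cmeasurable_cst h) md.
rewrite -(cintegralB mz2 md2 bz2 bd2).
apply: le_trans (cmod_cintegral_le (M := 4 / r ^+ 3 * cm h ^+ 2) _ _) _; last by lra.
  exact: cmeasurableD mz2 (cmeasurableN md2).
move=> w w1; have wz := sub_cmod_neq0 w1 z1; have wzh := sub_cmod_neq0 w1 zh1.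
have -> : herglotz (z + h) w - herglotz z w - h * (2 * w / (w - z) ^+ 2) =
    2 * w * ((w - (z + h))^-1 * ((w - z)^-1 * (w - z)^-1)) * h ^+ 2.
  by rewrite /herglotz; field; rewrite wz wzh.
rewrite (cmodM (_ * _) (h ^+ 2)) cmodX ler_wpM2r ?sqr_ge0 // !cmodM w1 cmod_nat mulr1.
have r2 : 0 < r / 2 by lra.
have i1 := inv_sub_le r2 zh w1; have i2 := inv_sub_le r0 (lexx r) w1.
have -> : 4 / r ^+ 3 = 2 * ((r / 2)^-1 * (r^-1 * r^-1)).
  by field; rewrite gt_eqF.
rewrite ler_wpM2l //; apply: ler_pM; rewrite ?cmod_ge0 ?mulr_ge0 ?cmod_ge0 //.
by apply: ler_pM; rewrite ?cmod_ge0.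
Qed.

Lemma herglotz_deriv_lipschitz z : cm z < 1 -> exists2 C : R, 0 <= C &
  forall z', cm (z - z') <= (1 - cm z) / 2 ->
   cm (herglotz_deriv z - herglotz_deriv z') <= C * cm (z - z').
Proof.
move=> z1; set r := 1 - cm z; have r0 : 0 < r by rewrite /r; lra.
have m0 : 0 <= m by rewrite fine_ge0.
exists (2 * (8 * (2 / r) ^+ 4) * m) => [|z' zz'].
  by apply: mulr_ge0 => //; do 2 apply: mulr_ge0 => //; rewrite exprn_ge0 // divr_ge0 // ltW.
have rz' : r / 2 <= 1 - cm z'.
  by have := cmodB_ge z' z; rewrite cmodC /r in zz' *; lra.
have z1' : cm z' < 1 by lra.
have md := cmeasurable_herglotz_deriv z; have bd := cbounded_herglotz_deriv z1.
have md' := cmeasurable_herglotz_deriv z'; have bd' := cbounded_herglotz_deriv z1'.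
rewrite /herglotz_deriv -(cintegralB md md' bd bd').
apply: le_trans (cmod_cintegral_le (M := 8 * (2 / r) ^+ 4 * cm (z - z')) _ _) _; last by lra.
  exact: cmeasurableD md (cmeasurableN md').
move=> w w1; have wz := sub_cmod_neq0 w1 z1; have wz' := sub_cmod_neq0 w1 z1'.
have -> : 2 * w / (w - z) ^+ 2 - 2 * w / (w - z') ^+ 2 =
    2 * w * (w - z + (w - z')) * ((w - z)^-1 * (w - z)^-1 * ((w - z')^-1 * (w - z')^-1))
    * (z - z').
  by field; rewrite wz wz'.
rewrite (cmodM _ (z - z')) ler_wpM2r ?cmod_ge0 //.
rewrite (cmodM (2 * w * _)); apply: ler_pM; rewrite ?cmod_ge0 //.
  rewrite !cmodM w1 cmod_nat mulr1.
  have := cmodD (w - z) (w - z'); have := cmodB w z; have := cmodB w z'; lra.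
have r2 : 0 < r / 2 by lra.
have i1 := inv_sub_le r2 rz' w1; have i2 : cm (w - z)^-1 <= (r / 2)^-1.
  by apply: inv_sub_le => //; rewrite -/r; lra.
have -> : (2 / r) ^+ 4 = (r / 2)^-1 * (r / 2)^-1 * ((r / 2)^-1 * (r / 2)^-1).
  by field; rewrite gt_eqF.
by rewrite !cmodM; apply: ler_pM; rewrite ?mulr_ge0 ?cmod_ge0 //; apply: ler_pM; rewrite ?cmod_ge0.
Qed.

Lemma is_derive_singular_inner (z : R[i]^o) : cm z < 1 ->
  is_derive z 1 (singular_inner mu) (- herglotz_deriv z * singular_inner mu z).
Proof.
move=> z1; apply/is_derive_cmodP => e e0.
have [C C0 CP] := herglotz_transform_taylor z1.
set S := singular_inner mu z; set D := herglotz_deriv z.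
have SE h : singular_inner mu (z + h) =
    S * cexp (- (herglotz_transform (z + h) - herglotz_transform z)).
  by rewrite -cexpD; congr cexp; rewrite opprB addrA addNr add0r.
have s0 : 0 < 1 + cm S by rewrite ltr_wpDr ?cmod_ge0.
have D0 : 0 < 1 + cm D by rewrite ltr_wpDr ?cmod_ge0.
pose e1 := e / 2 / (1 + cm S) / (1 + cm D).
have e10 : 0 < e1 by rewrite !divr_gt0.
have [d d0 dP] := cexp_littleo e10.
have r0 : 0 < (1 - cm z) / 2 by lra.
have C1 : 0 < 1 + C by rewrite ltr_wpDr.
pose q := Order.min 1 (e / 2 / (1 + cm S)) / (1 + C).
have q0 : 0 < q by rewrite divr_gt0 // lt_min ltr01 !divr_gt0.
exists (Order.min ((1 - cm z) / 2) (Order.min (d / (1 + cm D)) q)).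
  by rewrite !lt_min r0 q0 divr_gt0.
move=> h; rewrite !lt_min => /and3P[hr hd hq].
have kC := CP h (ltW hr); rewrite SE.
set k := - _; have {}kC : cm (k + D * h) <= C * cm h ^+ 2.
  by rewrite -cmodN /k opprD opprK (mulrC D).
have h0 := cmod_ge0 h; have S0 := cmod_ge0 S; have DD := cmod_ge0 D.
move: hq; rewrite ltr_pdivlMr // lt_min => /andP[hq1 hq2].
have Ch1 : C * cm h <= 1 by have := mulr_ge0 C0 h0; lra.
have Ch2 : C * cm h <= e / 2 / (1 + cm S) by have := mulr_ge0 C0 h0; lra.
have kh : cm k <= (1 + cm D) * cm h.
  rewrite -[k](addrK (D * h)); apply: le_trans (cmodB _ _) _; rewrite cmodM.
  have : C * cm h * cm h <= 1 * cm h by rewrite ler_wpM2r.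
  rewrite expr2 in kC; lra.
have kd : cm k < d.
  by apply: le_lt_trans kh _; rewrite mulrC -ltr_pdivlMr.
have -> : S * cexp k - S - - D * S * h = S * (cexp k - 1 - k) + S * (k + D * h) by ring.
apply: le_trans (cmodD _ _) _.
rewrite (cmodM S (cexp k - 1 - k)) (cmodM S (k + D * h)).
have b1 : cm S * cm (cexp k - 1 - k) <= e / 2 * cm h.
  apply: le_trans (_ : (1 + cm S) * (e1 * ((1 + cm D) * cm h)) <= _).
    apply: ler_pM; rewrite ?cmod_ge0 //; first by lra.
    by apply: le_trans (dP _ kd) _; rewrite ler_wpM2l // ltW.
  rewrite le_eqVlt; apply/orP; left; apply/eqP; rewrite /e1; field.
  by rewrite !gt_eqF.
have b2 : cm S * cm (k + D * h) <= e / 2 * cm h.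
  apply: le_trans (_ : (1 + cm S) * (e / 2 / (1 + cm S) * cm h) <= _).
    apply: ler_pM; rewrite ?cmod_ge0 //; first by lra.
    by apply: le_trans kC _; rewrite expr2 mulrA ler_wpM2r.
  rewrite le_eqVlt; apply/orP; left; apply/eqP; field.
  by rewrite !gt_eqF.
lra.
Qed.

End SingularInnerDerivative.

(** * Growth of the multiples that tend to one *)

Section CyclicGrowth.
Variable R : realType.
Local Notation cm := (@complex_modulus R).
Local Notation leb := (@lebesgue_measure R).
Variable mu : {finite_measure set (borelC R) -> \bar R}.
Local Notation S := (singular_inner mu).

Definition singular_inner_deriv (z : R[i]^o) : R[i]^o := - herglotz_deriv mu z * S z.

Definition multiple_deriv (P : {poly R[i]}) (z : R[i]^o) : R[i]^o :=
  P.[z] * singular_inner_deriv z + S z * P^`().[z].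

Lemma is_derive_multiple (P : {poly R[i]}) (z : R[i]^o) : cm z < 1 ->
  is_derive z 1 (fun z : R[i]^o => (P.[z] * S z - 1 : R[i]^o)) (multiple_deriv P z).
Proof.
move=> z1; have DS := is_derive_singular_inner mu z1.
have DM := is_deriveM (is_derive_horner P z) DS.
have DB := is_deriveB DM (is_derive_cst (1 : R[i]^o) z (1 : R[i]^o)).
have -> : multiple_deriv P z = (P.[z] : R[i]^o) *: singular_inner_deriv z +
   S z *: (P^`().[z] : R[i]^o) - 0 by rewrite subr0.
exact: DB.
Qed.

Lemma is_derive_continuous (f : R[i]^o -> R[i]^o) (z l : R[i]^o) : is_derive z 1 f l ->
  {for z, continuous f}.
Proof. by case=> D _; apply: differentiable_continuous; exact/derivable1_diffP. Qed.

Lemma continuous_cmodM (f g : R[i]^o -> R[i]^o) (z : R[i]^o) :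
  {for z, continuous f} -> {for z, continuous g} ->
  {for z, continuous (fun x => f x * g x : R[i]^o)}.
Proof.
move=> cf cg; have FF : Filter (nbhs z) by exact: nbhs_filter.
apply: (cvgM (F := nbhs z)); [exact: cf|exact: cg].
Qed.

Lemma continuous_cmodD (f g : R[i]^o -> R[i]^o) (z : R[i]^o) :
  {for z, continuous f} -> {for z, continuous g} ->
  {for z, continuous (fun x => f x + g x : R[i]^o)}.
Proof.
move=> cf cg; have FF : Filter (nbhs z) by exact: nbhs_filter.
apply: (cvgD (F := nbhs z)); [exact: cf|exact: cg].
Qed.

Lemma continuous_cmodN (f : R[i]^o -> R[i]^o) (z : R[i]^o) :
  {for z, continuous f} -> {for z, continuous (fun x => - f x : R[i]^o)}.
Proof.
move=> cf; have FF : Filter (nbhs z) by exact: nbhs_filter.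
apply: (cvgN (F := nbhs z)); exact: cf.
Qed.

Lemma continuous_multiple_deriv (P : {poly R[i]}) (z : R[i]^o) : cm z < 1 ->
  {for z, continuous (multiple_deriv P)}.
Proof.
move=> z1.
have cS : {for z, continuous S}.
  exact: is_derive_continuous (is_derive_singular_inner mu z1).
have cp (Q : {poly R[i]}) : {for z, continuous (fun x : R[i]^o => Q.[x] : R[i]^o)}.
  exact: is_derive_continuous (is_derive_horner Q z).
have cH : {for z, continuous (herglotz_deriv mu : R[i]^o -> R[i]^o)}.
  apply/(@cvg_cmod R _ (nbhs z) (nbhs_filter z)) => e e0.
  have [C C0 CP] := herglotz_deriv_lipschitz mu z1.
  have C1 : 0 < 1 + C by rewrite ltr_wpDr.
  apply/nbhs_cmod; exists (Order.min ((1 - cm z) / 2) (e / (1 + C))).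
    by rewrite lt_min !divr_gt0 // subr_gt0.
  move=> w; rewrite lt_min => /andP[h1]; rewrite ltr_pdivlMr // => h2.
  apply: le_lt_trans (CP _ (ltW h1)) _; have := cmod_ge0 (z - w); lra.
have cd : {for z, continuous singular_inner_deriv}.
  rewrite /singular_inner_deriv.
  exact: (@continuous_cmodM (fun x => - herglotz_deriv mu x) S z (continuous_cmodN cH) cS).
have h1 := @continuous_cmodM _ _ z (cp P) cd.
have h2 := @continuous_cmodM _ _ z cS (cp P^`()).
by have := @continuous_cmodD _ _ z h1 h2; rewrite /multiple_deriv.
Qed.

Lemma weighted_energyE (p : R) (P : {poly R[i]}) :
  weighted_energy (multiple_deriv P) p =
  (\int[leb \x leb]_(w in [set w : R * R | unit_disc (w.1 +i* w.2)])
      ((1 - cm (w.1 +i* w.2)) `^ (p - 1) *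
       cm (derive1 (fun z : R[i]^o => (P.[z] * S z - 1 : R[i]^o)) (w.1 +i* w.2)) `^ p)%:E)%E.
Proof.
apply: eq_integral => q; rewrite inE => q1.
rewrite derive1E; have D := is_derive_multiple P q1.
by rewrite (@derive_val _ _ _ _ _ _ _ D).
Qed.

Variables (p : R) (P : nat -> {poly R[i]}).
Hypotheses (p2 : 2 < p)
  (DP : Dnorm p (fun z => (P n).[z] * S z - 1) @[n --> \oo] --> 0%E).

Let p_gt0 : 0 < p. Proof. exact: lt_trans (ltr0n R 2) p2. Qed.

Let p1_gt1 : 1 < p - 1. Proof. by rewrite ltrBrDr; move: p2; rewrite -[2]/(1 + 1). Qed.

Let p1_gt0 : 0 < p - 1. Proof. exact: lt_trans ltr01 p1_gt1. Qed.

Lemma growth_multiple : exists A B : R, [/\ 0 < A, 0 < B &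
  forall n (l I : R) z, 0 < l -> 0 <= I ->
  (weighted_energy (multiple_deriv (P n)) p <= I%:E)%E -> cm z < 1 ->
  cm (((P n).[z] * S z - 1) - ((P n).[0] * S 0 - 1)) <=
    A * (l `^ (p - 1) * ((1 - cm z) ^- 2 * (((1 - cm z) / 4) `^ (p - 1))^-1)) * I
    + B / l].
Proof.
exists 256, (16 * (1 - (p - 1)^-1)^-1); split.
- by rewrite ltr0n.
- by rewrite mulr_gt0 // invr_gt0 subr_gt0 invf_lt1 ?p1_gt0 ?p1_gt1.
move=> n l I z l0 I0 WI z1.
rewrite !(mulrA 256) (mulrA _ _ (_ `^ _)^-1).
apply: (@growth_bound R (fun z => (P n).[z] * S z - 1) (multiple_deriv (P n))) => //.
  move=> x x1 e e0; have /is_derive_cmodP := is_derive_multiple (P n) x1.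
  by move=> /(_ e e0).
move=> x x1 e e0; have /cvg_cmod/(_ e e0) := @continuous_multiple_deriv (P n) x x1.
by move=> /nbhs_cmod[d d0 dP]; exists d => // w _; exact: dP.
Qed.

Lemma Dnorm_small (eta : R) : 0 < eta -> exists N : nat, forall n, (N <= n)%N ->
  cm ((P n).[0] * S 0 - 1) <= eta /\
  (weighted_energy (multiple_deriv (P n)) p <= (eta `^ p)%:E)%E.
Proof.
move=> eta0; have /fine_cvgP[fin /cvgrPdist_lt/(_ eta eta0) sm] := DP.
have [N _ NP] := filterI fin sm; exists N => n Nn.
have [fn sn] := NP n Nn; rewrite /= sub0r normrN in sn.
have [W WE] : exists W, W = weighted_energy (multiple_deriv (P n)) p by eexists.
have W0 : (0 <= W)%E.
  by rewrite WE; apply: integral_ge0 => q _; rewrite lee_fin mulr_ge0 ?powR_ge0.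
pose c := cm ((P n).[0] * S 0 - 1).
have DE : Dnorm p (fun z => (P n).[z] * S z - 1) = (c%:E + W `^ p^-1)%E.
  by rewrite /Dnorm WE weighted_energyE.
rewrite DE in fn sn.
have D0 : (0 <= c%:E + W `^ p^-1)%E by rewrite adde_ge0 ?poweR_ge0 // lee_fin cmod_ge0.
have {sn} : (c%:E + W `^ p^-1 <= eta%:E)%E.
  rewrite -(fineK fn) lee_fin; apply: ltW; apply: le_lt_trans sn; exact: ler_norm.
move=> sn; split.
  by rewrite -lee_fin; apply: le_trans sn; rewrite leeDl // poweR_ge0.
have p0 := p_gt0.
have {}sn : (W `^ p^-1 <= eta%:E)%E.
  by apply: le_trans sn; rewrite leeDr // lee_fin cmod_ge0.
rewrite -WE; have -> : (W = (W `^ p^-1) `^ p)%E.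
  by rewrite -poweRrM mulVf ?gt_eqF // poweRe1.
rewrite -poweR_EFin; apply: gt0_ler_poweR => //; first exact: ltW.
  by rewrite in_itv /= poweR_ge0 leey.
by rewrite in_itv /= lee_fin (ltW eta0) leey.
Qed.

Lemma powR_inv_le (d : R) (k : nat) : 0 < d <= 1 -> p - 1 <= k%:R ->
  ((d / 4) `^ (p - 1))^-1 <= 4 ^+ k * d ^- k.
Proof.
move=> /andP[d0 d1] pk; have d4 : 0 < d / 4 by lra.
rewrite -[4 ^+ k]invrK -invfM -exprVn -exprMn.
rewrite lef_pV2 ?posrE ?powR_gt0 ?exprn_gt0 ?mulr_gt0 // mulrC.
rewrite -powR_mulrn ?(ltW d4) //; apply: ger_powR => //.
by rewrite d4 /=; lra.
Qed.

(** By [growth_bound] the increment of [P n * S - 1] from the origin is at most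
    a power of [(1 - cm z)^-1] as soon as its norm is at most one. *)
Lemma cyclic_growth : exists (C : R) (k N : nat), 0 <= C /\
  forall n z, (N <= n)%N -> cm z < 1 ->
    cm ((P n).[z] * S z) <= C * (1 - cm z) ^- k.
Proof.
have [A [B [A0 B0 G]]] := growth_multiple.
have [N NP] := Dnorm_small ltr01.
have [k pk] : exists k : nat, p - 1 <= k%:R.
  by exists (Num.bound (p - 1)); apply: ltW; apply: archi_boundP; exact: ltW p1_gt0.
have [K K0 KE] : exists2 K : R, 0 < K & 4 ^+ k = K.
  by exists (4 ^+ k) => //; rewrite exprn_gt0.
have C0 : 0 <= A * K + (B + 2) by apply: addr_ge0; [exact: mulr_ge0 (ltW A0) (ltW K0)|lra].
exists (A * K + (B + 2)), (2 + k)%N, N; split=> // n z Nn z1.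
have [c0 W1] := NP n Nn; rewrite powR1 in W1.
have {G} := G n 1 1 z ltr01 ler01 W1 z1.
have [d dE] : exists d, d = 1 - cm z by eexists.
have d0 : 0 < d by rewrite dE subr_gt0.
have d1 : d <= 1 by have := cmod_ge0 z; rewrite dE; lra.
rewrite -dE powR1 mul1r mulr1 divr1 => G.
have hk : ((d / 4) `^ (p - 1))^-1 <= K * d ^- k.
  by rewrite -KE; apply: powR_inv_le; rewrite ?d0.
have [u [uE u1]] : exists u, u = d ^- (2 + k) /\ 1 <= u.
  by eexists; split; [reflexivity|rewrite invf_ge1 ?exprn_gt0 // exprn_ile1 // ltW].
have G2 : d ^- 2 * ((d / 4) `^ (p - 1))^-1 <= K * u.
  apply: (@le_trans _ _ (d ^- 2 * (K * d ^- k))).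
    by apply: ler_wpM2l hk; rewrite invr_ge0 exprn_ge0 // ltW.
  rewrite uE exprD (invfM (d ^+ 2) (d ^+ k)).
  by move: (d ^+ 2)^-1 (d ^+ k)^-1 => x y; rewrite mulrCA.
rewrite -uE; have {}G := le_trans G (lerD (ler_wpM2l (ltW A0) G2) (lexx B)).
move: ((P n).[z] * S z) ((P n).[0] * S 0) G c0 => a b G c0.
have -> : a = (a - 1 - (b - 1)) + ((b - 1) + 1) by ring.
apply: le_trans (cmodD _ _) _; have := cmodD (b - 1) 1; rewrite cmod1 => t1.
have h1 := ler_wpM2l (ltW B0) u1.
lra.
Qed.

(** At a fixed point [z], [growth_bound] with a large [l] and then a large [n]
    makes the increment of [P n * S - 1] small. *)
Lemma cyclic_lower z : cm z < 1 -> exists N : nat, forall n, (N <= n)%N ->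
  2^-1 <= cm ((P n).[z] * S z).
Proof.
move=> z1; have [A [B [A0 B0 G]]] := growth_multiple.
have [d dE] : exists d, d = 1 - cm z by eexists.
have d0 : 0 < d by rewrite dE subr_gt0.
(* with [l = 8 * B] the second term of the estimate is [1 / 8], and the choice
   of [eta] below makes the first one at most [1 / 8] *)
have l0 : 0 < 8 * B by rewrite mulr_gt0.
have [Q Q0 QE] : exists2 Q, 0 < Q &
    Q = A * ((8 * B) `^ (p - 1) * (d ^- 2 * ((d / 4) `^ (p - 1))^-1)).
  have h1 : 0 < (8 * B) `^ (p - 1) by exact: powR_gt0.
  have h2 : 0 < d ^- 2 by rewrite invr_gt0 exprn_gt0.
  have h3 : 0 < ((d / 4) `^ (p - 1))^-1 by rewrite invr_gt0 powR_gt0 // divr_gt0.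
  by eexists; last reflexivity; exact: mulr_gt0 A0 (mulr_gt0 h1 (mulr_gt0 h2 h3)).
have [eta [eta0 eta8 etaQ]] : exists eta : R, [/\ 0 < eta, eta <= 1 / 8 & Q * eta <= 1 / 8].
  exists (Order.min (1 / 8) (1 / 8 / Q)); split.
  - by rewrite lt_min !divr_gt0.
  - by rewrite ge_min lexx.
  - by rewrite mulrC -ler_pdivlMr // ge_min lexx orbT.
have etap : eta `^ p <= eta.
  rewrite -[leRHS](powRr1 (ltW eta0)); apply: ger_powR; last exact: ltW (lt_trans (ltr1n R 2) p2).
  by rewrite eta0 /=; lra.
have [N NP] := Dnorm_small eta0; exists N => n Nn; have [c0 W1] := NP n Nn.
have := G n (8 * B) (eta `^ p) z l0 (powR_ge0 _ _) W1 z1.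
rewrite -dE -QE; have -> : B / (8 * B) = 1 / 8 by field; rewrite gt_eqF.
have h := ler_wpM2l (ltW Q0) etap.
move: ((P n).[z] * S z) ((P n).[0] * S 0) c0 => a b c0 {}G.
have t := cmodB_ge 1 (1 - a); rewrite subKr cmod1 in t.
have := cmodD (a - 1 - (b - 1)) (b - 1); rewrite subrK (cmodC a 1) => t2.
apply: le_trans t; lra.
Qed.

End CyclicGrowth.

(** * Chords and arcs of the circle *)

Section Chords.
Variable R : realType.
Local Notation cm := (@complex_modulus R).
Implicit Types (s t x : R).

Lemma abs_sin_le x : `|sin x| <= `|x|.
Proof.
wlog x0 : x / 0 <= x => [H|].
  have [/H//|x0] := leP 0 x; have := H (- x).
  by rewrite sinN !normrN; apply; rewrite oppr_ge0 ltW.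
have [|c _] := @MVT_segment R sin cos 0 x x0 (fun y _ => is_derive_sin y).
  by apply: continuous_subspaceT; exact: continuous_sin.
by rewrite sin0 !subr0 => ->; rewrite normrM ler_piMl ?cos_max ?normr_ge0.
Qed.

Lemma half_le_sin x : 0 <= x <= pi / 2 -> x / 2 <= sin x.
Proof.
move=> /andP[x0 xp]; set y := x / 2.
have y0 : 0 <= y by rewrite divr_ge0.
have xE : x = y *+ 2 by rewrite mulr2n -splitr.
have [|c cy] := @MVT_segment R sin cos 0 y y0 (fun y _ => is_derive_sin y).
  by apply: continuous_subspaceT; exact: continuous_sin.
rewrite sin0 !subr0 => sE.
have pi0 := pi_gt0 R; have yp : y <= pi / 2 by rewrite /y; lra.
move: cy; rewrite in_itv /= => /andP[c0 cy].
have cc : cos y <= cos c.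
  have [->//|ync] := eqVneq y c; apply: ltW; rewrite ltr_cos ?in_itv /=; first by rewrite lt_neqAle eq_sym ync.
    by apply/andP; split; lra.
  by apply/andP; split; lra.
have cy0 : 0 <= cos y by apply: cos_ge0_pihalf; lra.
have cx0 : 0 <= cos x by apply: cos_ge0_pihalf; lra.
have ss : y * cos y <= sin y by rewrite sE mulrC ler_wpM2r.
rewrite xE sin_mulr2n; rewrite xE cos_mulr2n in cx0.
have : cos y * (y * cos y) <= cos y * sin y by rewrite ler_wpM2l.
have : 1 <= cos y ^+ 2 *+ 2 by rewrite -subr_ge0.
rewrite !mulr2n expr2; nra.
Qed.

Lemma cmod_chord s t : cm (expi s - expi t) = 2 * `|sin ((s - t) / 2)|.
Proof.
apply/eqP; rewrite -(eqrXn2 (n := 2)) ?cmod_ge0 ?mulr_ge0 //.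
rewrite cmod_sq ReB ImB /= exprMn real_normK ?num_real // sin2cos2.
have : cos (s - t) = cos ((s - t) / 2) ^+ 2 *+ 2 - 1.
  by rewrite -cos_mulr2n mulr2n -splitr.
rewrite cosB mulr2n => H; have := cos2Dsin2 s; have := cos2Dsin2 t => h1 h2.
apply/eqP; move: h1 h2 H; rewrite !expr2; lra.
Qed.

Lemma chord_le s t : cm (expi s - expi t) <= `|s - t|.
Proof.
rewrite cmod_chord; have := abs_sin_le ((s - t) / 2); rewrite normrM (@ger0_norm _ 2^-1) //.
lra.
Qed.

Lemma chord_ge m s t : 0 <= m -> m <= s - t -> s - t <= 2 * pi - m ->
  m / 2 <= cm (expi s - expi t).
Proof.
move=> m0 h1 h2; have pi0 := pi_gt0 R.
rewrite cmod_chord; set y := (s - t) / 2.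
have sy : sin (m / 2) <= sin y.
  have [yp|yp] := leP y (pi / 2).
    have [<-//|ne] := eqVneq (m / 2) y; apply: ltW.
    rewrite ltr_sin ?in_itv /=; first by rewrite lt_neqAle ne /y; lra.
      by apply/andP; split; lra.
    by apply/andP; split; rewrite /y in yp *; lra.
  have -> : sin y = sin (pi - y) by rewrite sinB sinpi cospi; ring.
  have [<-//|ne] := eqVneq (m / 2) (pi - y); apply: ltW.
  rewrite ltr_sin ?in_itv /=; first by rewrite lt_neqAle ne /y; lra.
    by apply/andP; split; lra.
  by apply/andP; split; rewrite /y in yp *; lra.
have := @half_le_sin (m / 2); have := ler_norm (sin y).
move=> h3 h4; have {}h4 : m / 2 / 2 <= sin (m / 2) by apply: h4; apply/andP; split; lra.
lra.
Qed.

Lemma expi_2pi : expi (2 * pi) = 1 :> R[i].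
Proof. by rewrite /expi mulrC mulr_natr cos2pi sin2pi. Qed.

Lemma expi_param0 (w : R[i]) : cm w = 1 -> exists2 t : R, 0 <= t < 2 * pi & w = expi t.
Proof.
case: w => x y w1; have pi0 := pi_gt0 R.
have xy : x ^+ 2 + y ^+ 2 = 1 by have := cmod_sq (x +i* y); rewrite w1 expr1n /= => <-.
have x1 : -1 <= x <= 1.
  by rewrite -ler_norml -(expr_le1 (n := 2)) // real_normK ?num_real //; have := sqr_ge0 y; lra.
have t0 := acos_ge0 x1; have tp := acos_lepi x1.
have sE : sin (acos x) = `|y|.
  by rewrite sin_acos // -sqrtr_sqr; congr Num.sqrt; lra.
have cE : cos (acos x) = x by rewrite acosK // in_itv.
have [y0|y0] := leP 0 y.
  exists (acos x); first by rewrite t0 /=; lra.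
  by rewrite /expi cE sE ger0_norm.
have tn : acos x != 0.
  by apply/eqP => h; move: sE; rewrite h sin0 => /esym/normr0_eq0; lra.
exists (2 * pi - acos x).
  by apply/andP; split; [lra|rewrite ltrBlDr ltrDl lt_def tn].
have p2 : 2 * pi = pi *+ 2 :> R by rewrite mulr2n; ring.
rewrite /expi cosB sinB p2 cos2pi sin2pi cE sE ltr0_norm //.
by congr (_ +i* _); ring.
Qed.

Lemma expi_param (a : R) (w : R[i]) : cm w = 1 -> exists2 t : R, a <= t < a + 2 * pi & w = expi t.
Proof.
move=> w1; have [|t t2 wt] := @expi_param0 (w * expi (- a)).
  by rewrite cmodM w1 cmod_expi mulr1.
exists (t + a); first by move: t2 => /andP[]; lra.
by rewrite expiD -wt -mulrA -expiD addNr expi0 mulr1.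
Qed.

Lemma expi_inj s t : `|s - t| < 2 * pi -> expi s = expi t -> s = t.
Proof.
wlog st : s t / t <= s => [H|].
  have [/H//|/ltW/H h] := leP t s; rewrite distrC => h1 h2.
  by rewrite (h h1 (esym h2)).
rewrite ger0_norm ?subr_ge0 // => h1 h2; apply/eqP; rewrite eq_le st andbT.
rewrite leNgt; apply/negP => ts.
have m0 : 0 < Order.min (s - t) (2 * pi - (s - t)) by rewrite lt_min !subr_gt0 ts.
have := @chord_ge (Order.min (s - t) (2 * pi - (s - t))) s t (ltW m0).
rewrite h2 subrr cmod0 ge_min lexx => /(_ isT).
have -> : s - t <= 2 * pi - Order.min (s - t) (2 * pi - (s - t)).
  by rewrite lerBrDr addrC -lerBrDr ge_min lexx orbT.
move=> /(_ isT); lra.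
Qed.

End Chords.

(** * Integrals of logarithms *)

Section LogIntegral.
Variable R : realType.
Local Notation leb := (@lebesgue_measure R).

(** An antiderivative of [k - ln x]. *)
Let F (k x : R) := x * (k - ln x + 1).

Lemma integral_ln_segment (k e l : R) : 0 < e -> e < l -> ln l <= k ->
  (\int[leb]_(x in `[e, l]) (k - ln x)%:E <= (l * (k - ln l + 1))%:E)%E.
Proof.
move=> e0 el lk.
have pos x : x \in `[e, l] -> 0 < x.
  by rewrite in_itv /= => /andP[/(lt_le_trans e0)].
have dF x : x \in `[e, l] -> is_derive x 1 (F k) (k - ln x).
  move=> /pos x0; have D := is_derive1_ln x0.
  have D1 : is_derive x 1 (fun x => k - ln x + 1) (0 - x^-1 + 0) by exact: is_deriveD.
  have D2 : is_derive x 1 (F k) (x *: (0 - x^-1 + 0) + (k - ln x + 1) *: 1).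
    exact: is_deriveM.
  apply: trigger_derive D2 _; rewrite -![_ *: _]/(_ * _).
  by field; rewrite gt_eqF.
have cF x : x \in `[e, l] -> {for x, continuous (F k)}.
  move=> /dF [D _]; apply: differentiable_continuous; exact/derivable1_diffP.
have cG : {within `[e, l], continuous (fun x : R => k - ln x)}.
  apply: continuous_in_subspaceT => x; rewrite inE => /pos x0.
  by apply: cvgB; [exact: cvg_cst|exact: continuous_ln].
have ee : e \in `[e, l] by rewrite in_itv /= lexx ltW.
have ell : l \in `[e, l] by rewrite in_itv /= lexx ltW.
rewrite (continuous_FTC2 el cG (F := F k)); last 2 first.
- split.
  + by move=> s se; have [] := dF s (subset_itv_oo_cc se).
  + exact: cvg_at_right_filter (cF _ ee).
  + exact: cvg_at_left_filter (cF _ ell).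
- move=> s se; have := dF s (subset_itv_oo_cc se).
  by move=> D; rewrite derive1E derive_val.
rewrite -EFinB lee_fin /F gerBl mulr_ge0 ?(ltW e0) //.
have : ln e <= ln l.
  by rewrite ler_ln ?posrE //; [exact: ltW|exact: lt_trans el].
lra.
Qed.

Lemma integral_ln_le (k l : R) : 0 < l -> ln l <= k ->
  (\int[leb]_(x in `]0%R, l[) (k - ln x)%:E <= (l * (k - ln l + 1))%:E)%E.
Proof.
move=> l0 lk.
pose A n := `[l / (n.+2)%:R, l]%classic : set R.
have ln_le x : 0 < x -> x <= l -> 0 <= k - ln x.
  move=> x0 xl; have : ln x <= ln l by rewrite ler_ln ?posrE.
  lra.
have AE : \bigcup_n A n = `]0, l]%classic.
  apply/seteqP; split => [x [n _]|x]; rewrite /A /= !in_itv /=.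
    by move=> /andP[h ->]; rewrite andbT; apply: lt_le_trans h; rewrite divr_gt0.
  move=> /andP[x0 xl]; exists (Num.bound (l / x)) => //; rewrite /= in_itv /= xl andbT.
  rewrite ler_pdivrMr // mulrC -ler_pdivrMr //.
  have := archi_boundP (divr_ge0 (ltW l0) (ltW x0)).
  by move=> /ltW /le_trans; apply; rewrite ler_nat -addn2 leq_addr.
have mf n : measurable_fun (A n) (fun x : R => (k - ln x)%:E).
  apply/measurable_EFinP; apply: measurable_funB => //.
  exact: measurable_funTS (@measurable_ln R).
have f0 n x : A n x -> (0 <= (k - ln x)%:E)%E.
  move=> Anx; have : (\bigcup_n A n) x by exists n.
  by rewrite AE /= in_itv /= => /andP[x0 xl]; rewrite lee_fin ln_le.
have ndA : {homo A : n m / (n <= m)%N >-> (n <= m)%O}.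
  move=> n m nm; apply/subsetPset => x; rewrite /A /= !in_itv /= => /andP[h ->].
  rewrite andbT; apply: le_trans h; rewrite ler_pM2l // lef_pV2 ?posrE //.
  by rewrite ler_nat.
have mA n : measurable (A n) by exact: measurable_itv.
have cv : (\int[leb]_(x in A i) (k - ln x)%:E)%E @[i --> \oo] -->
    (\int[leb]_(x in \bigcup_i A i) (k - ln x)%:E)%E.
  by apply: ge0_nondecreasing_set_cvg_integral.
apply: (@le_trans _ _ (\int[leb]_(x in \bigcup_n A n) (k - ln x)%:E)%E).
  apply: ge0_subset_integral => //.
  - by rewrite AE; exact: measurable_itv.
  - apply/measurable_EFinP; apply: measurable_funB => //.
    exact: (measurable_funTS (@measurable_ln R)).
  - by move=> x [n _]; exact: f0.
  by rewrite AE => x /=; rewrite !in_itv /= => /andP[-> /ltW].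
rewrite -(cvg_lim _ cv) //; apply: lime_le; first by apply/cvg_ex; eexists; exact: cv.
apply: nearW => n; apply: integral_ln_segment => //.
  by rewrite divr_gt0.
by rewrite ltr_pdivrMr // ltr_pMr // ltr1n.
Qed.

Lemma measurable_ln_shift (k c a : R) : measurable_fun setT (fun s : R => (k - ln (c + a * s))%:E).
Proof.
apply/measurable_EFinP; apply: measurable_funB => //.
exact: (measurableT_comp (@measurable_ln R) (measurable_affine c a)).
Qed.

Lemma integral_ln_affine_le (k c a al be : R) : `|a| = 1 -> al < be ->
  ln (be - al) <= k ->
  (forall s : R, al < s < be -> 0 < c + a * s < be - al) ->
  (\int[leb]_(s in `]al, be[) (k - ln (c + a * s))%:E <=
   ((be - al) * (k - ln (be - al) + 1))%:E)%E.
Proof.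
move=> a1 ab lk sD; set l := be - al; have l0 : 0 < l by rewrite subr_gt0.
pose g := (fun x : R => (k - ln x)%:E) \_ `]0, l[.
have g0 x : (0 <= g x)%E.
  rewrite /g /patch; case: ifPn => // ; rewrite inE /= in_itv /= => /andP[x0 xl].
  rewrite lee_fin; have : ln x <= ln l by rewrite ler_ln ?posrE // ltW.
  lra.
have mg : measurable_fun setT g.
  apply/(measurable_restrictT _ _).1 => //.
  apply/measurable_EFinP; apply: measurable_funB => //.
  exact: measurable_funTS (@measurable_ln R).
have a0 : a != 0 by rewrite -normr_eq0 a1 oner_eq0.
have := ge0_integral_affine c a0 mg g0; rewrite a1 mul1e => E.
apply: le_trans (integral_ln_le l0 lk).
rewrite [leRHS]integral_mkcond -/g -E integral_mkcond.
apply: ge0_le_integral => //.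
- move=> s _; rewrite /patch; case: ifPn => //; rewrite inE /= in_itv /= => /sD /andP[h1 h2].
  rewrite lee_fin; have : ln (c + a * s) <= ln l by rewrite ler_ln ?posrE // ltW.
  lra.
- apply/(measurable_restrictT _ _).1 => //; apply: measurable_funTS.
  exact: measurable_ln_shift.
- exact: (measurableT_comp mg (measurable_affine c a)).
move=> s _; rewrite /patch; case: ifPn => [|_]; last exact: g0.
by rewrite inE /= in_itv /= => /sD h; rewrite /g /patch mem_set.
Qed.

(** The form in which the logarithm of the distance to the end points of an arc
    enters; up to a constant, the bound is the term [l * ln l^-1] of the
    series defining Beurling-Carleson sets, plus the length [l]. *)
Lemma integral_arc_le (k al be : R) : al < be -> ln (be - al) <= k ->
  (\int[leb]_(s in `]al, be[) ((k - ln (s - al)) + (k - ln (be - s)))%:E <=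
   (2 * ((be - al) * (k - ln (be - al) + 1)))%:E)%E.
Proof.
move=> ab lk.
have h1 : (\int[leb]_(s in `]al, be[) (k - ln (- al + 1 * s))%:E <=
   ((be - al) * (k - ln (be - al) + 1))%:E)%E.
  by apply: integral_ln_affine_le; rewrite ?normr1 // => s /andP[h1 h2]; apply/andP; split; lra.
have h2 : (\int[leb]_(s in `]al, be[) (k - ln (be + (-1) * s))%:E <=
   ((be - al) * (k - ln (be - al) + 1))%:E)%E.
  by apply: integral_ln_affine_le; rewrite ?normrN1 // => s /andP[h1' h2]; apply/andP; split; lra.
have -> : 2 * ((be - al) * (k - ln (be - al) + 1)) =
  (be - al) * (k - ln (be - al) + 1) + (be - al) * (k - ln (be - al) + 1) by ring.
rewrite EFinD; apply: le_trans (leeD h1 h2); rewrite -ge0_integralD //; last 4 first.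
- move=> s; rewrite /= in_itv /= => /andP[s1 s2]; rewrite lee_fin mul1r.
  have : ln (- al + s) <= ln (be - al) by rewrite ler_ln ?posrE; lra.
  lra.
- by apply: measurable_funTS; exact: measurable_ln_shift.
- move=> s; rewrite /= in_itv /= => /andP[s1 s2]; rewrite lee_fin mulN1r.
  have : ln (be - s) <= ln (be - al) by rewrite ler_ln ?posrE; lra.
  lra.
- by apply: measurable_funTS; exact: measurable_ln_shift.
rewrite le_eqVlt; apply/orP; left; apply/eqP; apply: eq_integral => s _.
by rewrite -EFinD mul1r mulN1r (addrC (- al)).
Qed.

End LogIntegral.

(** * The logarithm of the distance to a closed subset of the circle *)

Section LogDistance.
Variable R : realType.
Local Notation cm := (@complex_modulus R).
Local Notation leb := (@lebesgue_measure R).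
Variable E : set R[i].
Hypotheses (E0 : E !=set0) (Ecl : @closed R[i]^o E) (ET : E `<=` @unit_circle R).

Definition circle_dist (z : R[i]) : R := inf [set cm (z - w) | w in E].

(** As the distances are at most the diameter [2], this is nonnegative; on [E],
    where [0^-1 = 0] and [ln 0 = 0], the value is [0] instead of infinity. *)
Definition log_dist (t : R) : R := ln (2 / circle_dist (expi t)).

Lemma circle_dist_le z w : E w -> circle_dist z <= cm (z - w).
Proof.
move=> Ew; apply: ge_inf; last by exists w.
by exists 0 => _ [u _ <-]; exact: cmod_ge0.
Qed.

Lemma circle_dist_ge z c : (forall w, E w -> c <= cm (z - w)) -> c <= circle_dist z.
Proof.
move=> H; apply: lb_le_inf; first by case: E0 => w Ew; exists (cm (z - w)), w.
by move=> _ [w Ew <-]; exact: H.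
Qed.

Lemma circle_dist_lipschitz z z' : `|circle_dist z - circle_dist z'| <= cm (z - z').
Proof.
wlog H : z z' / circle_dist z' <= circle_dist z => [G|].
  have [/G//|/ltW/G h] := leP (circle_dist z') (circle_dist z).
  by rewrite distrC cmodC.
rewrite ger0_norm ?subr_ge0 //.
suff : circle_dist z - cm (z - z') <= circle_dist z' by lra.
apply: circle_dist_ge => w Ew.
have := circle_dist_le z Ew; have := cmod_tri z' z w; lra.
Qed.

Lemma circle_dist_gt0 z : ~ E z -> 0 < circle_dist z.
Proof.
move=> nEz; have /open_cmodP/(_ z nEz)[e e0 eE] : open (~` E : set R[i]^o).
  exact: closed_openC.
apply: lt_le_trans e0 _; apply: circle_dist_ge => w Ew.
by rewrite leNgt; apply/negP => /eE.
Qed.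

Lemma circle_dist0 z : E z -> circle_dist z = 0.
Proof.
move=> Ez; apply/eqP; rewrite eq_le; apply/andP; split.
  by apply: le_trans (circle_dist_le z Ez) _; rewrite subrr cmod0.
by apply: circle_dist_ge => w _; exact: cmod_ge0.
Qed.

Lemma circle_dist_ge0 z : 0 <= circle_dist z.
Proof. by apply: circle_dist_ge => w _; exact: cmod_ge0. Qed.

Lemma circle_dist_le2 t : circle_dist (expi t) <= 2.
Proof.
case: E0 => w Ew; apply: le_trans (circle_dist_le _ Ew) _.
apply: le_trans (cmodB _ _) _; rewrite cmod_expi (ET Ew); lra.
Qed.

Lemma log_dist_ge0 t : 0 <= log_dist t.
Proof.
rewrite /log_dist; have := circle_dist_ge0 (expi t); rewrite le_eqVlt => /orP[/eqP <-|d0].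
  by rewrite invr0 mulr0 ln0.
by apply: ln_ge0; rewrite ler_pdivlMr // mul1r circle_dist_le2.
Qed.

Lemma log_dist0 t : E (expi t) -> log_dist t = 0.
Proof. by move=> /circle_dist0 h; rewrite /log_dist h invr0 mulr0 ln0. Qed.

Lemma log_dist_ge t w (s : R) : ~ E (expi t) -> E w -> cm (expi t - w) <= s ->
  ln (2 / s) <= log_dist t.
Proof.
move=> nE Ew h; have d0 := circle_dist_gt0 nE.
have ds := le_trans (circle_dist_le (expi t) Ew) h.
have s0 := lt_le_trans d0 ds.
by rewrite /log_dist ler_ln ?posrE ?divr_gt0 // ler_pM2l // lef_pV2 ?posrE.
Qed.

Lemma measurable_circle_dist : measurable_fun setT (fun t => circle_dist (expi t)).
Proof.
apply: continuous_measurable_fun => t; apply/cvgrPdist_lt => e e0.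
near=> s; apply: le_lt_trans (circle_dist_lipschitz _ _) _.
apply: le_lt_trans (chord_le _ _) _.
by near: s; apply: (cvgrPdist_lt _ _).1 => //; exact: cvg_id.
Unshelve. all: by end_near. Qed.

Lemma measurable_log_dist : measurable_fun setT log_dist.
Proof.
apply: (measurableT_comp (@measurable_ln R)).
apply: (eq_measurable_fun (fun t => 2 * (circle_dist (expi t)) `^ (-1))).
  by move=> t _; rewrite powR_inv1 // circle_dist_ge0.
apply: measurable_funM => //; apply: (measurableT_comp (measurable_powR (-1))).
exact: measurable_circle_dist.
Qed.

(** No point of [E] is closer to a point of a complementary arc than the
    nearest end point, and chords are comparable to arcs. *)
Lemma log_dist_arc_le (al be t : R) : al < be -> be <= al + 2 * pi ->
  (forall s, al < s < be -> ~ E (expi s)) -> al < t < be ->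
  log_dist t <= (ln 8 - ln (t - al)) + (ln 8 - ln (be - t)).
Proof.
move=> ab bp arcE /andP[t1 t2].
have pi4 : pi < 4 :> R by have := pihalf_lt2 R; lra.
pose m := Order.min (t - al) (be - t).
have m0 : 0 < m by rewrite lt_min !subr_gt0 t1.
have m1 : m <= t - al by rewrite ge_min lexx.
have m2 : m <= be - t by rewrite ge_min lexx orbT.
have dm : m / 2 <= circle_dist (expi t).
  apply: circle_dist_ge => w Ew; have [s /andP[s1 s2] wE] := expi_param al (ET Ew).
  have [sb|sb] := leP be s.
    rewrite cmodC wE; apply: chord_ge; lra.
  have sa : s = al.
    apply/eqP; rewrite eq_le s1 andbT leNgt; apply/negP => als.
    by apply: (arcE s) => //; [rewrite als|rewrite -wE].
  rewrite wE sa; apply: chord_ge; lra.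
have ln8 (x : R) : 0 < x -> x <= 8 -> 0 <= ln 8 - ln x.
  by move=> x0 x8; rewrite subr_ge0 ler_ln ?posrE.
have a0 := @ln8 (t - al); have b0 := @ln8 (be - t).
have lm : log_dist t <= ln 8 - ln m.
  rewrite -ln_div ?posrE // /log_dist ler_ln ?posrE ?divr_gt0 //; last first.
    by apply: lt_le_trans dm; rewrite divr_gt0.
  rewrite ler_pdivrMr; last by apply: lt_le_trans dm; rewrite divr_gt0.
  rewrite mulrAC ler_pdivlMr //; lra.
apply: le_trans lm _.
have [h|h] : m = t - al \/ m = be - t by rewrite /m; case: leP; [left|right].
  by rewrite h lerDl; apply: b0; lra.
by rewrite h lerDr; apply: a0; lra.
Qed.

Definition arc_angles (a b : R) : set R :=
  [set t | 0 <= t < 2 * pi /\ circle_arc a b (expi t)].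

(** An arc that contains the point [1] corresponds to two intervals of angles
    between [0] and [2 * pi]; the second interval of the union accounts for the
    part of the first one beyond [2 * pi]. *)
Lemma arc_angles_shift (a b : R) : a < b -> b <= a + 2 * pi ->
  exists al be : R, [/\ 0 <= al < 2 * pi, be - al = b - a,
   (forall s, al < s < be -> circle_arc a b (expi s)) &
   arc_angles a b = (`]al, be[ `|` `]al - 2 * pi, be - 2 * pi[) `&` `[0, 2 * pi[].
Proof.
move=> ab bp; have pi0 := pi_gt0 R.
have [al al2 aE] := expi_param0 (cmod_expi a).
have c1 (s : R) : expi (s + (al - a)) = expi s.
  by rewrite expiD -[expi (al - a)](mulfK (x := expi a)) -?expiD ?subrK -?aE ?divff ?mulr1 //;
    rewrite -cmod_gt0 cmod_expi.
have c2 (s : R) : expi (s - 2 * pi) = expi s.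
  by have := @expiD R (s - 2 * pi) (2 * pi); rewrite subrK expi_2pi mulr1 => ->.
have arc s : al < s < b + (al - a) -> circle_arc a b (expi s).
  move=> /andP[s1 s2]; exists (s - (al - a)); last by rewrite -c1 subrK.
  by rewrite /= in_itv /=; apply/andP; split; lra.
exists al, (b + (al - a)); split => //; first by ring.
move: al2 => /andP[al0 alp]; apply/seteqP; split => t.
  move=> [/andP[t0 t2]] [s]; rewrite /= in_itv /= => /andP[s1 s2] st.
  rewrite !in_itv /= t0 t2; split => //.
  have st' : expi (s + (al - a)) = expi t by rewrite c1.
  have [h|h] := ltP (s + (al - a)) (2 * pi).
    left; have <- : s + (al - a) = t.
      by apply: expi_inj => //; rewrite ltr_norml; apply/andP; split; lra.
    by apply/andP; split; lra.
  right; have <- : s + (al - a) - 2 * pi = t.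
    apply: expi_inj; last by rewrite c2.
    by rewrite ltr_norml; apply/andP; split; lra.
  by apply/andP; split; lra.
rewrite /= !in_itv /= => -[H t2]; split => //.
case: H => [/arc //|/andP[h1 h2]].
by rewrite -(addrK (2 * pi) t) c2; apply: arc; apply/andP; split; lra.
Qed.

End LogDistance.

Section LogDistanceIntegrable.
Variable R : realType.
Local Notation cm := (@complex_modulus R).
Local Notation leb := (@lebesgue_measure R).
Variable E : set R[i].
Hypotheses (E0 : E !=set0) (Ecl : @closed R[i]^o E) (ET : E `<=` @unit_circle R).
Local Notation psi := (log_dist E).

Lemma measurable_arc_angles (a b : R) : a < b -> b <= a + 2 * pi ->
  measurable (arc_angles a b).
Proof.
move=> ab bp; have [al [be [_ _ _ ->]]] := arc_angles_shift ab bp.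
by apply: measurableI; [apply: measurableU|]; exact: measurable_itv.
Qed.

(** The bound by one half of the length is enough: it serves to sum the terms
    of [integral_log_dist_arc_le] that are proportional to the length. *)
Lemma arc_angles_measure_ge (a b : R) : a < b -> b <= a + 2 * pi ->
  (((b - a) / 2)%:E <= leb (arc_angles a b))%E.
Proof.
move=> ab bp; have mA := measurable_arc_angles ab bp.
have [al [be [/andP[al0 alp] bal _ AE]]] := arc_angles_shift ab bp.
have sub (x y : R) : x < y -> (b - a) / 2 <= y - x -> `]x, y[ `<=` arc_angles a b ->
    (((b - a) / 2)%:E <= leb (arc_angles a b))%E.
  move=> xy h s; apply: (@le_trans _ _ (leb `]x, y[%classic)).
    by rewrite lebesgue_measure_itv /= lte_fin xy -EFinB lee_fin.
  by apply: le_measure; rewrite ?inE //; exact: measurable_itv.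
have [h|h] := leP be (2 * pi).
  apply: (sub al be); [lra|lra|rewrite AE => t; rewrite /= !in_itv /= => /andP[t1 t2]].
  by split; [left; rewrite t1|apply/andP; split; lra].
have [h2|h2] := leP ((b - a) / 2) (2 * pi - al).
  apply: (sub al (2 * pi)); [lra|lra|rewrite AE => t; rewrite /= !in_itv /= => /andP[t1 t2]].
  by split; [left; rewrite t1 /=; lra|apply/andP; split; lra].
apply: (sub 0 (be - 2 * pi)); [lra|lra|rewrite AE => t; rewrite /= !in_itv /= => /andP[t1 t2]].
by split; [right|]; apply/andP; split; lra.
Qed.

Lemma integral_log_dist_arc_le (a b : R) : a < b -> b <= a + 2 * pi ->
  (forall w, E w -> ~ circle_arc a b w) ->
  (\int[leb]_(t in arc_angles a b) (psi t)%:E <=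
   (4 * ((b - a) * (ln 8 - ln (b - a) + 1)))%:E)%E.
Proof.
move=> ab bp Earc; have mA := measurable_arc_angles ab bp.
have [al [be [/andP[al0 alp] bal arc AE]]] := arc_angles_shift ab bp.
have pi4 : pi < 4 :> R by have := pihalf_lt2 R; lra.
have psi0 t : (0 <= (psi t)%:E)%E by rewrite lee_fin log_dist_ge0.
have mpsi (D : set R) : measurable_fun D (fun t => (psi t)%:E).
  by apply/measurable_EFinP; apply: measurable_funTS; exact: measurable_log_dist.
have shiftE s : expi (s - 2 * pi) = expi s :> R[i].
  by have := @expiD R (s - 2 * pi) (2 * pi); rewrite subrK expi_2pi mulr1 => ->.
have l8 : ln (b - a) <= ln 8 by rewrite ler_ln ?posrE //; lra.
have B (x y : R) : y - x = b - a -> (forall s, x < s < y -> circle_arc a b (expi s)) ->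
    (\int[leb]_(t in `]x, y[) (psi t)%:E <= (2 * ((b - a) * (ln 8 - ln (b - a) + 1)))%:E)%E.
  move=> yx arcxy; have xy : x < y by lra.
  have := @integral_arc_le R (ln 8) x y xy; rewrite yx => /(_ l8); apply: le_trans.
  have le8 s : x < s < y -> 0 <= ln 8 - ln (s - x) /\ 0 <= ln 8 - ln (y - s).
    by move=> /andP[s1 s2]; rewrite !subr_ge0; split; rewrite ler_ln ?posrE //; lra.
  apply: ge0_le_integral => //; first exact: mpsi.
    apply/measurable_EFinP; apply: measurable_funD; apply: measurable_funB => //;
      apply: (measurableT_comp (@measurable_ln R)); exact: measurable_funB.
  move=> s; rewrite /= in_itv /= => s12; rewrite lee_fin.
  apply: log_dist_arc_le => //; first by lra.
  by move=> u u12 Eu; exact: Earc Eu (arcxy u u12).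
have B1 := B al be bal arc.
have B2 : (\int[leb]_(t in `](al - 2 * pi)%R, (be - 2 * pi)%R[) (psi t)%:E <=
    (2 * ((b - a) * (ln 8 - ln (b - a) + 1)))%:E)%E.
  apply: B => [|s /andP[s1 s2]]; first by lra.
  by rewrite -(addrK (2 * pi) s) shiftE; apply: arc; apply/andP; split; lra.
have -> : 4 * ((b - a) * (ln 8 - ln (b - a) + 1)) =
   2 * ((b - a) * (ln 8 - ln (b - a) + 1)) + 2 * ((b - a) * (ln 8 - ln (b - a) + 1)) by ring.
rewrite EFinD; apply: le_trans (leeD B1 B2).
apply: (@le_trans _ _ (\int[leb]_(t in `]al, be[ `|` `](al - 2 * pi)%R, (be - 2 * pi)%R[) (psi t)%:E)%E).
  apply: ge0_subset_integral => //.
  - by apply: measurableU; exact: measurable_itv.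
  - exact: mpsi.
  - by rewrite AE => t [].
rewrite ge0_integral_setU //; first exact: mpsi.
apply/disj_setPS => t [/=]; rewrite !in_itv /= => /andP[t1 t2] /andP[t3 t4].
lra.
Qed.

(** The integrals over the complementary arcs are bounded by
    [integral_log_dist_arc_le]; the series of the entropies converges by
    hypothesis, and the lengths of disjoint arcs have a finite sum. *)
Lemma integrable_log_dist (N : set nat) (a b : nat -> R) :
  (forall n, N n -> a n < b n <= a n + 2 * pi) ->
  trivIset N (fun n => circle_arc (a n) (b n)) ->
  @unit_circle R `\` E = \bigcup_(n in N) circle_arc (a n) (b n) ->
  summable N (fun n => ((b n - a n) * ln (b n - a n)^-1)%:E) ->
  leb.-integrable `[0, 2 * pi[ (fun t => (psi t)%:E).
Proof.
move=> abN tN UE sN; have pi0 := pi_gt0 R.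
have psi0 t : (0 <= (psi t)%:E)%E by rewrite lee_fin log_dist_ge0.
have mpsi (D : set R) : measurable_fun D (fun t => (psi t)%:E).
  by apply/measurable_EFinP; apply: measurable_funTS; exact: measurable_log_dist.
apply/integrableP; split; first exact: mpsi.
under eq_integral do rewrite gee0_abs //.
pose A n := if n \in N then arc_angles (a n) (b n) else set0.
have mA n : measurable (A n).
  rewrite /A; case: ifPn => // /set_mem /abN /andP[h1 h2].
  exact: measurable_arc_angles.
have tA : trivIset setT A.
  apply/trivIsetP => i j _ _ ij; apply/seteqP; split => // t [].
  rewrite /A; case: ifPn => // /set_mem Ni [_ ti]; case: ifPn => // /set_mem Nj [_ tj].
  have /eqP : i = j by apply: tN => //; exists (expi t).
  by rewrite (negbTE ij).
have AI : \bigcup_n A n `<=` `[0, 2 * pi[%classic.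
  by move=> t [n _]; rewrite /A; case: ifPn => // _ [] /=; rewrite in_itv.
have -> : (\int[leb]_(t in `[0%R, (2 * pi)%R[) (psi t)%:E =
    \int[leb]_(t in \bigcup_n A n) (psi t)%:E)%E.
  rewrite [LHS]integral_mkcond [RHS]integral_mkcond; apply: eq_integral => t _.
  rewrite /patch; case: ifPn => [|]; last first.
    move=> ti; case: ifPn => // /set_mem/AI ti'; move: ti; rewrite mem_set //.
  rewrite inE /= in_itv /= => t02; case: ifPn => // tA'.
  have [Et|nEt] := pselect (E (expi t)); first by rewrite log_dist0.
  have : (@unit_circle R `\` E) (expi t) by split => //; exact: cmod_expi.
  rewrite UE => -[n Nn tn]; move: tA'; rewrite mem_set //.
  by exists n => //; rewrite /A mem_set.
rewrite ge0_integral_bigcup //; last exact: mpsi.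
pose c : R := 8 * (ln 8 + 1).
have c0 : 0 <= c by rewrite mulr_ge0 // addr_ge0 // ln_ge0 // ler1n.
pose u n : \bar R := if n \in N then `|((b n - a n) * ln (b n - a n)^-1)%:E|%E else 0%E.
have u0 n : (0 <= u n)%E by rewrite /u; case: ifPn.
have key n : (\int[leb]_(t in A n) (psi t)%:E <= 4%:E * u n + c%:E * leb (A n))%E.
  rewrite /u /A; case: ifPn => nN; last first.
    by rewrite integral_set0 mule0 measure0 mule0 adde0.
  have /andP[h1 h2] := abN n (set_mem nN).
  have l0 : 0 < b n - a n by rewrite subr_gt0.
  apply: le_trans (integral_log_dist_arc_le h1 h2 _) _.
    move=> w Ew aw; have : (@unit_circle R `\` E) w.
      by rewrite UE; exists n => //; exact: set_mem.
    by case.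
  have := arc_angles_measure_ge h1 h2 => hm.
  apply: (@le_trans _ _ (4%:E * `|((b n - a n) * ln (b n - a n)^-1)%:E| +
      c%:E * ((b n - a n) / 2)%:E)%E); last first.
    by apply: leeD => //; apply: lee_wpmul2l => //; rewrite lee_fin.
  rewrite abse_EFin -!EFinM -EFinD lee_fin lnV ?posrE //.
  have := ler_norm ((b n - a n) * - ln (b n - a n)); rewrite /c; nra.
have AL : (leb (\bigcup_n A n) < +oo)%E.
  apply: (@le_lt_trans _ _ (leb `[0%R, (2 * pi)%R[%classic)).
    by apply: le_measure => //; rewrite inE //; exact: bigcupT_measurable.
  by rewrite lebesgue_measure_itv /=; case: ifP => // _; rewrite -EFinB ltry.
apply: (@le_lt_trans _ _ (\sum_(n <oo) (4%:E * u n + c%:E * leb (A n)))%E).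
  by apply: lee_nneseries => [n _ _|n _]; [exact: integral_ge0|exact: key].
rewrite nneseriesD //; last 2 first.
- by move=> n _ _; rewrite mule_ge0 // lee_fin.
- by move=> n _ _; rewrite mule_ge0 // lee_fin.
rewrite !nneseriesZl //.
apply: lte_add_pinfty.
  rewrite lte_mul_pinfty ?lee_fin //.
  rewrite nneseries_esumT // -esum_mkcond; exact: sN.
rewrite lte_mul_pinfty ?lee_fin // -measure_semi_bigcup //.
exact: bigcupT_measurable.
Qed.

End LogDistanceIntegrable.

(** * A Poisson integral that is large near the set *)

Section LogPoisson.
Variable R : realType.
Local Notation cm := (@complex_modulus R).
Local Notation leb := (@lebesgue_measure R).
Variable E : set R[i].
Hypotheses (E0 : E !=set0) (Ecl : @closed R[i]^o E) (ET : E `<=` @unit_circle R)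
  (Enull : circle_lebesgue E = 0%E)
  (Elog : leb.-integrable `[0, 2 * pi[ (fun t => (log_dist E t)%:E)).

Definition angles_off : set R := [set t | 0 <= t < 2 * pi /\ ~ E (expi t)].
Definition angles_in : set R := [set t | 0 <= t < 2 * pi /\ E (expi t)].

Lemma measurable_angles_off : measurable angles_off.
Proof.
have -> : angles_off = `[0, 2 * pi[ `&` ((fun t => circle_dist E (expi t)) @^-1` `]0, +oo[).
  apply/seteqP; split => t /=; rewrite !in_itv /= andbT => -[h1 h2]; split => //.
    exact: circle_dist_gt0.
  by move=> /(circle_dist0 E0) h; rewrite h ltxx in h2.
have m : measurable_fun `[0, 2 * pi[ (fun t => circle_dist E (expi t)).
  exact: (measurable_funTS (measurable_circle_dist E0)).
by apply: m => //; exact: measurable_itv.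
Qed.

Lemma measurable_angles_in : measurable angles_in.
Proof.
have -> : angles_in = `[0, 2 * pi[ `\` angles_off.
  apply/seteqP; split => t /=; rewrite !in_itv /= => -[h1 h2]; split => //.
    by case.
  by apply: contrapT => h; apply: h2.
by apply: measurableD; [exact: measurable_itv|exact: measurable_angles_off].
Qed.

(** The summand [ln 2] compensates the constants in [log_potential_ge], and the
    constant [L] will absorb additive constants. *)
Definition log_density (K L t : R) : R := K * (log_dist E t + ln 2) + L.

Lemma log_density_ge0 K L t : 0 <= K -> 0 <= L -> 0 <= log_density K L t.
Proof.
move=> K0 L0; rewrite addr_ge0 // mulr_ge0 // addr_ge0 ?log_dist_ge0 // ln_ge0 //.
exact: ler1n.
Qed.

Lemma integrable_bounded_set (D : set R) (f : R -> R) (M : R) : measurable D ->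
  (leb D < +oo)%E -> measurable_fun D f -> (forall t, D t -> `|f t| <= M) ->
  leb.-integrable D (fun t => (f t)%:E).
Proof.
move=> mD fD mf fM; apply: measurable_bounded_integrable => //.
exists M; split; first exact: num_real.
by move=> x Mx t Dt /=; apply: le_trans (ltW Mx); exact: fM.
Qed.

Lemma angles_off_fin : (leb angles_off < +oo)%E.
Proof.
apply: (@le_lt_trans _ _ (leb `[0%R, (2 * pi)%R[%classic)).
  apply: le_measure; rewrite ?inE //; first exact: measurable_angles_off.
  by move=> t [] /=; rewrite in_itv.
by rewrite lebesgue_measure_itv /=; case: ifP => // _; rewrite -EFinB ltry.
Qed.

Lemma integrable_log_density K L :
  leb.-integrable angles_off (fun t => (log_density K L t)%:E).
Proof.
have mD := measurable_angles_off.
have fin := angles_off_fin.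
have i1 : leb.-integrable angles_off (fun t => (log_dist E t)%:E).
  apply: integrableS Elog => //.
  by move=> t [] /=; rewrite in_itv.
have ic (c : R) : leb.-integrable angles_off (fun=> c%:E).
  by apply: (@integrable_bounded_set _ _ `|c|) => //; exact: measurable_cst.
have i2 : leb.-integrable angles_off (fun t => (K%:E * ((log_dist E t)%:E + (ln 2)%:E))%E).
  by apply: integrableZl => //; exact: integrableD.
exact: (integrableD _ i2 (ic L)).
Qed.

Definition log_potential K L : R[i] -> R :=
  poisson_integral leb angles_off (@expi R) (log_density K L).

Lemma polar (z : R[i]) : exists2 a, 0 <= a < 2 * pi & z = (cm z)%:C * expi a.
Proof.
have [->|z0] := eqVneq z 0.
  by exists 0; rewrite ?lexx ?mulr_gt0 ?pi_gt0 // cmod0 mul0r.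
have c0 : 0 < cm z by rewrite cmod_gt0.
have cC : (cm z)%:C != 0 by rewrite (inj_eq (@complexI R) (cm z) 0) gt_eqF.
have [|a a2 E'] := @expi_param0 R (z / (cm z)%:C).
  by rewrite cmod_div cmod_real ger0_norm ?cmod_ge0 // divff // gt_eqF.
by exists a => //; rewrite -E' mulrC divfK.
Qed.

Lemma interval_angles (a d : R) : 0 <= a < 2 * pi -> 0 < d <= 1 ->
  exists I : set R, [/\ measurable I, leb I = d%:E, I `<=` `[0, 2 * pi[ &
    forall t, I t -> `|t - a| <= d].
Proof.
move=> /andP[a0 a2] /andP[d0 d1]; have p2 := pi_ge2 R.
have [ap|ap] := leP a pi.
  exists `[a, a + d[%classic; split; first exact: measurable_itv.
  - rewrite lebesgue_measure_itv /= lte_fin ifT; last by lra.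
    by rewrite -EFinB; congr EFin; ring.
  - by move=> t; rewrite /= !in_itv /= => /andP[t1 t2]; apply/andP; split; lra.
  - by move=> t; rewrite /= in_itv /= => /andP[t1 t2]; rewrite ler_norml; apply/andP; split; lra.
exists `]a - d, a]%classic; split; first exact: measurable_itv.
- rewrite lebesgue_measure_itv /= lte_fin ifT; last by lra.
  by rewrite -EFinB; congr EFin; ring.
- by move=> t; rewrite /= !in_itv /= => /andP[t1 t2]; apply/andP; split; lra.
- by move=> t; rewrite /= in_itv /= => /andP[t1 t2]; rewrite ler_norml; apply/andP; split; lra.
Qed.

Lemma measurable_cos : measurable_fun setT (@cos R).
Proof. by apply: continuous_measurable_fun; exact: continuous_cos. Qed.

Lemma measurable_sin : measurable_fun setT (@sin R).
Proof. by apply: continuous_measurable_fun; exact: continuous_sin. Qed.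

Lemma integrable_log_potential K L z : 0 <= K -> 0 <= L -> cm z < 1 ->
  leb.-integrable angles_off (fun t => (poisson z (expi t) * log_density K L t)%:E).
Proof.
move=> K0 L0 z1; apply: integrable_poisson => //.
- exact: measurable_angles_off.
- by apply: measurable_funTS; exact: measurable_cos.
- by apply: measurable_funTS; exact: measurable_sin.
- by move=> t _; exact: cmod_expi.
- by move=> t _; exact: log_density_ge0.
- exact: integrable_log_density.
Qed.

(** On an arc of length [d = 1 - cm z] close to [z] the Poisson kernel is at least
    [(4 * d)^-1], and the distance to [E] is at most a multiple of the square
    root of [d], so that [log_dist] is there at least one half of [- ln d] up to
    a constant. The arc has full measure off [E] because [E] is a null set. *)
Lemma log_potential_ge K L z w : 0 <= K -> 0 <= L -> cm z < 1 -> E w ->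
  cm (z - w) ^+ 2 <= 4 * (1 - cm z) ->
  K / 8 * - ln (1 - cm z) + L / 4 <= log_potential K L z.
Proof.
move=> K0 L0 z1 Ew zw; set d := 1 - cm z.
have zc := cmod_ge0 z.
have d0 : 0 < d by rewrite /d; lra. have d1 : d <= 1 by rewrite /d; lra.
have [a a2 zE] := polar z.
have [|I [mI lI I2 Ia]] := @interval_angles a d a2; first by rewrite d0.
have mD := measurable_angles_off.
pose c := (4 * d)^-1 * (K / 2 * - ln d + L).
have ln0 : 0 <= - ln d by rewrite oppr_ge0 ln_le0.
have c0 : 0 <= c.
  rewrite /c mulr_ge0 ?invr_ge0 ?mulr_ge0 ?(ltW d0) // addr_ge0 // mulr_ge0 // divr_ge0 //.
have lID : (d%:E <= leb (I `&` angles_off))%E.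
  rewrite -lI; apply: (@le_trans _ _ (leb ((I `&` angles_off) `|` angles_in))).
    apply: le_measure; rewrite ?inE //.
      apply: measurableU; last exact: measurable_angles_in.
      exact: measurableI.
    move=> t It; have := I2 t It; rewrite /= in_itv /= => t2.
    by have [Et|nEt] := pselect (E (expi t)); [right|left].
  apply: le_trans (measureU2 _ _ _) _ => //.
  - exact: measurableI.
  - exact: measurable_angles_in.
  - rewrite -[leRHS]adde0; apply: leeD => //.
    by have h : leb angles_in = 0%E by []; rewrite -h.
have i1 : leb.-integrable angles_off (fun t => (\1_I t)%:E).
  apply: (@integrable_bounded_set _ _ 1) => //; first exact: angles_off_fin.
  by move=> t _; rewrite indicE; case: (_ \in _); rewrite ?normr1 ?normr0.
have iI : leb.-integrable angles_off (fun t => (c * \1_I t)%:E).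
  exact: (integrableZl _ c i1).
apply: (@le_trans _ _ (Rintegral leb angles_off (fun t => c * \1_I t))).
  rewrite RintegralZl // /Rintegral integral_indic // -[leLHS]mulr1.
  have -> : K / 8 * - ln d + L / 4 = c * d by rewrite /c; field; rewrite gt_eqF.
  rewrite mulr1 ler_wpM2l // -lee_fin fineK //.
  rewrite ge0_fin_numE //; apply: (@le_lt_trans _ _ (leb I)); last by rewrite lI ltry.
  by apply: le_measure; rewrite ?inE //; exact: measurableI.
apply: le_Rintegral => //; first exact: integrable_log_potential.
move=> t [t2 nEt]; have q0 := log_density_ge0 t K0 L0.
have p0 := poisson_ge0 (expi t) z1.
rewrite indicE; have [|_] := boolP (t \in I); last by rewrite mulr0 mulr_ge0.
rewrite inE mulr1 => It.
have ctz : cm (expi t - z) <= 2 * d.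
  apply: le_trans (cmod_tri (expi a) _ _) _.
  have -> : cm (expi a - z) = d.
    rewrite {1}zE -{1}[expi a]mul1r -mulrBl cmodM cmod_expi mulr1.
    by rewrite -(rmorph1 (real_complex R)) -rmorphB cmod_real ger0_norm // ltW.
  have := le_trans (chord_le t a) (Ia t It); lra.
rewrite /c ler_pM //.
- by rewrite invr_ge0 mulr_ge0 // ltW.
- by rewrite addr_ge0 // mulr_ge0 // divr_ge0.
- have := @poisson_ge R z (expi t) (2 * d) z1 (sub_cmod_gt0 (cmod_expi t) z1) ctz.
  apply: le_trans; rewrite -/d le_eqVlt; apply/orP; left; apply/eqP.
  by field; rewrite gt_eqF.
pose sd := Num.sqrt d; have sd0 : 0 < sd by rewrite sqrtr_gt0.
have sd2 : sd ^+ 2 = d by rewrite sqr_sqrtr // ltW.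
have sd1 : sd <= 1 by rewrite -sqrtr1 ler_wsqrtr.
have zw2 : cm (z - w) <= 2 * sd.
  rewrite -(ler_pXn2r (n := 2)) ?nnegrE ?cmod_ge0 ?mulr_ge0 ?(ltW sd0) //.
  by apply: le_trans zw _; rewrite exprMn sd2 /d; lra.
have tw : cm (expi t - w) <= 4 * sd.
  apply: le_trans (cmod_tri z _ _) _; rewrite -sd2 expr2 in ctz.
  have : sd * sd <= sd * 1 by rewrite ler_wpM2l // ltW.
  lra.
have := log_dist_ge E0 Ecl nEt Ew tw.
have -> : ln (2 / (4 * sd)) = - ln 2 - ln d / 2.
  have -> : 2 / (4 * sd) = (2 * sd)^-1 by field; rewrite gt_eqF.
  have -> : ln d = ln sd *+ 2 by rewrite -lnXn // sd2.
  by rewrite lnV ?posrE ?mulr_gt0 // lnM ?posrE // mulr2n; field.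
move=> h; rewrite /log_density lerD2r.
have : K * (- ln d / 2) <= K * (log_dist E t + ln 2) by rewrite ler_wpM2l //; lra.
lra.
Qed.

End LogPoisson.

(** * Potentials on the circle *)

(** What the maximum principle requires of a Poisson integral, in a form that
    is closed under sums: a Lipschitz constant on smaller discs, and the
    inequality between the mean over four points and the value at the centre
    up to an error of order four. *)
Definition superharmonic_in_disc (R : realType) (P : R[i] -> R) :=
  (forall r : R, 0 < r -> exists2 C : R, 0 <= C &
     forall z z', r <= 1 - @complex_modulus R z -> r <= 1 - @complex_modulus R z' ->
     `|P z - P z'| <= C * @complex_modulus R (z - z')) /\
  (forall z, @complex_modulus R z < 1 -> exists2 C : R, 0 <= C &
     forall h : R, 0 < h -> h <= (1 - @complex_modulus R z) / 2 ->
     P (z + h%:C) + P (z - h%:C) + P (z + 'i * h%:C) + P (z - 'i * h%:C) <=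
     4 * P z + C * h ^+ 4).

Lemma superharmonic_in_discD (R : realType) (P Q : R[i] -> R) :
  superharmonic_in_disc P -> superharmonic_in_disc Q ->
  superharmonic_in_disc (fun z => P z + Q z).
Proof.
move=> [P1 P4] [Q1 Q4]; split=> [r r0|z z1].
  have [C C0 PC] := P1 r r0; have [C' C'0 QC] := Q1 r r0.
  exists (C + C') => [|z z' rz rz']; first exact: addr_ge0.
  have -> : P z + Q z - (P z' + Q z') = (P z - P z') + (Q z - Q z') by ring.
  by apply: le_trans (ler_normD _ _) _; rewrite mulrDl lerD ?PC ?QC.
have [C C0 PC] := P4 z z1; have [C' C'0 QC] := Q4 z z1.
exists (C + C') => [|h h0 hz]; first exact: addr_ge0.
have := lerD (PC h h0 hz) (QC h h0 hz); lra.
Qed.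

Lemma poisson_integral_superharmonic (R : realType) (d : measure_display)
    (X : measurableType d) (m : {measure set X -> \bar R}) (D : set X)
    (v : X -> R[i]) (phi : X -> R) : measurable D ->
  measurable_fun D (fun x => complex.Re (v x)) ->
  measurable_fun D (fun x => complex.Im (v x)) ->
  (forall x, D x -> @complex_modulus R (v x) = 1) -> (forall x, D x -> 0 <= phi x) ->
  m.-integrable D (fun x => (phi x)%:E) ->
  superharmonic_in_disc (poisson_integral m D v phi).
Proof.
move=> mD mRe mIm v1 phi0 iphi; have I0 : 0 <= Rintegral m D phi by exact: Rintegral_ge0.
split=> [r r0|z z1].
  exists (2 / r ^+ 2 * Rintegral m D phi) => [|z z' rz rz'].
    by apply: mulr_ge0 => //; rewrite divr_ge0 ?sqr_ge0.
  exact: poisson_integral_lipschitz.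
exists (16 / (1 - @complex_modulus R z) ^+ 5 * Rintegral m D phi) => [|h h0 hz].
  by apply: mulr_ge0 => //; rewrite divr_ge0 // exprn_ge0 // subr_ge0 ltW.
exact: poisson_integral4.
Qed.

Section PotentialBound.
Variable R : realType.
Local Notation cm := (@complex_modulus R).
Local Notation leb := (@lebesgue_measure R).
Local Notation T := (@unit_circle R : set (borelC R)).

Section CirclePotential.
Variables (mu : {finite_measure set (borelC R) -> \bar R}) (A : set (borelC R)).
Hypotheses (mA : measurable A) (AT : A `<=` T).

Definition circle_potential (z : R[i]) : R :=
  poisson_integral mu A (fun w : borelC R => w : R[i]) (fun=> 1) z.

Let mRe : measurable_fun A (fun w : borelC R => complex.Re (w : R[i])).
Proof. by apply: measurable_funTS; exact: measurable_ReC. Qed.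

Let mIm : measurable_fun A (fun w : borelC R => complex.Im (w : R[i])).
Proof. by apply: measurable_funTS; exact: measurable_ImC. Qed.

Let i1 : mu.-integrable A (fun=> 1%:E).
Proof.
apply: measurable_bounded_integrable => //.
  by rewrite ltey_eq fin_num_measure.
exists 1; split; first exact: num_real.
by move=> x Mx w Tw /=; rewrite normr1 ltW.
Qed.

Lemma integrable_circle_potential z : cm z < 1 ->
  mu.-integrable A (fun w : borelC R => (poisson z w * 1)%:E).
Proof. by move=> z1; apply: integrable_poisson => // w /AT. Qed.

Lemma circle_potential_superharmonic : superharmonic_in_disc circle_potential.
Proof. by apply: poisson_integral_superharmonic => // w /AT. Qed.

Lemma circle_potential_le (c : R) z : cm z < 1 -> 0 <= c ->
  (forall w, A w -> poisson z w <= c) ->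
  circle_potential z <= c * fine (mu A).
Proof.
move=> z1 c0 H; rewrite -Rintegral_cst //; apply: le_Rintegral => //.
- exact: integrable_circle_potential.
- have := integrableZl mA c i1; by under eq_fun do rewrite -EFinM mulr1.
- by move=> w Aw; rewrite mulr1; exact: H.
Qed.

End CirclePotential.

Lemma cmod_singular_inner (mu : {finite_measure set (borelC R) -> \bar R})
    (A : set (borelC R)) z : measurable A -> A `<=` T -> cm z < 1 ->
  cm (singular_inner mu z) =
  expR (- (circle_potential mu A z + circle_potential mu (T `\` A) z)).
Proof.
move=> mA AT z1; have mT := @measurable_unit_circle R.
have mTA : measurable (T `\` A) by exact: measurableD.
rewrite /singular_inner cmod_cexp ReN; congr (expR (- _)).
rewrite /circle_potential /poisson_integral -Rintegral_setU //; last 2 first.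
- by rewrite setDUK //; exact: integrable_circle_potential.
- apply/disj_setPS => w [Aw [_ nAw]]; exact: nAw.
rewrite setDUK //= /cintegral /=; apply: eq_Rintegral => w; rewrite inE => Tw.
by rewrite mulr1 poissonE.
Qed.

End PotentialBound.

(** * Domination of the potential of the measure carried by the set *)

Lemma lipschitz_continuousC (R : realType) (f : R[i]^o -> R) :
  (forall z w, `|f z - f w| <= @complex_modulus R (z - w)) -> continuous f.
Proof.
move=> H z; have FF : Filter (nbhs z) by exact: nbhs_filter.
apply: (proj2 (@cvgrPdist_lt _ _ _ (nbhs z) FF f (f z))) => e e0.
apply/nbhs_cmod; exists e => // w; exact: le_lt_trans (H z w).
Qed.

Section DominatedPotential.
Variable R : realType.
Local Notation cm := (@complex_modulus R).
Local Notation leb := (@lebesgue_measure R).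
Local Notation T := (@unit_circle R : set (borelC R)).
Variable E : set R[i].
Hypotheses (E0 : E !=set0) (Ecl : @closed R[i]^o E) (ET : E `<=` @unit_circle R)
  (Enull : circle_lebesgue E = 0%E)
  (Elog : leb.-integrable `[0, 2 * pi[ (fun t => (log_dist E t)%:E)).

Lemma log_potential_superharmonic K L : 0 <= K -> 0 <= L ->
  superharmonic_in_disc (log_potential E K L).
Proof.
move=> K0 L0; apply: poisson_integral_superharmonic.
- exact: measurable_angles_off.
- by apply: measurable_funTS; exact: measurable_cos.
- by apply: measurable_funTS; exact: measurable_sin.
- by move=> t _; exact: cmod_expi.
- by move=> t _; exact: log_density_ge0.
- exact: integrable_log_density.
Qed.

Lemma log_potentialD K L : 0 <= K -> 0 <= L -> forall z, cm z < 1 ->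
  log_potential E K L z = log_potential E K 0 z + log_potential E 0 L z.
Proof.
move=> K0 L0 z z1; rewrite /log_potential /poisson_integral -RintegralD //.
- by apply: eq_Rintegral => t _; rewrite /log_density; ring.
- exact: measurable_angles_off.
- exact: integrable_log_potential.
- exact: integrable_log_potential.
Qed.

(** The largest value at [z] of the Poisson kernels with pole in [E] is
    [(1 - cm z ^+ 2) / circle_dist E z ^+ 2]; it exceeds [1] exactly when
    [approach z < 1], that is, when [z] is in the disc with diameter from [0] to
    [w] for some [w] in [E]. On the boundary of this region in the unit disc,
    the potential of a measure on [E] is at most its mass. *)
Definition approach z : R := circle_dist E z ^+ 2 + cm z ^+ 2.

Lemma continuous_cmod : continuous (cm : R[i]^o -> R).
Proof.
apply: lipschitz_continuousC => z w; rewrite ler_norml; apply/andP; split.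
  rewrite cmodC; have := cmodB_ge w z; lra.
exact: cmodB_ge.
Qed.

Lemma continuous_approach : continuous (approach : R[i]^o -> R).
Proof.
have c1 : continuous (circle_dist E : R[i]^o -> R).
  by apply: lipschitz_continuousC => z w; exact: circle_dist_lipschitz.
have c2 := continuous_cmod.
move=> z; have FF : Filter (nbhs (z : R[i]^o)) by exact: nbhs_filter.
rewrite /approach; under eq_fun do rewrite !expr2.
apply: (cvgD (F := nbhs z)); apply: (cvgM (F := nbhs z)); by [exact: c1|exact: c2].
Qed.

(** Since [1 - cm z ^+ 2 <= 2 * (1 - cm z)], the closure of the region lies where
    [log_potential_ge] applies; the remaining factor [2] is there because the
    infimum defining [circle_dist] is only approached. *)
Lemma approach_point z : cm z < 1 -> approach z <= 1 ->
  exists2 w, E w & cm (z - w) ^+ 2 <= 4 * (1 - cm z).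
Proof.
move=> z1 az; apply: contrapT => H; have zc := cmod_ge0 z.
pose s := Num.sqrt (1 - cm z).
have s2 : s ^+ 2 = 1 - cm z by rewrite sqr_sqrtr // subr_ge0 ltW.
have s0 : 0 <= s by exact: sqrtr_ge0.
have : 2 * s <= circle_dist E z.
  apply: (circle_dist_ge E0) => w Ew; rewrite leNgt; apply/negP => zw; apply: H; exists w => //.
  have -> : 4 * (1 - cm z) = (2 * s) ^+ 2 by rewrite exprMn s2; ring.
  by rewrite ler_pXn2r ?nnegrE ?cmod_ge0 ?mulr_ge0 // ltW.
move=> h; have : (2 * s) ^+ 2 <= circle_dist E z ^+ 2.
  by rewrite ler_pXn2r ?nnegrE ?circle_dist_ge0 ?mulr_ge0.
rewrite exprMn s2; move: az; rewrite /approach; nra.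
Qed.

Lemma poisson_le1 z w : 1 <= approach z -> E w -> cm z < 1 -> poisson z w <= 1.
Proof.
move=> az Ew z1; have wz := sub_cmod_gt0 (ET Ew) z1.
rewrite /poisson ler_pdivrMr ?exprn_gt0 // mul1r cmodC.
have h := circle_dist_le z Ew; have d0 := circle_dist_ge0 E0 z.
move: az; rewrite /approach; nra.
Qed.

Variable mu : {finite_measure set (borelC R) -> \bar R}.
Local Notation S := (singular_inner mu).

(** The maximum principle is applied in the part of the region that lies in the
    disc of radius [r]. On the boundary [approach z = 1], the potential of [mu] on
    [E] is bounded, so the growth hypothesis bounds [p] times the exponential
    of the other potential by a power of [(1 - cm z)^-1], which the
    logarithmic potential compensates. On the circle of radius [r] it is enough
    that [p] is bounded on the unit disc, if [r] is close to one; this is why a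
    power [k.+1] with one unit to spare is used. *)
Lemma polynomial_bound (p : {poly R[i]}) (C : R) (k : nat) : 0 <= C ->
  (forall z, cm z < 1 -> cm (p.[z] * S z) <= C * (1 - cm z) ^- k.+1) ->
  forall z, cm z < 1 -> approach z < 1 ->
  cm p.[z] * expR (- (circle_potential mu (T `\` E) z +
                      log_potential E (8 * k.+1%:R) 0 z)) <=
  C * expR (fine (mu E)) + 1.
Proof.
move=> C0 G z0 z01 az0; set m := fine (mu E); set K : R := 8 * k.+1%:R.
have K0 : 0 <= K by rewrite mulr_ge0.
have mE : measurable (E : set (borelC R)) by exact: closed_measurableC.
have mTE : measurable (T `\` E).
  by apply: measurableD => //; exact: measurable_unit_circle.
have [M M0 pM] : exists2 M : R, 0 <= M & forall z, cm z <= 1 -> cm p.[z] <= M.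
  have [L L0 pL] := lipschitz_horner p 1.
  exists (cm p.[0] + L) => [|z z1]; first by rewrite addr_ge0 ?cmod_ge0.
  rewrite -[p.[z]](subrK p.[0]) addrC; apply: le_trans (cmodD _ _) _.
  rewrite lerD2l; apply: le_trans (pL _ _ z1 _) _; first by rewrite cmod0.
  by rewrite subr0 ler_piMr.
have [r [r0 zr r1 Mr]] : exists r : R, [/\ 0 <= r, cm z0 < r, r < 1 & M * (1 - r) <= 1].
  pose e := Num.min ((1 - cm z0) / 2) (M + 1)^-1; exists (1 - e).
  have e0 : 0 < e by rewrite lt_min invr_gt0; apply/andP; split; lra.
  have e1 : e <= (1 - cm z0) / 2 by rewrite ge_min lexx.
  have e2 : e <= (M + 1)^-1 by rewrite ge_min lexx orbT.
  have zc := cmod_ge0 z0; split; [lra|lra|lra|].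
  have -> : 1 - (1 - e) = e by ring.
  apply: le_trans (ler_wpM2l M0 e2) _; rewrite ler_pdivrMr; lra.
pose A : set R[i]^o := [set z | cm z <= r /\ approach z <= 1].
pose U : set R[i]^o := [set z | cm z < r /\ approach z < 1].
have Ar z : A z -> cm z < 1 by case=> h _; exact: le_lt_trans h r1.
have SH : superharmonic_in_disc (fun z => circle_potential mu (T `\` E) z +
    log_potential E K 0 z).
  apply: superharmonic_in_discD; last exact: log_potential_superharmonic.
  by apply: circle_potential_superharmonic => // w [].
have [Plip P4] := SH.
pose P z := circle_potential mu (T `\` E) z + log_potential E K 0 z.
have UA z : U z -> A z by case=> h1 h2; split; exact: ltW.
have Qd z : A z -> expR (- log_potential E K 0 z) <= (1 - cm z) ^+ k.+1.
  move=> Az; have z1 := Ar z Az; have [w Ew zw] := approach_point z1 Az.2.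
  have d0 : 0 < 1 - cm z by lra.
  rewrite -[leRHS]lnK ?posrE ?exprn_gt0 // ler_expR lnXn // lerNl.
  have := log_potential_ge E0 Ecl ET Enull Elog K0 (lexx 0) z1 Ew zw.
  have -> : K / 8 = k.+1%:R by rewrite /K; field.
  by rewrite mul0r addr0 mulrN mulr_natl.
apply: (@maximum_principle _ p P A U) => //; last first.
- by split; exact: ltW.
- move=> z Az nU; have z1 := Ar z Az; have d0 : 0 < 1 - cm z by lra.
  rewrite /P opprD expRD mulrA.
  have [zr'|rz] := ltP (cm z) r.
    have az : 1 <= approach z by rewrite leNgt; apply/negP => h; apply: nU.
    have Pm : circle_potential mu E z <= m.
      rewrite -[leRHS]mul1r; apply: circle_potential_le => // w Ew.
      exact: poisson_le1.
    have := G z z1; rewrite cmodM (@cmod_singular_inner _ _ E) // opprD addrC expRD mulrA.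
    rewrite [X in _ * X]expRN ler_pdivrMr ?expR_gt0 // => h.
    have h2 : C * (1 - cm z) ^- k.+1 * expR (circle_potential mu E z) <=
        C * (1 - cm z) ^- k.+1 * expR m.
      apply: ler_wpM2l; last by rewrite ler_expR.
      by apply: mulr_ge0 => //; rewrite invr_ge0 exprn_ge0 // ltW.
    apply: le_trans (ler_pM _ _ (le_trans h h2) (Qd z Az)) _.
    + by rewrite mulr_ge0 ?cmod_ge0 ?expR_ge0.
    + exact: expR_ge0.
    rewrite mulrAC mulfVK ?gt_eqF ?exprn_gt0 //; lra.
  have Ps0 : 0 <= circle_potential mu (T `\` E) z.
    by apply: poisson_integral_ge0 => // w [].
  have h1 : cm p.[z] * expR (- circle_potential mu (T `\` E) z) <= M * 1.
    rewrite ler_pM ?cmod_ge0 ?expR_ge0 ?pM ?(ltW z1) //.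
    by rewrite -expR0 ler_expR oppr_le0.
  have h2 : (1 - cm z) ^+ k.+1 <= 1 - r.
    rewrite exprS; apply: le_trans (_ : (1 - cm z) * 1 <= _); last by rewrite mulr1; lra.
    by rewrite ler_wpM2l ?(ltW d0) // exprn_ile1 // ?(ltW d0) //; have := cmod_ge0 z; lra.
  apply: le_trans (ler_pM _ _ h1 (le_trans (Qd z Az) h2)) _.
  + by rewrite mulr_ge0 ?cmod_ge0 ?expR_ge0.
  + exact: expR_ge0.
  by rewrite mulr1; apply: le_trans Mr _; rewrite lerDr mulr_ge0 ?expR_ge0.
- by rewrite addr_ge0 // mulr_ge0 ?expR_ge0.
- move=> z /UA/Ar z1; have [D D0 H] := P4 z z1.
  exists D, ((1 - cm z) / 2); split=> //; first by rewrite divr_gt0 // subr_gt0.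
  by move=> h h0 hz; apply: H => //; exact: ltW.
- move=> z Az e e0; have [|L L0 H] := Plip (1 - r); first by rewrite subr_gt0.
  exists (e / (L + 1)) => [|w Aw zw]; first by rewrite divr_gt0 // ltr_wpDl.
  apply: le_lt_trans (H z w _ _) _.
  + by rewrite lerD2l lerN2; exact: Az.1.
  + by rewrite lerD2l lerN2; exact: Aw.1.
  move: zw; rewrite ltr_pdivlMr ?ltr_wpDl // => h.
  by have := cmod_ge0 (z - w); nra.
- move=> z Uz; split; first exact: UA.
  have /open_cmodP/(_ z Uz)[e e0 eU] : open U.
    apply: openI; first exact: open_comp (fun z _ => @continuous_cmod z) (@open_lt _ r).
    exact: open_comp (fun z _ => @continuous_approach z) (@open_lt _ 1).
  by exists e => // w /eU/UA.
- by move=> z /Ar/ltW.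
- apply: (@compact_cmod _ _ r); last by move=> z [].
  apply: closedI.
    exact: preimage_closed (fun z _ => @continuous_cmod z) (@closed_le _ r).
  exact: preimage_closed (fun z _ => @continuous_approach z) (@closed_le _ 1).
Qed.

(** Two bounds for the modulus of [P n * S], from above by [polynomial_bound]
    and from below by one half, are compared at [z]; the former is
    uniform in [n], while [n] in the latter depends on [z]. *)
Lemma potential_dominated (P : nat -> {poly R[i]}) (C : R) (k N : nat) : 0 <= C ->
  (forall n z, (N <= n)%N -> cm z < 1 ->
     cm ((P n).[z] * S z) <= C * (1 - cm z) ^- k) ->
  (forall z, cm z < 1 -> exists N' : nat, forall n, (N' <= n)%N ->
     2^-1 <= cm ((P n).[z] * S z)) ->
  exists K L : R, [/\ 0 <= K, 0 <= L & forall z, cm z < 1 -> approach z < 1 ->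
    circle_potential mu E z <= log_potential E K L z].
Proof.
move=> C0 G H; set K : R := 8 * k.+1%:R; set B := C * expR (fine (mu E)) + 1.
have K0 : 0 <= K by rewrite mulr_ge0.
have B1 : 1 <= B by rewrite lerDr mulr_ge0 // expR_ge0.
have lB : 0 <= ln (2 * B) by rewrite ln_ge0 //; lra.
exists K, (4 * ln (2 * B)); split => //; first by rewrite mulr_ge0.
move=> z z1 az; have [N' HN] := H z z1.
have mE : measurable (E : set (borelC R)) by exact: closed_measurableC.
have h1 := HN (maxn N N') (leq_maxr _ _).
have h2 : cm (P (maxn N N')).[z] * expR (- (circle_potential mu (T `\` E) z +
                      log_potential E K 0 z)) <= B.
  apply: polynomial_bound => // w w1.
  apply: le_trans (G _ _ (leq_maxl _ _) w1) _; rewrite ler_wpM2l //.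
  have wc := cmod_ge0 w; have d0 : 0 < 1 - cm w by lra.
  rewrite lef_pV2 ?posrE ?exprn_gt0 // exprS ler_piMl ?exprn_ge0 ?(ltW d0) //; lra.
rewrite log_potentialD ?mulr_ge0 //.
have h3 : ln (2 * B) <= log_potential E 0 (4 * ln (2 * B)) z.
  have [w Ew zw] := approach_point z1 (ltW az).
  have := log_potential_ge E0 Ecl ET Enull Elog (lexx 0) (mulr_ge0 (ler0n R 4) lB) z1 Ew zw.
  lra.
apply: le_trans (lerD (lexx _) h3).
rewrite -ler_expR expRD lnK ?posrE; last by lra.
move: h1; rewrite cmodM (@cmod_singular_inner _ _ E) // => h1.
have h4 : cm (P (maxn N N')).[z] * expR (- circle_potential mu (T `\` E) z) <=
    B * expR (log_potential E K 0 z).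
  have e0 := expR_gt0 (log_potential E K 0 z).
  move: h2; rewrite opprD expRD [X in _ * (_ * X)]expRN mulrA ler_pdivrMr //.
move: h1; rewrite opprD addrC expRD mulrA [X in _ * X]expRN ler_pdivlMr ?expR_gt0 //.
lra.
Qed.

End DominatedPotential.

(** * Coverings of the set by dyadic arcs *)

Section Covering.
Variable R : realType.
Local Notation cm := (@complex_modulus R).
Local Notation leb := (@lebesgue_measure R).

Lemma Rintegral_sum (d : measure_display) (X : measurableType d)
    (m : {measure set X -> \bar R}) (D : set X) (I : Type) (s : seq I) (Q : pred I)
    (f : I -> X -> R) : measurable D ->
  (forall i, Q i -> m.-integrable D (fun x => (f i x)%:E)) ->
  m.-integrable D (fun x => (\sum_(i <- s | Q i) f i x)%:E) /\
  Rintegral m D (fun x => \sum_(i <- s | Q i) f i x) =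
  \sum_(i <- s | Q i) Rintegral m D (f i).
Proof.
move=> mD fi; elim: s => [|i s [IH1 IH2]].
  split; first by under eq_fun do rewrite big_nil; exact: integrable0.
  have -> : (fun x : X => \sum_(i <- [::] | Q i) f i x) = cst 0.
    by apply/funext => x; rewrite big_nil.
  by rewrite big_nil Rintegral_cst // mul0r.
rewrite big_cons; case: ifP => Qi; last first.
  have E : (fun x : X => \sum_(j <- i :: s | Q j) f j x) =
           (fun x => \sum_(j <- s | Q j) f j x).
    by apply/funext => x; rewrite big_cons Qi.
  by rewrite E; split => //; under eq_fun do rewrite big_cons Qi.
have E : (fun x : X => \sum_(j <- i :: s | Q j) f j x) =
         (fun x => f i x + \sum_(j <- s | Q j) f j x).
  by apply/funext => x; rewrite big_cons Qi.
rewrite E; split; last by rewrite RintegralD ?IH2 //; exact: fi.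
under eq_fun do rewrite big_cons Qi EFinD; apply: integrableD => //; exact: fi.
Qed.

Definition mesh j : R := 2 * pi / 2 ^+ j.
Definition mesh_root j : R[i] := expi (mesh j).

Lemma mesh_gt0 j : 0 < mesh j.
Proof. by rewrite divr_gt0 ?exprn_gt0 ?mulr_gt0 ?pi_gt0. Qed.

Lemma mesh_mul j : 2 ^+ j * mesh j = 2 * pi.
Proof. by rewrite /mesh mulrC divfK // expf_eq0 pnatr_eq0 andbF. Qed.

Lemma mesh_root_double j : mesh_root j.+1 ^+ 2 = mesh_root j.
Proof.
rewrite -expiMn; congr expi; rewrite /mesh exprS mulr2n; field.
by rewrite expf_eq0 pnatr_eq0 andbF.
Qed.

Lemma mesh_root_half j : mesh_root j.+1 ^+ (2 ^ j) = -1.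
Proof.
rewrite -expiMn; have -> : mesh j.+1 *+ 2 ^ j = pi.
  rewrite -mulr_natr natrX /mesh exprS; field.
  by rewrite expf_eq0 pnatr_eq0 andbF.
by rewrite /expi cospi sinpi; apply/eqP; rewrite eq_complex /= oppr0 !eqxx.
Qed.

Lemma sum_poisson_roots j z w : cm w = 1 -> cm z < 1 ->
  \sum_(i < 2 ^ j) poisson (z * mesh_root j ^+ i) w =
  2 ^+ j * poisson (z ^+ (2 ^ j)) (w ^+ (2 ^ j)).
Proof.
elim: j z w => [|j IH] z w w1 z1.
  by rewrite expn0 big_ord_recl big_ord0 addr0 /= !expr0 !mulr1 !expr1 mul1r.
have -> : (2 ^ j.+1 = 2 ^ j + 2 ^ j)%N by rewrite expnS mul2n addnn.
rewrite big_split_ord /= -big_split /=.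
transitivity (\sum_(i < 2 ^ j) 2 * poisson (z ^+ 2 * mesh_root j ^+ i) (w ^+ 2)).
  apply: eq_bigr => i _; rewrite exprD mesh_root_half mulN1r mulrN poisson_double //.
    by rewrite exprMn -exprM mulnC exprM mesh_root_double.
  by rewrite cmodM cmodX cmod_expi expr1n mulr1.
rewrite -mulr_sumr IH; last first.
- by rewrite cmodX expr_lt1 ?cmod_ge0.
- by rewrite cmodX w1 expr1n.
by rewrite mulrA -exprS -!exprM -expnS addnn -mul2n -expnS.
Qed.

Variable E : set R[i].
Hypotheses (E0 : E !=set0) (Ecl : @closed R[i]^o E) (ET : E `<=` @unit_circle R).

Definition node j i : R[i] := (1 - mesh j)%:C * mesh_root j ^+ i.

Definition near_node j i : bool := `[< exists2 w, E w & cm (w - mesh_root j ^+ i) <= mesh j >].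

Definition covering_kernel j (w : R[i]) : R :=
  \sum_(i < 2 ^ j | near_node j i) mesh j * poisson (node j i) w.

Lemma cmod_node j i : mesh j < 1 -> cm (node j i) = 1 - mesh j.
Proof.
move=> m1; rewrite cmodM cmodX cmod_expi expr1n mulr1 cmod_real ger0_norm //; lra.
Qed.

Lemma cmod_node_root j i : cm (mesh_root j ^+ i - node j i) = mesh j.
Proof.
have -> : mesh_root j ^+ i - node j i = (mesh j)%:C * mesh_root j ^+ i.
  by rewrite /node rmorphB rmorph1; ring.
by rewrite cmodM cmodX cmod_expi expr1n mulr1 cmod_real gtr0_norm // mesh_gt0.
Qed.

Lemma covering_kernel_ge0 j w : mesh j < 1 -> 0 <= covering_kernel j w.
Proof.
move=> m1; have m0 := mesh_gt0 j; apply: sumr_ge0 => i _; rewrite mulr_ge0 ?(ltW m0) //.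
by apply: poisson_ge0; rewrite cmod_node //; lra.
Qed.

(** By [1 - x <= expR (- x)], the left-hand side is at most [expR (- 2 * pi)]. *)
Lemma mesh_power_le j : mesh j < 1 -> (1 - mesh j) ^+ (2 ^ j) <= 2^-1.
Proof.
move=> m1; have m0 := mesh_gt0 j.
have h : 1 - mesh j <= expR (- mesh j) by exact: expR_ge1Dx.
have h1 : (1 - mesh j) ^+ (2 ^ j) <= expR (- mesh j) ^+ (2 ^ j).
  by rewrite lerXn2r ?nnegrE ?expR_ge0 //; lra.
apply: le_trans h1 _; rewrite -expRM_natl mulrN.
have -> : (2 ^ j)%:R * mesh j = 2 * pi.
  by rewrite natrX mesh_mul.
rewrite expRN lef_pV2 ?posrE ?expR_gt0 //.
apply: le_trans (expR_ge1Dx _); have := pi_ge2 R; lra.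
Qed.

(** The sum over all nodes is [2 * pi] times a single Poisson kernel, at a point
    of modulus at most one half. *)
Lemma covering_kernel_le j w : mesh j < 1 -> cm w = 1 -> covering_kernel j w <= 8 * pi.
Proof.
move=> m1 w1; have m0 := mesh_gt0 j; have p0 := pi_gt0 R.
have z1 : cm (1 - mesh j)%:C < 1 by rewrite cmod_real ger0_norm; lra.
apply: (@le_trans _ _ (\sum_(i < 2 ^ j) mesh j * poisson (node j i) w)).
  rewrite [leRHS](bigID (fun i : 'I_(2 ^ j) => near_node j i)) /= lerDl sumr_ge0 // => i _.
  by rewrite mulr_ge0 ?(ltW m0) // poisson_ge0 // cmod_node //; lra.
rewrite -mulr_sumr sum_poisson_roots // mulrA.
have -> : mesh j * 2 ^+ j = 2 * pi.
  by rewrite mulrC mesh_mul.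
have h := mesh_power_le m1.
have c : cm ((1 - mesh j)%:C ^+ (2 ^ j)) = (1 - mesh j) ^+ (2 ^ j).
  by rewrite cmodX cmod_real ger0_norm //; lra.
have p4 : poisson ((1 - mesh j)%:C ^+ (2 ^ j)) (w ^+ (2 ^ j)) <= 4.
  apply: le_trans (poisson_le _ _) _; rewrite ?c.
  - by rewrite cmodX w1 expr1n.
  - lra.
  rewrite ler_pdivrMr; lra.
nra.
Qed.

(** The nodes of the sum are within [2 * mesh j] of [E]; if [w] is at a fixed
    distance from [E], all the [2 ^ j] terms are of order [mesh j ^+ 2]. *)
Lemma covering_kernel_decay j w : cm w = 1 -> mesh j < 1 ->
  4 * mesh j <= circle_dist E w ->
  covering_kernel j w <= 16 * pi * mesh j / circle_dist E w ^+ 2.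
Proof.
move=> w1 m1 mw; have m0 := mesh_gt0 j; set c := circle_dist E w in mw *.
have c0 : 0 < c by lra.
apply: (@le_trans _ _ (\sum_(i < 2 ^ j) mesh j * (8 * mesh j / c ^+ 2))).
  rewrite [leRHS](bigID (fun i : 'I_(2 ^ j) => near_node j i)) /=.
  apply: ler_wpDr.
    apply: sumr_ge0 => i _; apply: mulr_ge0; first exact: ltW.
    by rewrite divr_ge0 ?sqr_ge0 // mulr_ge0 // ltW.
  apply: ler_sum => i /asboolP[u Eu ui]; rewrite ler_pM2l //.
  have h1 := circle_dist_le w Eu; rewrite -/c in h1.
  have h2 := cmod_tri (node j i) w u.
  have h3 := cmod_tri (mesh_root j ^+ i) (node j i) u.
  have h4 := cmod_node_root j i; rewrite cmodC in h4; rewrite cmodC in ui.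
  have h5 : c / 2 <= cm (w - node j i) by lra.
  rewrite /poisson cmod_node // ler_pdivrMr; last first.
    by rewrite exprn_gt0 //; lra.
  have h6 : (c / 2) ^+ 2 <= cm (w - node j i) ^+ 2.
    by rewrite lerXn2r ?nnegrE ?cmod_ge0 //; lra.
  apply: le_trans (_ : 8 * mesh j / c ^+ 2 * (c / 2) ^+ 2 <= _); last first.
    by rewrite ler_wpM2l // divr_ge0 ?sqr_ge0 // mulr_ge0 // ltW.
  have -> : 8 * mesh j / c ^+ 2 * (c / 2) ^+ 2 = 2 * mesh j by field; rewrite gt_eqF.
  nra.
rewrite sumr_const card_ord -[X in X <= _]mulr_natl natrX /mesh le_eqVlt; apply/orP; left; apply/eqP.
by field; rewrite gt_eqF //= expf_eq0 pnatr_eq0 andbF.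
Qed.

(** At [w] in [E] the single term of the vertex next to [w] is large enough. *)
Lemma covering_kernel_ge j w : mesh j < 1 -> E w -> 1 <= 4 * covering_kernel j w.
Proof.
move=> m1 Ew; have m0 := mesh_gt0 j.
have [a /andP[a0 a2] wa] := expi_param0 (ET Ew).
have am0 : 0 <= a / mesh j by rewrite divr_ge0 // ltW.
set i := Num.truncn (a / mesh j).
have /andP[i1 i2] : i%:R <= a / mesh j < i.+1%:R by exact: truncn_itv.
have ij : (i < 2 ^ j)%N.
  rewrite -(ltr_nat R) natrX; apply: le_lt_trans i1 _.
  by rewrite ltr_pdivrMr // mesh_mul.
have wi : cm (w - mesh_root j ^+ i) <= mesh j.
  rewrite wa -expiMn; apply: le_trans (chord_le _ _) _.
  rewrite -mulr_natl; move: i1 i2; rewrite ler_pdivlMr // ltr_pdivrMr // -natr1 => i1 i2.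
  rewrite ler_norml; apply/andP; split; lra.
have ni : near_node j (Ordinal ij) by apply/asboolP; exists w.
rewrite /covering_kernel (bigD1 (Ordinal ij)) //=.
have p : 1 <= 4 * (mesh j * poisson (node j i) w).
  have w2 : cm (w - node j i) <= 2 * mesh j.
    have := cmod_tri (mesh_root j ^+ i) w (node j i); rewrite cmod_node_root; lra.
  have z1 : cm (node j i) < 1 by rewrite cmod_node //; lra.
  have := poisson_ge z1 (sub_cmod_gt0 (ET Ew) z1) w2.
  rewrite cmod_node // => h.
  have e : 1 = 4 * (mesh j * ((1 - (1 - mesh j)) / (2 * mesh j) ^+ 2)).
    by field; rewrite gt_eqF.
  by rewrite {1}e ler_pM2l // ler_pM2l.
rewrite mulrDr; apply: le_trans p _; rewrite lerDl mulr_ge0 // sumr_ge0 // => k _.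
by rewrite mulr_ge0 ?(ltW m0) // poisson_ge0 // cmod_node //; lra.
Qed.

Lemma approach_node j i : 5 * mesh j < 2 -> near_node j i -> approach E (node j i) < 1.
Proof.
move=> m5 /asboolP[w Ew wi]; have m0 := mesh_gt0 j.
have d := circle_dist_le (node j i) Ew; have d0 := circle_dist_ge0 E0 (node j i).
have := cmod_tri (mesh_root j ^+ i) (node j i) w.
rewrite (cmodC (node j i) (mesh_root j ^+ i)) cmod_node_root
  (cmodC (mesh_root j ^+ i) w) => h.
have d2 : circle_dist E (node j i) <= 2 * mesh j by lra.
rewrite /approach cmod_node; last by lra.
have : circle_dist E (node j i) ^+ 2 <= (2 * mesh j) ^+ 2.
  by rewrite lerXn2r ?nnegrE //; lra.
nra.
Qed.

Lemma mesh_cvg0 : mesh j @[j --> \oo] --> (0 : R).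
Proof.
have -> : mesh = (fun j => 2 * pi * 2^-1 ^+ j) by apply/funext => j; rewrite /mesh exprVn.
rewrite -[X in _ --> X](mulr0 (2 * pi)); apply: cvgMr; apply: cvg_expr.
rewrite ger0_norm //; lra.
Qed.

End Covering.

Section VanishingOnE.
Variable R : realType.
Local Notation cm := (@complex_modulus R).
Local Notation leb := (@lebesgue_measure R).
Variable E : set R[i].
Hypotheses (E0 : E !=set0) (Ecl : @closed R[i]^o E) (ET : E `<=` @unit_circle R)
  (Enull : circle_lebesgue E = 0%E)
  (Elog : leb.-integrable `[0, 2 * pi[ (fun t => (log_dist E t)%:E)).
Variables (mu : {finite_measure set (borelC R) -> \bar R}) (K L : R).
Hypotheses (K0 : 0 <= K) (L0 : 0 <= L)
  (dom : forall z, cm z < 1 -> approach E z < 1 ->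
    circle_potential mu E z <= log_potential E K L z).

Let F j t := covering_kernel E j (expi t) * log_density E K L t.

Let sumF j : 5 * mesh R j < 2 ->
  leb.-integrable (angles_off E) (fun t => (F j t)%:E) /\
  Rintegral leb (angles_off E) (F j) =
  \sum_(i < 2 ^ j | near_node E j i) mesh R j * log_potential E K L (node R j i).
Proof.
move=> m5; have m0 := mesh_gt0 R j; have mD := measurable_angles_off E0 Ecl.
have ip (i : 'I_(2 ^ j)) : leb.-integrable (angles_off E)
    (fun t => (mesh R j * (poisson (node R j i) (expi t) * log_density E K L t))%:E).
  have z1 : cm (node R j i) < 1 by rewrite cmod_node; lra.
  have h := integrable_log_potential E0 Ecl ET Elog K0 L0 z1.
  exact: (integrableZl _ (mesh R j) h).
have -> : F j = fun t => \sum_(i < 2 ^ j | near_node E j i)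
    mesh R j * (poisson (node R j i) (expi t) * log_density E K L t).
  by apply/funext => t; rewrite /F mulr_suml; apply: eq_bigr => i _; rewrite mulrA.
have [//|//|h1 h2] := @Rintegral_sum R _ _ leb (angles_off E) _ (index_enum 'I_(2 ^ j))
  (fun i => near_node E j i) (fun i t =>
    mesh R j * (poisson (node R j i) (expi t) * log_density E K L t)).
split; first exact: h1.
rewrite h2; apply: eq_bigr => i _; rewrite RintegralZl //.
apply: integrable_log_potential => //; by rewrite cmod_node; lra.
Qed.

(** The sum of kernels is at least [4^-1] on [E]; the potential of [mu] on [E] at
    the nodes is at most the logarithmic potential, by domination. *)
Lemma measure_le_covering j : 5 * mesh R j < 2 ->
  fine (mu E) <= 4 * Rintegral leb (angles_off E) (F j).
Proof.
move=> m5; have m0 := mesh_gt0 R j; have [_ ->] := sumF m5.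
have mE : measurable (E : set (borelC R)) by exact: closed_measurableC.
have ip (i : 'I_(2 ^ j)) : mu.-integrable E
    (fun w : borelC R => (mesh R j * (poisson (node R j i) w * 1))%:E).
  have z1 : cm (node R j i) < 1 by rewrite cmod_node; lra.
  exact: (integrableZl _ (mesh R j) (integrable_circle_potential mu mE ET z1)).
have [h1 h2] := Rintegral_sum (index_enum 'I_(2 ^ j)) (Q := fun i => near_node E j i)
  mE (fun i _ => ip i).
have -> : fine (mu E) = Rintegral mu E (fun=> 1) by rewrite Rintegral_cst // mul1r.
apply: (@le_trans _ _ (Rintegral mu E (fun w : borelC R =>
    4 * \sum_(i < 2 ^ j | near_node E j i) mesh R j * (poisson (node R j i) w * 1)))).
  apply: le_Rintegral => //.
  - apply: measurable_bounded_integrable => //.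
      by rewrite ltey_eq fin_num_measure.
    exists 1; split; first exact: num_real.
    by move=> x Mx w Tw /=; rewrite normr1 ltW.
  - exact: (integrableZl mE 4 h1).
  move=> w Ew; have m1 : mesh R j < 1 by lra.
  apply: le_trans (covering_kernel_ge ET m1 Ew) _; rewrite ler_pM2l //.
  by apply: ler_sum => i _; rewrite mulr1.
rewrite RintegralZl // h2 ler_pM2l //; apply: ler_sum => i ni.
rewrite RintegralZl //; last first.
  by apply: integrable_circle_potential => //; rewrite cmod_node; lra.
rewrite ler_pM2l //; apply: dom; first by rewrite cmod_node; lra.
exact: approach_node.
Qed.

(** Dominated convergence: off [E] the kernels tend to zero and are bounded, and
    the logarithmic density is integrable. *)
Lemma covering_integral_cvg0 :
  Rintegral leb (angles_off E) (F j) @[j --> \oo] --> (0 : R).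
Proof.
have mD := measurable_angles_off E0 Ecl.
have q0 t : 0 <= log_density E K L t by exact: log_density_ge0.
have iq := integrable_log_density E0 Ecl Elog K L.
have [N NP] : exists N, forall j, (N <= j)%N -> 5 * mesh R j < 2.
  have /cvgrPdist_lt/(_ (2 / 5)) := @mesh_cvg0 R.
  have h : 0 < 2 / 5 :> R by lra.
  move=> /(_ h) [N _ NP]; exists N => j /NP /=.
  by rewrite sub0r normrN gtr0_norm ?mesh_gt0 //; lra.
pose f j t := (F (j + N) t)%:E.
have m5 j : 5 * mesh R (j + N) < 2 by apply: NP; exact: leq_addl.
have F0 j t : 0 <= F (j + N) t.
  by rewrite mulr_ge0 // covering_kernel_ge0 //; have := m5 j; have := mesh_gt0 R (j + N); lra.
have FK j t : F (j + N) t <= 8 * pi * log_density E K L t.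
  rewrite ler_wpM2r // covering_kernel_le ?cmod_expi //.
  by have := m5 j; have := mesh_gt0 R (j + N); lra.
have Fcvg t : angles_off E t -> F j t @[j --> \oo] --> (0 : R).
  move=> [_ nEt]; have c0 := circle_dist_gt0 E0 Ecl nEt.
  set c := circle_dist E (expi t) in c0.
  have cv : 16 * pi * mesh R j / c ^+ 2 * log_density E K L t @[j --> \oo] --> (0 : R).
    rewrite [X in _ --> X](_ : _ = 16 * pi * 0 / c ^+ 2 * log_density E K L t); last first.
      by rewrite mulr0 !mul0r.
    by apply: cvgMl; apply: cvgMl; apply: cvgMr; exact: mesh_cvg0.
  apply: squeeze_cvgr cv; last exact: cvg_cst.
  have /cvgrPdist_lt/(_ (c / 4)) := @mesh_cvg0 R.
  move=> /(_ (divr_gt0 c0 (ltr0n _ 4))) [N' _ HN].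
  exists (maxn N N') => // j /=; rewrite geq_max => /andP[jN jN'].
  have m := HN j jN'; rewrite /= sub0r normrN gtr0_norm ?mesh_gt0 // in m.
  have := F0 (j - N)%N t; rewrite subnK // => -> /=.
  rewrite ler_wpM2r // covering_kernel_decay ?cmod_expi //; last by rewrite -/c; lra.
  by have := NP j jN; have := mesh_gt0 R j; lra.
have cvgI : (\int[leb]_(x in angles_off E) f j x @[j --> \oo] -->
    \int[leb]_(x in angles_off E) (cst 0 x))%E.
  have [] := @dominated_convergence _ _ _ leb (angles_off E) _ f (cst 0%E)
    (fun t => (8 * pi)%:E * (log_density E K L t)%:E)%E => //.
  - by move=> j; have [h _] := sumF (m5 j); exact: measurable_int h.
  - apply: aeW => t Dt; apply: cvg_EFin; first exact: nearW.
    have := Fcvg t Dt; rewrite -(cvg_shiftn N); exact.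
  - exact: integrableZl.
  - by apply: aeW => t n Dt; rewrite gee0_abs ?lee_fin //.
rewrite integral0 in cvgI.
rewrite -(cvg_shiftn N) /=; exact: (fine_cvg cvgI).
Qed.

Lemma measure_vanishes : mu E = 0%E.
Proof.
have mE : measurable (E : set (borelC R)) by exact: closed_measurableC.
have fE : mu E \is a fin_num by exact: fin_num_measure.
suff h : fine (mu E) <= 0.
  apply/eqP; rewrite eq_le measure_ge0 andbT -(fineK fE) lee_fin //.
apply/ler_addgt0Pr => e e0; rewrite add0r.
have e4 : 0 < e / 4 by rewrite divr_gt0.
have /cvgrPdist_lt/(_ _ e4)[N1 _ H1] := covering_integral_cvg0.
have h : 0 < 2 / 5 :> R by lra.
have /cvgrPdist_lt/(_ _ h)[N2 _ H2] := @mesh_cvg0 R.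
have h1 := H1 _ (leq_maxl N1 N2); have h2 := H2 _ (leq_maxr N1 N2).
have m5 : 5 * mesh R (maxn N1 N2) < 2.
  by move: h2; rewrite /= sub0r normrN gtr0_norm ?mesh_gt0 //; lra.
apply: le_trans (measure_le_covering m5) _.
move: h1; rewrite /= sub0r normrN => h1; have := ler_norm (Rintegral leb (angles_off E) (F (maxn N1 N2))).
lra.
Qed.

End VanishingOnE.

Theorem corollary1p3 (R : realType)
  (mu : {finite_measure set (borelC R) -> \bar R})
  (mu_circle : mu (~` @unit_circle R) = 0%E)
  (mu_singular : circle_singular mu) :
  (exists p : R, 2 < p /\ cyclic_in_D p (singular_inner mu)) ->
  forall E : set R[i], beurling_carleson E -> mu E = 0%E.
Proof.
move=> [p [p2 [_ [P DP]]]] E [Ecl ET Enull [N [a [b [abN tN UE sN]]]]].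
have [[w0 Ew0]|/set0P/negP] := pselect (E !=set0); last first.
  by rewrite negbK => /eqP ->; exact: measure0.
have E0 : E !=set0 by exists w0.
have Elog := integrable_log_dist E0 ET abN tN UE sN.
have [C [k [M [C0 growth]]]] := cyclic_growth p2 DP.
have [K [L [K0 L0 dom]]] := potential_dominated E0 Ecl ET Enull Elog C0 growth
  (fun z z1 => cyclic_lower p2 DP z1).
exact: measure_vanishes K0 L0 dom.
Qed.
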